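(* Let $X$ be a Banach space, let $\mathcal{C}$ be one of the families $cb(X)$, $cwk(X)$, $ck(X)$, and let $\Gamma:[0,1]\to c(X)$ be a multifunction that is integrable in $\mathcal{C}$ in the sense of one of the scalarly defined integrals (Pettis, weakly McShane, Henstock-Kurzweil-Pettis, Denjoy-Khintchine-Pettis). Assume that $\Gamma$ possesses at least one selection integrable in the same sense. Then the following conditions are equivalent: (1) $\Gamma$ satisfies the $DL$-condition (respectively, the $Db$-condition); (2) $\Gamma=G+f$, where $f$ is a selection of $\Gamma$ integrable in the same sense as $\Gamma$, $G$ is Pettis integrable in $\mathcal{C}$ and $\overline{\int}_0^1 D_G(t)\,dt<\infty$ (respectively, and moreover $G$ is bounded). In particular, in (2) the indefinite Pettis integral of $G$ is of finite variation.
   Context: $c(X)$ is the family of nonempty closed convex subsets of $X$; $cb(X)$, $cwk(X)$, $ck(X)$ are the subfamilies of bounded, weakly compact and compact members. $s(x^*,C)=\sup_{x\in C}\langle x^*,x\rangle$ for $x^*\in X^*$; $\|C\|_h=\sup_{x\in C}\|x\|$. $\mathcal{I}$ is the family of closed subintervals of $[0,1]$, $\lambda$ is Lebesgue measure, $\mathcal{L}$ the Lebesgue measurable subsets of $[0,1]$. $\Gamma=G+f$ means $\Gamma(t)=G(t)+f(t)$ for $t\in[0,1]$ (translation). A selection of $\Gamma$ is a function $f:[0,1]\to X$ with $f(t)\in\Gamma(t)$. $D_\Gamma(t)=\mathrm{diam}(\Gamma(t))\in[0,\infty]$. $\overline{\int}_0^1$ is the upper integral: $\overline{\int}_0^1 g=\inf\{\int_0^1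 h\,d\lambda: h \text{ measurable}, h\ge g\}$ for $g\ge0$. $\Gamma$ satisfies the $DL$-condition if $\overline{\int}_0^1D_\Gamma(t)\,dt<\infty$, and the $Db$-condition if $\mathrm{ess\,sup}_tD_\Gamma(t)<\infty$ (i.e. for some $c<\infty$, $D_\Gamma(t)\le c$ for almost every $t$). ''$G$ is bounded'' means that there is $c<\infty$ with $\|G(t)\|_h\le c$ for almost every $t$. Integrals in $\mathcal{C}$: (Pettis) $s(x^*,\Gamma)$ is Lebesgue integrable for every $x^*\in X^*$ and for every $A\in\mathcal{L}$ there is $M_\Gamma(A)\in\mathcal{C}$ with $s(x^*,M_\Gamma(A))=\int_As(x^*,\Gamma)\,d\lambda$ for all $x^*$. (Henstock-Kurzweil-Pettis, HKP) $s(x^*,\Gamma)$ is Henstock-Kurzweil (HK) integrable for every $x^*$ and for every $I\in\mathcal{I}$ there is $N_\Gamma(I)\in\mathcal{C}$ with $s(x^*,N_\Gamma(I))=(HK)\int_Is(x^*,\Gamma)$ for all $x^*$. (Weakly McShane) HKP integrable and $s(x^*,\Gamma)$ Lebesgue integrable for every $x^*$. (Denjoy-Khintchine-Pettis, DKP) $s(x^*,\Gamma)$ is Denjoy-Khintchine (DK) integrable for every $x^*$ and for every $I\in\mathcal{I}$ there is $C_I\in\mathcal{C}$ with $s(x^*,C_I)=(DK)\int_Is(x^*,\Gamma)$ for all $x^*$. Here $g:[0,1]\to\mathbb{R}$ is DK integrable if there is an ACG function $F$ (i.e. $F$ is continuous and $[0,1]$ is a countable union of sets on each of which $F$ is absolutely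 continuous) whose approximate derivative equals $g$ a.e., and $(DK)\int_a^bg=F(b)-F(a)$. A function $f:[0,1]\to X$ is integrable in one of these senses if the multifunction $t\mapsto\{f(t)\}$ is (equivalently, the integrals are given by elements of $X$). The indefinite integral $M_G$ has finite variation if $\sup_\pi\sum_{A\in\pi}\|M_G(A)\|_h<\infty$ over all finite partitions $\pi$ of $[0,1]$ into pairwise disjoint members of $\mathcal{L}$. *)

(* Defs.v *)
From HB Require Import structures.
From mathcomp Require Import all_boot all_order all_algebra.
From mathcomp Require Import all_classical all_reals all_analysis.
From mathcomp Require Import measurable_realfun.

Set Implicit Arguments.
Unset Strict Implicit.
Unset Printing Implicit Defensive.

Import Order.TTheory GRing.Theory Num.Theory.
Import numFieldNormedType.Exports.

Local Open Scope classical_set_scope.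
Local Open Scope ring_scope.

(* A function on [0,1] is represented by a function on R, and no definition
   below depends on its values outside of [0,1]. *)

Definition unit_interval {R : realType} : set R := `[0, 1].

Section lebesgue.
Context {R : realType}.
Implicit Types (A : set R) (g : R -> \bar R).

(* R with the sigma-algebra of Lebesgue measurable (not just Borel) sets, the
   domain of `completed_lebesgue_measure`. *)
Definition lebesgue_type :
    measurableType ((@wlength R idfun)^*%mu).-cara%mdisp :=
  caratheodory_type ((@wlength R idfun)^*%mu).

Definition lebesgue_measurable A : Prop := measurable (A : set lebesgue_type).

Definition upper_integral01 g : \bar R :=
  ereal_inf [set (\int[@completed_lebesgue_measure R]_(t in unit_interval) h t)%E |
    h in [set h : R -> \bar R |
      measurable_fun (unit_interval : set lebesgue_type) h /\
      forall t, unit_interval t -> (g t <= h t)%E]].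

Definition lebesgue_integrable01 g : Prop :=
  (@completed_lebesgue_measure R).-integrable unit_interval g.

End lebesgue.

Section henstock_kurzweil.
Context {R : realType}.

(* The partition of [a, b] has the points a < s`_0 < ... < s`_n.-1 = b, and
   c i is the tag of its i-th interval. *)
Definition fine_tagged_partition (a b : R) (delta : R -> R) (s : seq R)
    (c : nat -> R) : Prop :=
  itv_partition a b s /\
  forall i, (i < size s)%N ->
    [/\ nth b (a :: s) i <= c i <= nth b s i,
        c i - delta (c i) < nth b (a :: s) i &
        nth b s i < c i + delta (c i)].

Definition riemann_sum (a b : R) (g : R -> R) (s : seq R) (c : nat -> R) : R :=
  \sum_(i < size s) g (c i) * (nth b s i - nth b (a :: s) i).

Definition real_HK_integral (a b : R) (g : R -> R) (v : R) : Prop :=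
  forall e : R, 0 < e -> exists delta : R -> R,
    (forall t, a <= t <= b -> 0 < delta t) /\
    forall s c, fine_tagged_partition a b delta s c ->
      `|riemann_sum a b g s c - v| < e.

(* Support functionals of unbounded sets may take the value +oo, so g need only
   be finite almost everywhere; the Henstock-Kurzweil integral does not depend
   on values on a null set. *)
Definition HK_integral (a b : R) (g : R -> \bar R) (v : R) : Prop :=
  exists g' : R -> R,
    {ae @completed_lebesgue_measure R,
      forall t : R, a <= t <= b -> g t = (g' t)%:E} /\
    real_HK_integral a b g' v.

End henstock_kurzweil.

Section denjoy_khintchine.
Context {R : realType}.
Implicit Types (E : set R) (F : R -> R).

Definition absolutely_continuous_on E F : Prop :=
  forall e : R, 0 < e -> exists2 d : R, 0 < d &
    forall (n : nat) (a b : 'I_n -> R),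
      (forall i, [/\ E (a i), E (b i) & a i < b i]) ->
      (forall i j, i != j -> b i <= a j \/ b j <= a i) ->
      \sum_(i < n) (b i - a i) < d ->
      \sum_(i < n) `|F (b i) - F (a i)| < e.

Definition ACG01 F : Prop :=
  {within unit_interval, continuous F} /\
  exists E : nat -> set R,
    unit_interval = \bigcup_n E n /\ forall n, absolutely_continuous_on (E n) F.

Definition density_point E (t : R) : Prop :=
  fine (@completed_lebesgue_measure R (E `&` `[t - h, t + h])) / (2 * h)
    @[h --> 0^'+] --> (1 : R).

Definition approximate_derivative01 F (t l : R) : Prop :=
  exists E : set R, [/\ lebesgue_measurable E, E `<=` unit_interval,
    density_point E t &
    (F u - F t) / (u - t) @[u --> within E t^'] --> l].

Definition DK_primitive01 (g : R -> \bar R) F : Prop :=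
  ACG01 F /\
  {ae @completed_lebesgue_measure R, forall t : R, unit_interval t ->
    exists2 l : R, g t = l%:E & approximate_derivative01 F t l}.

(* The value v does not depend on the choice of F: an ACG function whose
   approximate derivative is 0 almost everywhere is constant. *)
Definition DK_integral (a b : R) (g : R -> \bar R) (v : R) : Prop :=
  exists2 F, DK_primitive01 g F & v = F b - F a.

End denjoy_khintchine.

Section convex_sets.
Context {R : realType} {X : completeNormedModType R}.
Implicit Types C : set X.

Record dual : Type := Dual {
  dual_fun :> {linear X -> R^o} ;
  dual_continuous : continuous dual_fun }.

Definition weak_topology : Type :=
  sup_topology (fun phi : dual =>
    Topological.class (initial_topology (phi : X -> R^o))).

HB.instance Definition _ := Topological.on weak_topology.

Definition closed_convex C : Prop := [/\ C !=set0, closed C & convex_set C].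

Variant subfamily := Cb | Cwk | Ck.

Definition in_subfamily (k : subfamily) C : Prop :=
  closed_convex C /\
  match k with
  | Cb => bounded_set C
  | Cwk => compact (C : set weak_topology)
  | Ck => compact C
  end.

Definition support_fun (phi : dual) C : \bar R :=
  ereal_sup [set ((phi x : R)%:E) | x in C].

Definition hnorm C : \bar R := ereal_sup [set `|x|%:E | x in C].

Definition diam C : \bar R :=
  ereal_sup [set `|p.1 - p.2|%:E | p in C `*` C].

End convex_sets.
Arguments dual {R} X.
Arguments weak_topology {R} X.

Section multifunctions.
Context {R : realType} {X : completeNormedModType R}.
Implicit Types (Gamma G : R -> set X) (f : R -> X) (k : subfamily).

Definition is_multifunction01 Gamma : Prop :=
  forall t : R, unit_interval t -> closed_convex (Gamma t).

Definition is_selection01 Gamma f : Prop :=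
  forall t : R, unit_interval t -> Gamma t (f t).

Definition is_translation01 Gamma G f : Prop :=
  forall t : R, unit_interval t -> Gamma t = [set x + f t | x in G t].

Definition DL_condition Gamma : Prop :=
  (upper_integral01 (fun t => diam (Gamma t)) < +oo)%E.

Definition Db_condition Gamma : Prop :=
  exists c : R, {ae @completed_lebesgue_measure R,
    forall t : R, unit_interval t -> (diam (Gamma t) <= c%:E)%E}.

Definition bounded_multifunction Gamma : Prop :=
  exists c : R, {ae @completed_lebesgue_measure R,
    forall t : R, unit_interval t -> (hnorm (Gamma t) <= c%:E)%E}.

Definition scalarly_lebesgue_integrable Gamma : Prop :=
  forall phi : dual X,
    lebesgue_integrable01 (fun t => support_fun phi (Gamma t)).

Definition pettis_integral_over Gamma (A : set R) (M : set X) : Prop :=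
  forall phi : dual X, support_fun phi M =
    (\int[@completed_lebesgue_measure R]_(t in A) support_fun phi (Gamma t))%E.

Definition pettis_integrable k Gamma : Prop :=
  scalarly_lebesgue_integrable Gamma /\
  forall A : set R, lebesgue_measurable A -> A `<=` unit_interval ->
    exists2 M : set X, in_subfamily k M & pettis_integral_over Gamma A M.

Definition HKP_integrable k Gamma : Prop :=
  (forall phi : dual X, exists v : R,
     HK_integral 0 1 (fun t => support_fun phi (Gamma t)) v) /\
  forall a b : R, 0 <= a -> a <= b -> b <= 1 ->
    exists2 N : set X, in_subfamily k N &
      forall phi : dual X, exists2 v : R,
        HK_integral a b (fun t => support_fun phi (Gamma t)) v &
        support_fun phi N = v%:E.

Definition weakly_McShane_integrable k Gamma : Prop :=
  HKP_integrable k Gamma /\ scalarly_lebesgue_integrable Gamma.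

Definition DKP_integrable k Gamma : Prop :=
  (forall phi : dual X, exists v : R,
     DK_integral 0 1 (fun t => support_fun phi (Gamma t)) v) /\
  forall a b : R, 0 <= a -> a <= b -> b <= 1 ->
    exists2 C : set X, in_subfamily k C &
      forall phi : dual X, exists2 v : R,
        DK_integral a b (fun t => support_fun phi (Gamma t)) v &
        support_fun phi C = v%:E.

Variant scalar_sense :=
  Pettis | WeaklyMcShane | HenstockKurzweilPettis | DenjoyKhintchinePettis.

Definition integrable_in (sense : scalar_sense) k Gamma : Prop :=
  match sense with
  | Pettis => pettis_integrable k Gamma
  | WeaklyMcShane => weakly_McShane_integrable k Gamma
  | HenstockKurzweilPettis => HKP_integrable k Gamma
  | DenjoyKhintchinePettis => DKP_integrable k Gamma
  end.

Definition integrable_selection (sense : scalar_sense) k Gamma f : Prop :=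
  is_selection01 Gamma f /\ integrable_in sense k (fun t => [set f t]).

Definition DL_decomposition (sense : scalar_sense) k Gamma G f : Prop :=
  [/\ is_multifunction01 G, is_translation01 Gamma G f,
      integrable_selection sense k Gamma f, pettis_integrable k G &
      (upper_integral01 (fun t => diam (G t)) < +oo)%E].

Definition Db_decomposition (sense : scalar_sense) k Gamma G f : Prop :=
  DL_decomposition sense k Gamma G f /\ bounded_multifunction G.

Definition indefinite_pettis_integral k G (M : set R -> set X) : Prop :=
  forall A : set R, lebesgue_measurable A -> A `<=` unit_interval ->
    in_subfamily k (M A) /\ pettis_integral_over G A (M A).

Definition measurable_partition01 (n : nat) (A : 'I_n -> set R) : Prop :=
  [/\ forall i, lebesgue_measurable (A i), trivIset setT A &
      \bigcup_i A i = unit_interval].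

Definition finite_variation01 (M : set R -> set X) : Prop :=
  (ereal_sup [set v | exists n (A : 'I_n -> set R),
     measurable_partition01 A /\ v = (\sum_(i < n) hnorm (M (A i)))%E] < +oo)%E.

End multifunctions.

(* Main.v *)
(* Put G = Gamma - f. Since 0 is in G t, the support functions of G are nonnegative
   and satisfy 0 <= s(phi, G t) <= |phi| D(t), where the diameter D(t) of Gamma t
   has a Lebesgue integrable majorant h by the DL-condition. A sum of two
   Henstock-Kurzweil or Denjoy-Khintchine integrable functions that lies between 0
   and h is Lebesgue integrable with the same integral: its upper integral and
   that of the complement to (a majorant of) h add up to at most the integral of
   this majorant. Hence the sets N(I) - y(I), where N(I) and y(I) are the integrals
   of Gamma and f over an interval I, have the Lebesgue integrals of s(phi, G) over
   I as support function. By Hahn-Banach, and because X is complete, the sets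
   {x | phi x <= p phi for all phi} pass to the limit when their support functions
   p converge uniformly on the unit ball of the dual; as the integrals of h over
   small sets are small, this extends the integral of G from finite unions of
   intervals to all measurable sets, and each of these integrals is a closed convex
   subset of the integral over [0, 1]. Finally, the norm of the integral of G over A
   is at most the integral of h over A, which gives the finite variation. *)
From HB Require Import structures.
Require Import Defs.
From mathcomp Require Import all_boot all_order all_algebra.
From mathcomp Require Import all_classical all_reals all_analysis.
From mathcomp Require Import measurable_realfun lra ring.

Set Implicit Arguments.
Unset Strict Implicit.
Unset Printing Implicit Defensive.

Import Order.TTheory GRing.Theory Num.Theory.
Import numFieldNormedType.Exports.

Local Open Scope classical_set_scope.
Local Open Scope ring_scope.

(** Measurability of the support functions of [G] is not part of the Henstock-Kurzweil-Pettis and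
    Denjoy-Khintchine-Pettis definitions, and these integrals control a sum only through Riemann
    sums or increments of a primitive. Both kinds of information are therefore turned into one-sided
    bounds: step functions on uniform partitions have a measurable [liminf], and Fatou's lemma
    bounds its integral. For [g] and [h - g] together these bounds leave no slack, which forces [g]
    to agree almost everywhere with a measurable function. Lower semicontinuous majorants of [h]
    serve twice: they bound Riemann sums from above, and their indefinite integrals have an ordinary
    lower derivative at least [h] at interior points, with no appeal to differentiation almost
    everywhere. A second obstacle is that the definitions give only a convex set as the integral of
    the selection [f]; it has to be shown to act as a single point before it can be subtracted. *)

(** * Sublinear functionals and the Hahn-Banach theorem *)

Section sublinear_functionals.
Context {R : realType} {V : lmodType R}.
Implicit Types (p : V -> R) (D : set V).

(** Only one half of positive homogeneity is recorded; for [t > 0] the other half follows by scaling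
    with [t^-1]. For infima of families, only this half then has to be checked. *)
Definition sublinear p : Prop :=
  (forall x y, p (x + y) <= p x + p y) /\
  (forall t x, 0 <= t -> p (t *: x) <= t * p x).

Definition convex_combinations D : Prop :=
  forall x y t, D x -> D y -> 0 <= t -> t <= 1 -> D (t *: x + (1 - t) *: y).

Lemma sublinear0 p : sublinear p -> p 0 = 0.
Proof.
move=> [pD pZ]; apply/eqP; rewrite eq_le; apply/andP; split.
  by have := pZ 0 0 (lexx _); rewrite scale0r mul0r.
by have := pD 0 0; rewrite addr0; lra.
Qed.

Lemma sublinearN p x : sublinear p -> - p (- x) <= p x.
Proof.
move=> pP; have := pP.1 x (- x); rewrite subrr sublinear0//; lra.
Qed.

(** The functional is [q x = inf (p (x + t *: d) - t * r)] over [t >= 0] and [d] in [D], as in the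
    Mazur-Orlicz theorem. A linear functional below [q] is below [p] and at least [r] on [D], since
    [q (- d) <= - r]. *)
Lemma sublinear_inf p D r : sublinear p -> D !=set0 -> convex_combinations D ->
    (forall d, D d -> r <= p d) ->
  exists q, [/\ sublinear q, forall x, q x <= p x & forall d, D d -> q (- d) <= - r].
Proof.
move=> pP [d0 Dd0] cD rp.
pose S x := [set p (x + td.1 *: td.2) - td.1 * r |
             td in [set td : R * V | 0 <= td.1 /\ D td.2]].
have SP x t d : 0 <= t -> D d -> S x (p (x + t *: d) - t * r).
  by move=> t0 Dd; exists (t, d).
have S0 x : S x !=set0 by exists (p (x + 0 *: d0) - 0 * r); exact: SP.
(* The bound comes from [t * r <= t * p d <= p (t *: d) <= p (- x) + p (x + t *: d)]. *)
have Slb x : lbound (S x) (- p (- x)).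
  move=> _ [[t d] [/= t0 Dd] <-].
  have h1 : p (t *: d) <= p (- x) + p (x + t *: d).
    by have := pP.1 (- x) (x + t *: d); rewrite addKr.
  have h2 : t * p d <= p (t *: d).
    have [->|tn0] := eqVneq t 0; first by rewrite scale0r mul0r sublinear0.
    have tp : 0 < t by lra.
    have := pP.2 t^-1 (t *: d); rewrite invr_ge0 => /(_ t0).
    by rewrite scalerA mulVf// scale1r mulrC ler_pdivlMr// mulrC.
  have h3 : t * r <= t * p d by apply: ler_wpM2l => //; exact: rp.
  lra.
have hS x : has_inf (S x) by split => //; exists (- p (- x)).
pose q x := inf (S x).
have qle x t d : 0 <= t -> D d -> q x <= p (x + t *: d) - t * r.
  by move=> t0 Dd; apply: ge_inf; [exact: (hS x).2|exact: SP].
have qge x c : (forall t d, 0 <= t -> D d -> c <= p (x + t *: d) - t * r) -> c <= q x.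
  by move=> h; apply: lb_le_inf => // _ [[t d] [/= t0 Dd] <-]; exact: h.
exists q; split.
- split=> [x y|t x t0].
    rewrite -lerBlDr; apply: (qge _ _) => t d t0 Dd.
    rewrite lerBlDr -lerBlDl; apply: (qge _ _) => s e s0 De.
    have [ts0|ts0] := eqVneq (t + s) 0.
      have t00 : t = 0 by lra.
      have s00 : s = 0 by lra.
      have := qle (x + y) 0 d (lexx _) Dd; have := pP.1 x y.
      by rewrite t00 s00 !scale0r !addr0; lra.
    (* Convexity of [D] merges the two directions: [t *: d + s *: e] is [t + s] times a point of
       [D]. *)
    have tsp : 0 < t + s by lra.
    have := qle (x + y) (t + s) ((t / (t + s)) *: d + (1 - t / (t + s)) *: e).
    have -> : (t + s) *: ((t / (t + s)) *: d + (1 - t / (t + s)) *: e) = t *: d + s *: e.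
      by rewrite scalerDr !scalerA; congr (_ *: _ + _ *: _); field.
    move=> /(_ (ltW tsp)) H.
    have : D ((t / (t + s)) *: d + (1 - t / (t + s)) *: e).
      apply: cD => //; first by apply: divr_ge0 => //; lra.
      by rewrite ler_pdivrMr//; lra.
    move=> /H; have := pP.1 (x + t *: d) (y + s *: e).
    rewrite addrACA; lra.
  have [->|tn0] := eqVneq t 0.
    have := qle 0 0 d0 (lexx _) Dd0; rewrite !scale0r !mul0r.
    by rewrite addr0 (sublinear0 pP) subr0.
  have tp : 0 < t by lra.
  rewrite mulrC -ler_pdivrMr//; apply: (qge _ _) => s d s0 Dd; rewrite ler_pdivrMr//.
  have := qle (t *: x) (t * s) d (mulr_ge0 t0 s0) Dd.
  rewrite -scalerA -scalerDr => /le_trans; apply.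
  have := pP.2 t (x + s *: d) t0; rewrite mulrBl; lra.
- move=> x; have := qle x 0 d0 (lexx _) Dd0.
  by rewrite scale0r addr0 mul0r subr0.
- move=> d Dd; have := qle (- d) 1 d ler01 Dd.
  by rewrite scale1r addNr (sublinear0 pP) mul1r sub0r.
Qed.

(** Zorn's lemma for the reversed pointwise order; [- p (- x)] bounds every chain from below at [x],
    so the pointwise infimum exists. *)
Lemma minimal_sublinear p : sublinear p -> exists q,
  [/\ sublinear q, forall x, q x <= p x &
      forall q', sublinear q' -> (forall x, q' x <= q x) -> q' = q].
Proof.
move=> pP.
pose T := {q : V -> R | sublinear q /\ forall x, q x <= p x}.
pose Rl (q q' : T) := `[< forall x, sval q' x <= sval q x >].
have := @Zorn T Rl; case.
- by move=> q; apply/asboolP.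
- move=> q1 q2 q3 /asboolP h1 /asboolP h2; apply/asboolP => x.
  exact: le_trans (h2 x) (h1 x).
- move=> [q1 h1] [q2 h2] /asboolP /= h12 /asboolP /= h21.
  have E : q1 = q2 by apply/funext => x; apply/eqP; rewrite eq_le h12 h21.
  by subst q2; congr exist; exact: Prop_irrelevance.
- move=> A Atot.
  have [[q0 Aq0]|A0] := pselect (exists q, A q); last first.
    exists (exist _ p (conj pP (fun x => lexx _))) => s As.
    by exfalso; apply: A0; exists s.
  pose S x := [set sval q x | q in A].
  have S0 x : S x !=set0 by exists (sval q0 x), q0.
  have Slb x : lbound (S x) (- p (- x)).
    move=> _ [[q [qs qp]] Aq <-] /=.
    by have := sublinearN x qs; have := qp (- x); lra.
  have qle x q : A q -> inf (S x) <= sval q x.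
    by move=> Aq; apply: ge_inf; [exists (- p (- x))|exists q].
  have qge x c : (forall q, A q -> c <= sval q x) -> c <= inf (S x).
    by move=> h; apply: lb_le_inf => // _ [q Aq <-]; exact: h.
  have infP : sublinear (fun x => inf (S x)) /\ forall x, inf (S x) <= p x.
    split; last by move=> x; apply: le_trans (qle x q0 Aq0) _; exact: (svalP q0).2.
    split=> [x y|t x t0].
      rewrite -lerBlDr; apply: (qge _ _) => q Aq.
      rewrite lerBlDr -lerBlDl; apply: (qge _ _) => q' Aq'.
      (* Of two members of a chain, the smaller one estimates both terms; infima over arbitrary
         families need not be subadditive. *)
      have [/asboolP h|/asboolP h] := Atot _ _ Aq Aq'.
        have := qle (x + y) _ Aq'; have := (svalP q').1.1 x y; have := h x; lra.
      have := qle (x + y) _ Aq; have := (svalP q).1.1 x y; have := h y; lra.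
    have [->|tn0] := eqVneq t 0.
      rewrite scale0r mul0r; apply: le_trans (qle 0 q0 Aq0) _.
      by rewrite (sublinear0 (svalP q0).1).
    have tp : 0 < t by lra.
    rewrite mulrC -ler_pdivrMr//; apply: (qge _ _) => q Aq; rewrite ler_pdivrMr// mulrC.
    by apply: le_trans (qle _ _ Aq) _; exact: (svalP q).1.2.
  exists (exist (fun q => sublinear q /\ forall x, q x <= p x) (fun x => inf (S x)) infP).
  move=> q Aq; apply/asboolP => x /=.
  exact: qle.
- move=> [q [qs qp]] qmin; exists q; split => // q' qs' qq'.
  have h : sublinear q' /\ forall x, q' x <= p x.
    by split => // x; exact: le_trans (qq' x) (qp x).
  pose Q' : T := exist (fun q => sublinear q /\ forall x, q x <= p x) q' h.
  have E : Rl (exist _ q (conj qs qp)) Q' by apply/asboolP.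
  have := qmin Q' E.
  by move=> /(congr1 sval).
Qed.

(** A minimal sublinear functional is linear: [sublinear_inf] with [D = [set y]] and [r = q y]
    yields a smaller one with value at most [- q y] at [- y]. Minimality gives [q (- y) <= - q y],
    which turns subadditivity into additivity. *)
Lemma sublinear_linear_minorant p : sublinear p ->
  exists phi : {linear V -> R^o}, forall x, phi x <= p x.
Proof.
move=> /minimal_sublinear[q [qs qp qmin]].
have qD x y : q (x + y) = q x + q y.
  apply/eqP; rewrite eq_le qs.1 /=.
  have [||d ->//|q' [q's q'q q'y]] := @sublinear_inf q [set y] (q y) qs.
  - by exists y.
  - by move=> a b t -> -> t0 t1; rewrite /= -scalerDl [t + _]addrC subrK scale1r.
  have E := qmin q' q's q'q.
  have := q'y y erefl; rewrite E => qNy.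
  by have := qs.1 (x + y) (- y); rewrite addrK; lra.
have q0 := sublinear0 qs.
have qN x : q (- x) = - q x by have := qD x (- x); rewrite subrr q0; lra.
have qZp t x : 0 <= t -> q (t *: x) = t * q x.
  move=> t0; apply/eqP; rewrite eq_le qs.2//=.
  by have := qs.2 t (- x) t0; rewrite scalerN !qN; lra.
have qZ t x : q (t *: x) = t * q x.
  have [t0|t0] := leP 0 t; first exact: qZp.
  by rewrite -[t]opprK scaleNr qN qZp ?mulNr//; lra.
have qlin : linear (q : V -> R^o) by move=> t x y; rewrite qD qZ.
pose HBq := GRing.isLinear.Build R V R^o *:%R q qlin.
pose phi : {linear V -> R^o} := HB.pack (q : V -> R^o) HBq.
by exists phi => x; exact: qp.
Qed.

End sublinear_functionals.

(** * Separation and support functions *)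

Section support_functions.
Context {R : realType} {X : completeNormedModType R}.
Implicit Types (phi : dual X) (C N : set X) (p : dual X -> R) (k : subfamily).

Lemma dual_bounded phi : exists2 M : R, 0 < M & forall x, `|phi x| <= M * `|x|.
Proof.
have := @continuous_linear_bounded _ _ _ 0 _ (@dual_continuous _ _ phi 0).
move=> /linear_boundedP/pinfty_ex_gt0[M M0 hM]; exists M => //.
Qed.

Lemma dual_of_bound (phi : {linear X -> R^o}) : (forall x, `|phi x| <= `|x|) ->
  exists psi : dual X, forall x, psi x = phi x.
Proof.
move=> phi1; suff c : continuous phi by exists (Dual c).
apply: bounded_linear_continuous; apply/linear_boundedP.
near=> r => x; apply: le_trans (phi1 x) _.
by rewrite ler_peMl//; near: r; exact: nbhs_pinfty_ge.
Unshelve. all: by end_near. Qed.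

(** [dual] has no vector space structure, so the opposite functional is supplied by its values. It
    turns the subtraction of [f] into the addition of a support function. *)
Lemma dualN phi : exists psi : dual X, forall x, psi x = - phi x.
Proof.
have c : continuous ((\- phi : {linear X -> R^o}) : X -> R^o).
  by move=> x; apply: cvgN; exact: dual_continuous.
by exists (Dual c).
Qed.

Lemma convex_setP C : convex_set C <-> convex_combinations C.
Proof.
split=> [cC x y t Cx Cy t0 t1|cC x y l /set_mem Cx /set_mem Cy]; last first.
  by apply/mem_set; exact: cC.
have t01 : 0 <= t <= 1 by rewrite t0.
have /= := cC x y (Itv01 t0 t1); rewrite !inE; exact.
Qed.

(** [sublinear_inf] is applied to the norm and the convex set [x - C]. The explicit gap [r] for a
    functional of norm at most 1 is what lets support functions control distances. *)
Lemma separation C x r : C !=set0 -> convex_combinations C ->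
    (forall y, C y -> r <= `|x - y|) ->
  exists2 phi : dual X, (forall z, `|phi z| <= `|z|) &
    forall y, C y -> phi y + r <= phi x.
Proof.
move=> [y0 Cy0] cC rC.
have nP : sublinear (fun z : X => `|z|).
  by split=> [u v|t z t0]; [exact: ler_normD|rewrite normrZ ger0_norm].
have [||_ [y Cy <-]|q [qs qn qD]] := @sublinear_inf _ _ _ [set x - y | y in C] r nP.
- by exists (x - y0), y0.
- move=> _ _ t [y1 C1 <-] [y2 C2 <-] t0 t1; exists (t *: y1 + (1 - t) *: y2).
    exact: cC.
  rewrite !scalerBr addrACA -scalerDl -opprD; congr (_ - _).
  by rewrite addrCA subrr addr0 scale1r.
- exact: rC.
have [phi phiq] := sublinear_linear_minorant qs.
have [|psi psiE] := @dual_of_bound phi.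
  move=> z; rewrite ler_norml (le_trans (phiq z) (qn z)) andbT lerNl.
  by rewrite -linearN -[leRHS]normrN; exact: le_trans (phiq _) (qn _).
exists psi => [z|y Cy].
  rewrite psiE ler_norml (le_trans (phiq z) (qn z)) andbT lerNl.
  by rewrite -linearN -[leRHS]normrN; exact: le_trans (phiq _) (qn _).
rewrite !psiE; have := le_trans (phiq (- (x - y))) (qD _ (ex_intro2 _ _ y Cy erefl)).
by rewrite linearN linearB /=; lra.
Qed.

Definition support_is C p : Prop :=
  forall phi, support_fun phi C = (p phi)%:E.

Lemma support_fun_ge phi C x : C x -> ((phi x : R)%:E <= support_fun phi C)%E.
Proof. by move=> Cx; apply: ereal_sup_ubound; exists x. Qed.

Lemma support_fun_le phi C (c : \bar R) :
  (forall x, C x -> ((phi x : R)%:E <= c)%E) -> (support_fun phi C <= c)%E.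
Proof. by move=> h; apply: ge_ereal_sup => _ [x Cx <-]; exact: h. Qed.

Lemma support_is_ge C p phi x : support_is C p -> C x -> phi x <= p phi.
Proof. by move=> Cp Cx; rewrite -lee_fin -Cp; exact: support_fun_ge. Qed.

Lemma support_is_adherent C p phi (e : R) : support_is C p -> 0 < e ->
  exists2 x, C x & p phi - e < phi x.
Proof.
move=> Cp e0; have h : ((p phi - e)%:E < support_fun phi C)%E.
  by rewrite Cp lte_fin; lra.
by have [_ [x Cx <-]] := ereal_sup_gt h; rewrite lte_fin; exists x.
Qed.

(** An intersection of closed half-spaces. If [p] is the support function of a closed convex set, it
    is that set. *)
Definition polar p : set X := [set x | forall phi, phi x <= p phi].

Lemma weak_dual_continuous phi :
  continuous ((phi : X -> R^o) : weak_topology X -> R^o).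
Proof.
move=> x; apply: cvg_trans; last exact: (@initial_continuous X R^o phi x).
apply: cvg_app.
by have [+ _] := @cvg_sup X (dual X)
  (fun phi => Topological.class (initial_topology (phi : X -> R^o)))
  (nbhs (x : weak_topology X)) x _; move=> /(_ cvg_id phi).
Qed.

Lemma polar_closed_weakly p : closed (polar p : set (weak_topology X)).
Proof.
have -> : polar p = \bigcap_(phi in [set: dual X]) (phi @^-1` [set r : R | r <= p phi]).
  by apply/seteqP; split => x /= h phi; [move=> _; exact: h|exact: h].
apply: closed_bigI => phi _.
apply: (@preimage_closed (weak_topology X) _ phi); last exact: closed_le.
by move=> x _; exact: weak_dual_continuous.
Qed.

Lemma polar_closed p : closed (polar p).
Proof.
have -> : polar p = \bigcap_(phi in [set: dual X]) (phi @^-1` [set r : R | r <= p phi]).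
  by apply/seteqP; split => x /= h phi; [move=> _; exact: h|exact: h].
apply: closed_bigI => phi _; apply: preimage_closed; last exact: closed_le.
by move=> x _; exact: dual_continuous.
Qed.

Lemma polar_convex p : convex_combinations (polar p).
Proof.
move=> x y t px py t0 t1 phi; rewrite linearD !linearZ /=.
have := ler_wpM2l t0 (px phi); have : 0 <= 1 - t by lra.
by move=> /ler_wpM2l/(_ _ _ (py phi)); rewrite /GRing.scale /=; lra.
Qed.

(** A point outside [N] has positive distance to [N], and a separating functional violates the bound
    by [support_fun phi N]. *)
Lemma polar_sub N p : closed_convex N ->
  (forall phi, ((p phi)%:E <= support_fun phi N)%E) -> polar p `<=` N.
Proof.
move=> [N0 cN /convex_setP vN] pN x px; apply: contrapT => Nx.
have : open (~` N) by exact: closed_openC.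
rewrite openE => /(_ x Nx)/nbhs_ballP[e /= e0 eN].
have [y Ny|phi _ phiN] := @separation N x e N0 vN.
  rewrite leNgt; apply/negP => xy; apply: (eN y) => //.
  by rewrite -ball_normE.
have : (support_fun phi N <= (phi x - e)%:E)%E.
  by apply: support_fun_le => y /phiN; rewrite lee_fin; lra.
move=> /(le_trans (pN phi)); rewrite lee_fin; have := px phi; lra.
Qed.

(** If [x] were at distance at least [e] from [C], a separating functional of norm at most 1 would
    give [p phi + e <= phi x <= p' phi]. *)
Lemma polar_approx C p p' e x : C !=set0 -> convex_combinations C -> support_is C p ->
    (forall phi, (forall z, `|phi z| <= `|z|) -> p' phi < p phi + e) -> polar p' x ->
  exists2 y, C y & `|x - y| < e.
Proof.
move=> C0 cC Cp pp' xp'; apply: contrapT => h.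
have [y Cy|phi phi1 phiC] := @separation C x e C0 cC.
  by rewrite leNgt; apply/negP => xy; apply: h; exists y.
have := pp' phi phi1; have := xp' phi.
have : (support_fun phi C <= (phi x - e)%:E)%E.
  by apply: support_fun_le => y /phiC; rewrite lee_fin; lra.
rewrite Cp lee_fin; lra.
Qed.

End support_functions.

(** * Limits, sums and translates of sets in terms of support functions *)

Section support_limits.
Context {R : realType} {X : completeNormedModType R}.
Implicit Types (phi : dual X) (C N : set X) (p : dual X -> R) (k : subfamily).

(** Closedness is left out because the Minkowski sum of two closed convex sets need not be closed;
    passing to [polar] restores it. *)
Definition supports C p : Prop :=
  [/\ C !=set0, convex_combinations C & support_is C p].

(** Uniform closeness on the unit ball of the dual, in homogeneous form: [dual] has no norm, so an
    arbitrary bound [M] of [phi] replaces it. *)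
Definition support_within p q (e : R) : Prop :=
  forall phi M, 0 <= M -> (forall z, `|phi z| <= M * `|z|) -> `|q phi - p phi| <= e * M.

(** Points of approximating sets for the errors [e / 2 ^ n] are chosen successively; they form a
    Cauchy sequence whose limit lies in the polar. The constant 9 is 3 for the jump from [x] to the
    first set plus [3 + 3/2 + 3/4 + ... = 6]. *)
Lemma support_limit_near p : 
    (forall e : R, 0 < e -> exists C q, supports C q /\ support_within p q e) ->
  forall (e : R) C q x, 0 < e -> supports C q -> support_within p q e -> C x ->
  exists2 y, polar p y & `|x - y| <= 9 * e.
Proof.
move=> hp e C q x e0 [C0 cC Cq] qp Cx.
pose eps (n : nat) : R := e * 2^-1 ^+ n.
have eps0 n : 0 < eps n by rewrite mulr_gt0// exprn_gt0.
have epsS n : eps n.+1 = eps n / 2 by rewrite /eps exprSr mulrA.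
have /choice[D /choice[Q DQ]] : forall n, exists C q, supports C q /\ support_within p q (eps n).
  by move=> n; exact: hp.
have within1 (r : dual X -> R) (d : R) : support_within p r d ->
    forall phi : dual X, (forall z, `|phi z| <= `|z|) -> `|r phi - p phi| <= d.
  by move=> h phi phi1; have := h phi 1 ler01; rewrite mulr1; apply => z; rewrite mul1r.
have [y0 Dy0 xy0] : exists2 y, D 0 y & `|x - y| < 3 * e.
  have [[D0 cD DQ0] Qp] := DQ 0.
  apply: (@polar_approx _ _ (D 0) (Q 0) q) => //.
    move=> phi phi1; have := within1 _ _ Qp _ phi1; have := within1 _ _ qp _ phi1.
    by rewrite /eps expr0 mulr1 !ler_norml => /andP[_ h] /andP[h' _]; lra.
  by move=> phi; exact: support_is_ge Cq Cx.
(* Each point has to lie in its own set and depends on its predecessor, hence a recursion through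
   sigma types. *)
pose S n := {y | D n y}.
have step n (y : S n) : exists z : S n.+1, `|sval y - sval z| < 3 * eps n.
  have [[D0 cD DQ0] Qp] := DQ n.+1; have [[_ _ DQn] Qpn] := DQ n.
  have [||z Dz yz] := @polar_approx _ _ (D n.+1) (Q n.+1) (Q n) (3 * eps n) (sval y) D0 cD DQ0.
  - move=> phi phi1; have := within1 _ _ Qp _ phi1; have := within1 _ _ Qpn _ phi1.
    by rewrite epsS !ler_norml => /andP[_ h] /andP[h' _]; have := eps0 n; lra.
  - by move=> phi; exact: support_is_ge DQn (svalP y).
  - by exists (exist _ z Dz).
pose f n (y : S n) := sval (cid (step n y)).
have fP n (y : S n) : `|sval y - sval (f n y)| < 3 * eps n := svalP (cid (step n y)).
pose ys : forall n, S n := nat_rect S (exist _ y0 Dy0) f.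
pose y n := sval (ys n).
have yS n : `|y n.+1 - y n| < 3 * eps n by rewrite distrC; exact: fP.
pose u := [sequence y n.+1 - y n]_n.
have uE n : series u n = y n - y 0 by rewrite /series /= telescope_sumr.
pose v := geometric (3 * e) (2^-1 : R).
have v0 n : 0 <= v n by rewrite /v /= mulr_ge0 ?exprn_ge0//; lra.
have uv n : `|u n| <= v n by rewrite /v /u /= -mulrA; exact/ltW/yS.
have half1 : `|2^-1 : R| < 1 by rewrite ger0_norm//; lra.
have cv : cvgn (series v) by exact: is_cvg_geometric_series.
have cnu : cvgn [normed series u] by apply: (series_le_cvg _ v0 uv cv) => n; exact: normr_ge0.
have cu : cvgn (series u) by exact: normed_cvg.
pose z := limn (series u) + y 0.
have yz : y n @[n --> \oo] --> z.
  rewrite (_ : y = fun n => series u n + y 0); last by apply/funext => n; rewrite uE subrK.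
  by apply: cvgD => //; exact: cvg_cst.
exists z => [phi|].
  have [M M0 phiM] := dual_bounded phi.
  have c1 : phi (y n) @[n --> \oo] --> (phi z : R).
    by apply: continuous_cvg => //; exact: dual_continuous.
  have c2 : p phi + eps n * M @[n --> \oo] --> p phi.
    rewrite -[X in _ --> X]addr0 -[X in _ --> _ + X](mul0r M).
    apply: cvgD; first exact: cvg_cst.
    apply: cvgM; last exact: cvg_cst.
    exact: cvg_geometric.
  apply: ler_cvg_to c1 c2 _; near=> n.
  have [[_ _ DQn] Qpn] := DQ n.
  have := support_is_ge phi DQn (svalP (ys n)).
  by have := Qpn phi M (ltW M0) phiM; rewrite ler_norml => /andP[_]; rewrite /y; lra.
have : `|limn (series u)| <= 6 * e.
  apply: le_trans (lim_series_norm cnu) _.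
  apply: le_trans (lim_series_le cnu cv uv) _.
  rewrite (cvg_lim _ (cvg_geometric_series _))// (_ : 1 - 2^-1 = 2^-1); last by lra.
  by rewrite invrK; lra.
have -> : x - z = (x - y0) - limn (series u) by rewrite /z opprD addrCA addrC.
have := ler_normB (x - y0) (limn (series u)); lra.
Unshelve. all: by end_near. Qed.

Lemma support_limit p :
    (forall e : R, 0 < e -> exists C q, supports C q /\ support_within p q e) ->
  supports (polar p) p.
Proof.
move=> hp; split; last 2 first.
- exact: polar_convex.
- move=> phi; apply/eqP; rewrite eq_le; apply/andP; split.
    by apply: support_fun_le => x px; rewrite lee_fin.
  apply/lee_addgt0Pr => e e0.
  have [M M0 phiM] := dual_bounded phi.
  (* The losses add up to [11 * d * M]: 9 for moving into the polar, 1 for the choice of [x], 1 for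
     replacing [q] by [p]. The 20 leaves room. *)
  pose d := e / (20 * M); have d0 : 0 < d by rewrite divr_gt0// mulr_gt0.
  have dM : d * M = e / 20 by rewrite /d; field; rewrite gt_eqF.
  have [C [q [[C0 cC Cq] qp]]] := hp d d0.
  have dM0 : 0 < d * M by exact: mulr_gt0.
  have [x Cx qx] := support_is_adherent phi Cq dM0.
  have [y py xy] := @support_limit_near p hp d C q x d0 (And3 C0 cC Cq) qp Cx.
  apply: le_trans (leeD2r _ (support_fun_ge phi py)); rewrite -EFinD lee_fin.
  have := qp phi M (ltW M0) phiM; rewrite ler_norml => /andP[h _].
  have : `|phi (x - y)| <= M * (9 * d).
    by apply: le_trans (phiM _) _; apply: ler_wpM2l => //; exact: ltW.
  rewrite linearB ler_norml /= => /andP[_ h']; nra.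
- have [C [q [[C0 cC Cq] qp]]] := hp 1 ltr01; have [x Cx] := C0.
  have [y py _] := @support_limit_near p hp 1 C q x ltr01 (And3 C0 cC Cq) qp Cx.
  by exists y.
Qed.

Lemma supportsD C1 C2 p1 p2 : supports C1 p1 -> supports C2 p2 ->
  supports [set x1 + x2 | x1 in C1 & x2 in C2] (fun phi => p1 phi + p2 phi).
Proof.
move=> [[x10 Cx10] c1 s1] [[x20 Cx20] c2 s2]; split.
- by exists (x10 + x20), x10 => //; exists x20.
- move=> _ _ t [x1 Cx1 [x2 Cx2 <-]] [y1 Cy1 [y2 Cy2 <-]] t0 t1.
  exists (t *: x1 + (1 - t) *: y1); first exact: c1.
  exists (t *: x2 + (1 - t) *: y2); first exact: c2.
  by rewrite !scalerDr addrACA.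
- move=> phi; apply/eqP; rewrite eq_le; apply/andP; split.
    apply: support_fun_le => _ [x1 Cx1 [x2 Cx2 <-]]; rewrite lee_fin linearD.
    by apply: lerD; [exact: support_is_ge s1 _|exact: support_is_ge s2 _].
  apply/lee_addgt0Pr => e e0.
  have e20 : 0 < e / 2 by rewrite divr_gt0.
  have [x1 Cx1 h1] := support_is_adherent phi s1 e20.
  have [x2 Cx2 h2] := support_is_adherent phi s2 e20.
  have : [set x1 + x2 | x1 in C1 & x2 in C2] (x1 + x2) by exists x1 => //; exists x2.
  move=> /(support_fun_ge phi) h; apply: le_trans (leeD2r _ h).
  by rewrite -EFinD lee_fin linearD /=; lra.
Qed.

Lemma closed_convex_translate N y : closed_convex N -> closed_convex [set x - y | x in N].
Proof.
move=> [[x0 Nx0] cN vN]; split; first by exists (x0 - y), x0.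
- have -> : [set x - y | x in N] = (fun x => x + y) @^-1` N.
    apply/seteqP; split => [_ [x Nx <-]|x Nx] /=; first by rewrite subrK.
    by exists (x + y) => //; rewrite addrK.
  apply: preimage_closed => // x _.
  by apply: cvgD; [exact: cvg_id|exact: cvg_cst].
- apply/convex_setP => _ _ t [x1 C1 <-] [x2 C2 <-] t0 t1.
  exists (t *: x1 + (1 - t) *: x2); first by move/convex_setP : vN; exact.
  rewrite !scalerBr addrACA -opprD -scalerDl; congr (_ - _).
  by rewrite addrCA subrr addr0 scale1r.
Qed.

Lemma weak_cvgP (F : set_system (weak_topology X)) (x : weak_topology X) : Filter F ->
  (forall phi, (phi : X -> R^o) @ F --> (phi x : R^o)) -> F --> x.
Proof.
move=> FF h; apply/(@cvg_sup X (dual X)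
  (fun phi => Topological.class (initial_topology (phi : X -> R^o)))) => phi.
move=> U [_ [[V oV <-] Vx] VU]; apply: filterS VU _.
by apply: h; exact: open_nbhs_nbhs.
Qed.

Lemma weak_translate_continuous y :
  continuous ((fun x : X => x - y) : weak_topology X -> weak_topology X).
Proof.
move=> x; apply: (@weak_cvgP _ _ (fmap_filter _ (nbhs_filter x))) => phi.
have E : (fun z : X => phi z - phi y : R^o) = (fun z => phi (z - y)).
  by apply/funext => z; rewrite linearB.
have : (fun z : X => phi z - phi y : R^o) @ nbhs (x : weak_topology X) --> (phi x - phi y : R^o).
  by apply: cvgB; [exact: weak_dual_continuous|exact: cvg_cst].
by rewrite E -linearB.
Qed.

Lemma in_subfamily_translate k N y : in_subfamily k N ->
  in_subfamily k [set x - y | x in N].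
Proof.
move=> [cN kN]; split; first exact: closed_convex_translate.
case: k kN => /= kN.
- have /pinfty_ex_gt0[M M0 NM] := kN.
  apply: filterS (nbhs_pinfty_ge (num_real (M + `|y|))) => r rM _ [x Nx <-] /=.
  apply: le_trans rM; apply: le_trans (ler_normB _ _) _.
  by rewrite lerD2r; exact: NM.
- apply: (@continuous_compact (weak_topology X) (weak_topology X)) => //.
  exact/continuous_subspaceT/weak_translate_continuous.
- apply: continuous_compact => //; apply: continuous_subspaceT => x.
  by apply: cvgB; [exact: cvg_id|exact: cvg_cst].
Qed.

(** By [polar_sub] the polar is a closed, and weakly closed, subset of [N], so it inherits
    boundedness and either kind of compactness. *)
Lemma in_subfamily_polar k N p q : in_subfamily k N -> support_is N q ->
  (forall phi, p phi <= q phi) -> supports (polar p) p -> in_subfamily k (polar p).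
Proof.
move=> [cN kN] Nq pq [p0 pc _].
have pN : polar p `<=` N.
  by apply: polar_sub => // phi; rewrite Nq lee_fin.
split; first by split => //; [exact: polar_closed|exact/convex_setP].
case: k kN => /= kN.
- by apply: filterS kN => r rN x /pN; exact: rN.
- apply: subclosed_compact kN pN; exact: polar_closed_weakly.
- apply: subclosed_compact kN pN; exact: polar_closed.
Qed.

End support_limits.

(** * Lebesgue measure and lower semicontinuous majorants (Vitali-Caratheodory) *)

Section lebesgue_basics.
Context {R : realType}.
Local Notation mu := (@completed_lebesgue_measure R).
Local Notation T := (@lebesgue_type R).
Implicit Types (A D U : set R) (h g : R -> \bar R).

Lemma borel_lebesgue_measurable A : measurable (A : set (measurableTypeR R)) ->
  lebesgue_measurable A.
Proof. exact: sub_caratheodory. Qed.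

Lemma borel_lebesgue_fun (g : measurableTypeR R -> \bar R) (D : set T) :
  measurable_fun setT g -> measurable_fun (D : set T) (g : T -> \bar R).
Proof.
move=> mg; apply: (@measurable_funTS _ _ T) => _ B mB; rewrite setTI.
have := mg measurableT B mB; rewrite setTI.
exact: borel_lebesgue_measurable.
Qed.

Lemma lebesgue_measurable_open U : open U -> lebesgue_measurable U.
Proof. by move=> oU; apply: borel_lebesgue_measurable; exact: open_measurable. Qed.

Lemma lebesgue_measurable_itv (i : interval R) : lebesgue_measurable [set` i].
Proof. by apply: borel_lebesgue_measurable; exact: measurable_itv. Qed.

Lemma lebesgue_itv (i : interval R) :
  mu [set` i] = (if i.1 < i.2 then (i.2 : \bar R) - i.1 else 0)%E.
Proof. exact: lebesgue_measure_itv. Qed.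

Lemma lebesgue_open_cover A (e : R) : 0 < e ->
  exists U, [/\ open U, A `<=` U & (mu U <= mu A + e%:E)%E].
Proof. exact: outer_measure_open_le. Qed.

(** Together with [layers_ge] this rounds up to multiples of [c]: a finite [x] is at most [c] times
    the number of [k] with [k * c < x], which is at most [x + c]. *)
Lemma layers_le (c : R) (x : \bar R) n : 0 < c -> (0 <= x)%E ->
  ((\sum_(0 <= k < n) (if ((k%:R * c)%:E < x)%E then c else 0))%:E <= x + c%:E)%E.
Proof.
move=> c0; case: x => [r||] x0; [|by rewrite addye// leey|by []].
move: x0.
rewrite lee_fin => r0; rewrite -EFinD lee_fin.
have le n' : \sum_(0 <= k < n') (if ((k%:R * c)%:E < r%:E)%E then c else 0) <= n'%:R * c.
  elim: n' => [|n' IH]; first by rewrite big_nil mul0r.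
  by rewrite big_nat_recr//= -natr1 mulrDl mul1r lerD//; case: ifP => // _; exact: ltW.
elim: n => [|n IH]; first by rewrite big_nil addr_ge0// ltW.
rewrite big_nat_recr//=; case: ifPn => [|_]; last by rewrite addr0.
by rewrite lte_fin => nr; have := le n; lra.
Qed.

Lemma layers_ge (c : R) (x : \bar R) n : 0 < c -> ((n%:R * c)%:E < x)%E ->
  \sum_(0 <= k < n.+1) (if ((k%:R * c)%:E < x)%E then c else 0) = n.+1%:R * c.
Proof.
move=> c0 nx; rewrite (eq_big_nat _ _ (F2 := fun=> c)) => [|k /andP[_ kn]].
  by rewrite sumr_const_nat subn0 mulr_natl.
rewrite ifT//; apply: le_lt_trans nx; rewrite lee_fin ler_pM2r// ler_nat.
by rewrite -ltnS.
Qed.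

(* The graph of h is cut into layers of height c, and each layer is replaced by
   an open set of almost the same measure. *)
Lemma lsc_majorant D h (e : R) : lebesgue_measurable D -> (mu D < +oo)%E ->
    measurable_fun (D : set T) h -> (forall t, D t -> (0 <= h t)%E) -> 0 < e ->
  exists g, [/\ lower_semicontinuous g, forall t, (0 <= g t)%E,
    forall t, D t -> (h t <= g t)%E &
    (\int[mu]_(t in D) g t <= \int[mu]_(t in D) h t + e%:E)%E].
Proof.
move=> mD Doo mh h0 e0.
pose m := fine (mu D).
have m0 : 0 <= m by exact: fine_ge0.
have mE : mu D = m%:E by rewrite fineK// ge0_fin_numE.
(* [c * m] pays for rounding up on [D], and the remaining [c] for enlarging the layers to open sets,
   whose excess measures sum to at most 1; [m + 1] avoids division by 0. *)
pose c := e / (m + 1).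
have c0 : 0 < c by rewrite divr_gt0//; lra.
have cm : c * m + c = e.
  by rewrite -[X in _ + X]mulr1 -mulrDr divfK// lt0r_neq0// ltr_wpDl.
pose A (k : nat) : set R := D `&` [set t | (((k%:R * c)%R%:E < h t)%E : bool)].
have mA k : lebesgue_measurable (A k) by exact: emeasurable_fun_o_infty.
have AE k t : D t -> (\1_(A k) t : R) = (if ((k%:R * c)%:E < h t)%E then 1 else 0).
  move=> Dt; rewrite indicE; case: ifPn => kt.
    by rewrite mem_set.
  by rewrite memNset// => -[_] /=; exact/negP.
have /choice [U UP] : forall k, exists V, [/\ open V, A k `<=` V &
    (mu V <= mu (A k) + (1 / (2 ^ k.+1)%:R)%:E)%E].
  by move=> k; apply: lebesgue_open_cover; rewrite divr_gt0// ltr0n expn_gt0.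
have mU k : lebesgue_measurable (U k).
  by apply: lebesgue_measurable_open; case: (UP k).
pose g t := (\sum_(k <oo) (c * \1_(U k) t)%:E)%E.
have t0 k t : (0 <= (c * \1_(U k) t)%:E)%E.
  by rewrite lee_fin mulr_ge0// ltW.
have tA0 k t : (0 <= (c * \1_(A k) t)%:E)%E.
  by rewrite lee_fin mulr_ge0// ltW.
have part n t : ((\sum_(0 <= k < n) c * \1_(U k) t)%:E <= g t)%E.
  by rewrite -sumEFin; apply: nneseries_lim_ge => k _ _; exact: t0.
exists g; split.
- move=> x a ax.
  (* A finite partial sum already exceeds [a], and those of its finitely many open sets that contain
     [x] contain a common neighbourhood. *)
  have [n an] : exists n, a < \sum_(0 <= k < n) c * \1_(U k) x.
    apply: contrapT => /forallNP h1.
    suff : (g x <= a%:E)%E by rewrite leNgt ax.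
    apply: lime_le; first by apply: is_cvg_nneseries => k _ _; exact: t0.
    apply: nearW => n; rewrite sumEFin lee_fin leNgt; exact/negP.
  have near1 (k : 'I_n) : nbhs x [set y | x \in U k -> y \in U k].
    case: (boolP (x \in U k)) => [|_]; last exact: filterE.
    rewrite inE => Ux; have [oU _ _] := UP k.
    by apply: filterS (open_nbhs_nbhs (conj oU Ux)) => y Uy _; rewrite inE.
  have nx := filter_forall _ near1.
  eexists; first exact: nx.
  move=> y /= xy; apply: lt_le_trans (part n y); rewrite lte_fin.
  apply: lt_le_trans an _; apply: ler_sum_nat => k /andP[_ kn].
  rewrite ler_pM2l// !indicE ler_nat; have := xy (Ordinal kn) => /=.
  by case: (x \in U k) => // ->.
- by move=> t; apply: nneseries_ge0 => k _ _; exact: t0.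
- move=> t Dt; rewrite leNgt; apply/negP => gh.
  have g0 : (0 <= g t)%E by apply: nneseries_ge0 => k _ _; exact: t0.
  have gfin : g t \is a fin_num by rewrite ge0_fin_numE// (lt_le_trans gh)// leey.
  (* As [n * c <= g t < h t], all layers from 0 to [n] contain [t], so [g t] is at least [n.+1 * c],
     which exceeds [g t]. *)
  pose n := Num.truncn (fine (g t) / c).
  have /truncn_itv/andP[n1 n2] : 0 <= fine (g t) / c.
    by rewrite divr_ge0 ?fine_ge0// ltW.
  have nh : ((n%:R * c)%:E < h t)%E.
    by apply: le_lt_trans gh; rewrite -(fineK gfin) lee_fin -ler_pdivlMr.
  have := part n.+1 t; rewrite leNgt => /negP; apply.
  rewrite -(fineK gfin) lte_fin; apply: (@lt_le_trans _ _ (n.+1%:R * c)).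
    by rewrite -ltr_pdivrMr.
  rewrite -(layers_ge c0 nh); apply: ler_sum => k _.
  case: ifPn => [kt|_]; last by rewrite mulr_ge0// ltW.
  have [_ AU _] := UP k; rewrite indicE mem_set ?mulr1//.
  by apply: AU; split.
- have mI (B : nat -> set R) k : (forall k, lebesgue_measurable (B k)) ->
      measurable_fun (D : set T) (fun t => (c * \1_(B k) t)%:E).
    move=> mB'; apply/measurable_EFinP; apply: measurable_funM => //.
    by apply: measurable_indic; exact: mB'.
  have IE (B : nat -> set R) k : (forall k, lebesgue_measurable (B k)) ->
      (\int[mu]_(t in D) (c * \1_(B k) t)%:E = c%:E * mu (B k `&` D))%E.
    move=> mB'; under eq_integral do rewrite EFinM.
    have mI' : measurable_fun (D : set T) (fun t => (\1_(B k) t)%:E : \bar R).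
      by apply/measurable_EFinP; apply: measurable_indic; exact: mB'.
    have c0' : 0 <= c by exact: ltW.
    have I0 t : D t -> (0 <= (\1_(B k) t : R)%:E)%E by rewrite lee_fin.
    rewrite (ge0_integralZl_EFin mu mD I0 mI' c0') integral_indic//.
    exact: mB'.
  have intU := integral_nneseries mu mD (fun k => mI U k mU) (fun k t _ => t0 k t).
  rewrite [leLHS]intU.
  apply: (@le_trans _ _ (\sum_(k <oo) (\int[mu]_(t in D) (c * \1_(A k) t)%:E +
      (c / (2 ^ k.+1)%:R)%:E))%E).
    apply: lee_nneseries => k _; first by move=> _; exact: integral_ge0.
    rewrite !IE//; have [_ _ mUk] := UP k.
    have -> : A k `&` D = A k by rewrite /A setIAC setIid.
    have -> : (c / (2 ^ k.+1)%:R)%:E = (c%:E * (1 / (2 ^ k.+1)%:R)%:E)%E.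
      by rewrite -EFinM mulrA mulr1.
    rewrite -ge0_muleDr//.
    apply: lee_wpmul2l; first by rewrite lee_fin ltW.
    apply: le_trans mUk; apply: le_measure; rewrite ?inE//.
    + by apply: measurableI; [exact: mU|exact: mD].
    + exact: mU.
  rewrite nneseriesD//; last 2 first.
    by move=> k _ _; exact: integral_ge0.
    by move=> k _ _; rewrite lee_fin divr_ge0// ltW.
  have -> : (\sum_(k <oo) (c / (2 ^ k.+1)%:R)%:E = c%:E)%E.
    under eq_eseriesr => k _ do rewrite -[k.+1]addn1.
    have := cvg_lim (@ereal_hausdorff R) (@cvg_geometric_eseries_half R c 0).
    by rewrite expr0 divr1; exact.
  have intA := integral_nneseries mu mD (fun k => mI A k mA) (fun k t _ => tA0 k t).
  rewrite -[X in (X + _)%E]intA.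
  rewrite -cm EFinD addeA leeD2r//.
  rewrite EFinM -mE -(integral_cst mu mD) -ge0_integralD//; last first.
    by move=> t _; rewrite lee_fin ltW.
  apply: ge0_le_integral; first exact: mD.
  + by move=> t _; apply: nneseries_ge0 => k _ _; exact: tA0.
  + apply: (@ge0_emeasurable_sum _ T R D (fun k t => (c * \1_(A k) t)%:E) xpredT) => k.
      by move=> t _ _; exact: tA0.
    by move=> _; exact: mI.
  + by apply: emeasurable_funD.
  + move=> t Dt; apply: lime_le; first by apply: is_cvg_nneseries => k _ _; exact: tA0.
    apply: nearW => n; rewrite sumEFin.
    apply: le_trans (layers_le n c0 (h0 t Dt)); rewrite lee_fin.
    apply: ler_sum => k _; rewrite AE//; case: ifPn; rewrite ?mulr1 ?mulr0//.
Qed.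

End lebesgue_basics.

(** * Upper integrals and the squeeze *)

Section squeeze.
Context {R : realType}.
Local Notation mu := (@completed_lebesgue_measure R).
Local Notation T := (@lebesgue_type R).
Implicit Types (D : set R) (g h : R -> R).

Lemma aeS (P Q : R -> Prop) : (forall t, P t -> Q t) ->
  {ae mu, forall t, P t} -> {ae mu, forall t, Q t}.
Proof. exact: (@filterS T (almost_everywhere mu) _). Qed.

Lemma aeS2 (P1 P2 Q : R -> Prop) : (forall t, P1 t -> P2 t -> Q t) ->
  {ae mu, forall t, P1 t} -> {ae mu, forall t, P2 t} -> {ae mu, forall t, Q t}.
Proof. exact: (@filterS2 T (almost_everywhere mu) _). Qed.

Lemma aeS3 (P1 P2 P3 Q : R -> Prop) : (forall t, P1 t -> P2 t -> P3 t -> Q t) ->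
  {ae mu, forall t, P1 t} -> {ae mu, forall t, P2 t} -> {ae mu, forall t, P3 t} ->
  {ae mu, forall t, Q t}.
Proof. exact: (@filterS3 T (almost_everywhere mu) _). Qed.

Lemma ae_all_nat (P : nat -> R -> Prop) : (forall n, {ae mu, forall t, P n t}) ->
  {ae mu, forall t, forall n, P n t}.
Proof. exact: (@ae_foralln _ T R mu). Qed.

(** The upper integral of a possibly nonmeasurable [g] is at most [v], with the bound attained by a
    single nonnegative majorant. *)
Definition majorized D g (v : R) : Prop := exists u : R -> \bar R,
  [/\ measurable_fun (D : set T) u, forall t, D t -> (0 <= u t)%E,
      {ae mu, forall t, D t -> ((g t)%:E <= u t)%E} &
      (\int[mu]_(t in D) u t <= v%:E)%E].

Lemma majorized_inf D g v : lebesgue_measurable D ->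
  (forall e, 0 < e -> majorized D g (v + e)) -> majorized D g v.
Proof.
move=> mD hg.
have /choice[u uP] : forall n, exists u : R -> \bar R,
  [/\ measurable_fun (D : set T) u, forall t, D t -> (0 <= u t)%E,
      {ae mu, forall t, D t -> ((g t)%:E <= u t)%E} &
      (\int[mu]_(t in D) u t <= (v + n.+1%:R^-1)%:E)%E].
  by move=> n; exact: hg.
have mu_ n : measurable_fun (D : set T) (u n) by case: (uP n).
pose U t := einfs (fun n => u n t) 0.
have Ule n t : (U t <= u n t)%E by apply: ereal_inf_lbound; exists n.
have Uge x t : (forall n, (x <= u n t)%E) -> (x <= U t)%E.
  by move=> h; apply: le_ereal_inf_tmp => _ [n _ <-].
have mU : measurable_fun (D : set T) U by exact: measurable_fun_einfs.
have U0 t : D t -> (0 <= U t)%E.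
  by move=> Dt; apply: Uge => n; case: (uP n) => _ + _ _; exact.
exists U; split => //.
- have : {ae mu, forall t, forall n, D t -> ((g t)%:E <= u n t)%E}.
    by apply: ae_all_nat => n; case: (uP n).
  by apply: aeS => t h Dt; apply: Uge => n; exact: h.
- apply/lee_addgt0Pr => e e0.
  have [n ne] : exists n, n.+1%:R^-1 < e.
    near (\oo) => n; exists n; near: n.
    exact: near_infty_natSinv_lt (PosNum e0).
  apply: (@le_trans _ _ (v + n.+1%:R^-1)%:E).
    case: (uP n) => _ u0 _; apply: le_trans.
    by apply: ge0_le_integral.
  by rewrite -EFinD lee_fin lerD2l ltW.
Unshelve. all: by end_near. Qed.

(** The majorants [u1] and [u2] add up to a majorant of [h] with integral at most [w], hence at most
    that of [h]. So equality holds almost everywhere, [g] agrees with [u1] off a null set, and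
    completeness of the measure makes [g] measurable. *)
Lemma squeeze_integral D g h v w : lebesgue_measurable D ->
    measurable_fun (D : set T) (EFin \o h) -> (forall t, D t -> 0 <= h t) ->
    (w%:E <= \int[mu]_(t in D) (h t)%:E)%E ->
    majorized D g v -> majorized D (fun t => h t - g t) (w - v) ->
  measurable_fun (D : set T) (EFin \o g) /\ (\int[mu]_(t in D) (g t)%:E = v%:E)%E.
Proof.
move=> mD mh h0 wh [u1 [mu1 u10 gu1 iu1]] [u2 [mu2 u20 gu2 iu2]].
pose k t := (u1 t + u2 t)%E.
have mk : measurable_fun (D : set T) k by exact: emeasurable_funD.
have k0 t : D t -> (0 <= k t)%E by move=> Dt; rewrite adde_ge0 ?u10 ?u20.
have ikE : (\int[mu]_(t in D) k t = \int[mu]_(t in D) u1 t + \int[mu]_(t in D) u2 t)%E.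
  by rewrite ge0_integralD.
have ik : (\int[mu]_(t in D) k t <= w%:E)%E.
  apply: le_trans (_ : v%:E + (w - v)%:E <= _)%E; last by rewrite -EFinD addrC subrK.
  by rewrite ikE leeD.
have intk : mu.-integrable D k.
  apply/integrableP; split => //.
  under eq_integral => t /set_mem Dt do rewrite gee0_abs ?k0//.
  by apply: le_lt_trans ik _; rewrite ltry.
have hk : {ae mu, forall t, D t -> ((h t)%:E <= k t)%E}.
  apply: (aeS2 _ gu1 gu2) => t h1 h2 Dt.
  have := leeD (h1 Dt) (h2 Dt); rewrite -EFinD.
  by rewrite addrC subrK.
have h0' t : D t -> (0 <= (h t)%:E)%E by move=> Dt; rewrite lee_fin h0.
have ih : (\int[mu]_(t in D) (h t)%:E <= \int[mu]_(t in D) k t)%E.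
  exact: ae_ge0_le_integral.
have inth : mu.-integrable D (EFin \o h).
  apply/integrableP; split => //.
  under eq_integral => t /set_mem Dt do rewrite gee0_abs ?h0'//.
  by apply: le_lt_trans ih _; apply: le_lt_trans ik _; rewrite ltry.
have ikh : (\int[mu]_(t in D) `|(k \- (EFin \o h)) t| = 0)%E.
  have -> : (\int[mu]_(t in D) `|(k \- (EFin \o h)) t| =
             \int[mu]_(t in D) (k \- (EFin \o h)) t)%E.
    apply: ae_eq_integral; first exact: mD.
    - by apply: measurableT_comp; [exact: abse_measurable|exact: emeasurable_funB].
    - exact: emeasurable_funB.
    - apply: (aeS _ hk) => t hkt Dt; have := hkt Dt; rewrite -sube_ge0// => kh0.
      exact: gee0_abs.
  rewrite integralB//; apply/eqP; rewrite eq_le; apply/andP; split.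
    by rewrite sube_le0; apply: le_trans ik wh.
  by rewrite sube_ge0 ?ih// (integrable_fin_num mD inth).
have kh : {ae mu, forall t, D t -> k t = (h t)%:E}.
  have /ae_eq_integral_abs : measurable_fun (D : set T) (k \- (EFin \o h))%E.
    exact: emeasurable_funB.
  move=> /(_ mu mD)[/(_ ikh) + _]; apply: aeS => t kht Dt.
  move: (kht Dt) => /=; case: (k t) => [r||]//= [/eqP].
  by rewrite subr_eq0 => /eqP ->.
have u1g : {ae mu, forall t, D t -> u1 t = (g t)%:E}.
  apply: (aeS3 _ gu1 gu2 kh) => t h1 h2 h3 Dt; have := h1 Dt; have := h2 Dt.
  have := h3 Dt; rewrite /k; have := u10 t Dt; have := u20 t Dt.
  case: (u1 t) => [r1||]//; case: (u2 t) => [r2||]// _ _ [rh].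
  by rewrite !lee_fin => g2 g1; congr EFin; apply/eqP; rewrite eq_le g1 andbT; lra.
have mg : measurable_fun (D : set T) (EFin \o g).
  exact: (ae_measurable_fun (@completed_lebesgue_measure_is_complete R) u1g mu1).
split => //.
have -> : (\int[mu]_(t in D) (g t)%:E = \int[mu]_(t in D) u1 t)%E.
  by apply/esym/ae_eq_integral.
(* If the integral of [u1] were below [v], that of [k] would be below [w]. *)
apply/eqP; rewrite eq_le iu1 /= leNgt; apply/negP => lt1.
have : (\int[mu]_(t in D) k t < w%:E)%E.
  have -> : w%:E = (v%:E + (w - v)%:E)%E by rewrite -EFinD addrC subrK.
  rewrite ikE lte_leD// ge0_fin_numE ?integral_ge0//.
  by apply: le_lt_trans iu2 _; rewrite ltry.
by rewrite ltNge (le_trans wh ih).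
Qed.

End squeeze.

(** * Uniform partitions and majorants by step functions *)

Lemma measurable_fun_limn_einf {d} {T : measurableType d} {R : realType} (D : set T)
    (f : nat -> T -> \bar R) : (forall n, measurable_fun D (f n)) ->
  measurable_fun D (fun t => limn_einf (fun n => f n t)).
Proof.
move=> mf; apply: measurableT_comp => //.
by apply: measurable_fun_limn_esup => n; exact: measurableT_comp.
Qed.

Section uniform_partitions.
Context {R : realType}.
Local Notation mu := (@completed_lebesgue_measure R).
Local Notation T := (@lebesgue_type R).
Implicit Types (g h : R -> R).

(** The division points, for [i <= n.+1], of the partition into [n.+1] equal cells; the successor
    avoids division by 0. *)
Definition grid (a b : R) (n i : nat) : R := a + i%:R * ((b - a) / n.+1%:R).

Lemma gridS a b n i : grid a b n i.+1 - grid a b n i = (b - a) / n.+1%:R.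
Proof. by rewrite /grid -natr1 mulrDl mul1r; ring. Qed.

Lemma grid0 a b n : grid a b n 0 = a.
Proof. by rewrite /grid mul0r addr0. Qed.

Lemma grid_last a b n : grid a b n n.+1 = b.
Proof. by rewrite /grid mulrC divfK ?pnatr_eq0// addrC subrK. Qed.

Lemma grid_mono a b n i j : a <= b -> (i <= j)%N -> grid a b n i <= grid a b n j.
Proof.
move=> ab ij; rewrite /grid lerD2l ler_wpM2r ?ler_nat//.
by rewrite divr_ge0// subr_ge0.
Qed.

Lemma grid_in a b n i : a <= b -> (i <= n.+1)%N -> a <= grid a b n i <= b.
Proof.
move=> ab ni; have := grid_mono n ab (leq0n i); have := grid_mono n ab ni.
by rewrite grid0 grid_last => -> ->.
Qed.

Lemma grid_cell a b n t : a < b -> a <= t < b ->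
  exists2 i, (i < n.+1)%N & grid a b n i <= t < grid a b n i.+1.
Proof.
move=> ab /andP[at_ tb]; pose d := (b - a) / n.+1%:R.
have d0 : 0 < d by rewrite divr_gt0// subr_gt0.
have /truncn_itv/andP[n1 n2] : 0 <= (t - a) / d by rewrite divr_ge0 ?subr_ge0// ltW.
exists (Num.truncn ((t - a) / d)).
  rewrite -(ltr_nat R); apply: le_lt_trans n1 _.
  by rewrite ltr_pdivrMr// /d mulrC divfK ?pnatr_eq0// ltrD2r.
move: n1 n2; rewrite ler_pdivlMr// ltr_pdivrMr// /grid -/d => n1 n2.
by apply/andP; split; lra.
Qed.

Lemma grid_mesh a b (d : R) : 0 < d ->
  exists N, forall n, (N <= n)%N -> (b - a) / n.+1%:R < d.
Proof.
move=> d0; exists (Num.truncn (`|b - a| / d)) => n Nn.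
rewrite ltr_pdivrMr ?ltr0n//; apply: le_lt_trans (ler_norm _) _.
rewrite mulrC -ltr_pdivrMr//; apply: lt_le_trans (_ : (Num.truncn (`|b - a| / d)).+1%:R <= _).
  by have /truncn_itv/andP[] : 0 <= `|b - a| / d by rewrite divr_ge0// ltW.
by rewrite ler_nat ltnS.
Qed.

Lemma limn_einf_le (v : nat -> \bar R) (W : \bar R) :
  (forall n, (v n <= W)%E) -> (limn_einf v <= W)%E.
Proof.
move=> vW; rewrite limn_einf_lim; apply: lime_le; first exact: is_cvg_einfs.
apply: nearW => n; apply: le_trans (vW n); apply: ereal_inf_lbound.
by exists n => /=.
Qed.

Lemma limn_einf_ge (v : nat -> \bar R) (x : \bar R) N :
  (forall n, (N <= n)%N -> (x <= v n)%E) -> (x <= limn_einf v)%E.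
Proof.
move=> vx; rewrite limn_einf_lim; apply: lime_ge; first exact: is_cvg_einfs.
near=> n; apply: le_ereal_inf_tmp => _ [m /= nm <-]; apply: vx.
by apply: leq_trans nm; near: n; exact: nbhs_infty_ge.
Unshelve. all: by end_near. Qed.

Lemma ae_neq (b : R) : {ae mu, forall t, t != b}.
Proof.
exists [set b]; split; first by rewrite -set_itv1; exact: lebesgue_measurable_itv.
  by rewrite -set_itv1 [LHS]lebesgue_itv /= ltxx.
by move=> t /= /negP; rewrite negbK => /eqP.
Qed.

(** The majorant is the [liminf] of the step functions with value [c n i] on the i-th cell, and
    Fatou's lemma bounds its integral. The values will be near-suprema of [g] or slopes of a
    primitive. Cells are half-open, so [b] lies in none and is discarded as a null set. *)
Lemma step_majorized (a b W : R) (c : nat -> nat -> R) g : a < b ->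
    (forall n i, 0 <= c n i) ->
    (forall n, \sum_(i < n.+1) c n i * ((b - a) / n.+1%:R) <= W) ->
    {ae mu, forall t, a <= t < b -> forall e : R, 0 < e -> exists N, forall n i,
       (N <= n)%N -> (i < n.+1)%N ->
       grid a b n i <= t < grid a b n i.+1 -> g t <= c n i + e} ->
  majorized `[a, b] g W.
Proof.
move=> ab c0 cW gc.
pose cell n i : set R := `[grid a b n i, grid a b n i.+1[%classic.
have mcell n i : lebesgue_measurable (cell n i) by exact: lebesgue_measurable_itv.
have mD : lebesgue_measurable `[a, b] by exact: lebesgue_measurable_itv.
pose f n (t : R) := (\sum_(i < n.+1) (c n i * \1_(cell n i) t)%:E)%E.
have mterm n i : measurable_fun (`[a, b] : set T) (fun t => (c n i * \1_(cell n i) t)%:E).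
  apply/measurable_EFinP; apply: measurable_funM => //.
  by apply: measurable_indic; exact: mcell.
have t0 n i t : (0 <= (c n i * \1_(cell n i) t)%:E)%E by rewrite lee_fin mulr_ge0.
have f0 n t : (0 <= f n t)%E by apply: sume_ge0 => i _; exact: t0.
have mf n : measurable_fun (`[a, b] : set T) (f n).
  by apply: emeasurable_sum => i; exact: mterm.
exists (fun t => limn_einf (fun n => f n t)); split.
- exact: measurable_fun_limn_einf.
- by move=> t _; apply: (@limn_einf_ge _ _ 0).
- apply: (aeS2 _ gc (ae_neq b)) => t gt tb Dt; apply/lee_addgt0Pr => e e0.
  have Dt' : a <= t < b.
    by move: Dt; rewrite /= in_itv/= lt_neqAle tb => /andP[-> ->].
  have [N gN] := gt Dt' e e0; rewrite -leeBlDr//; apply: (@limn_einf_ge _ _ N) => n Nn.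
  have [i ni ti] := @grid_cell a b n t ab Dt'.
  rewrite /f (bigD1 (Ordinal ni))//= indicE mem_set ?mulr1; last by rewrite /cell /= in_itv.
  apply: (@le_trans _ _ (c n i)%:E); last by rewrite leeDl// sume_ge0.
  by rewrite lee_fin; have := gN n i Nn ni ti; lra.
- apply: le_trans (fatou mu mD mf (fun n t _ => f0 n t)) _.
  apply: limn_einf_le => n.
  rewrite /f ge0_integral_sum; [|exact: mD|by move=> i; exact: mterm|by move=> i t _; exact: t0].
  apply: (@le_trans _ _ (\sum_(i < n.+1) (c n i * ((b - a) / n.+1%:R))%:E)%E); last first.
    by rewrite sumEFin lee_fin.
  apply: lee_sum => i _.
  have mI' : measurable_fun (`[a, b] : set T) (fun t => (\1_(cell n i) t)%:E : \bar R).
    by apply/measurable_EFinP; apply: measurable_indic; exact: mcell.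
  have I0 (t : R) : `[a, b]%classic t -> (0 <= (\1_(cell n i) t : R)%:E)%E by rewrite lee_fin.
  under eq_integral do rewrite EFinM.
  rewrite (ge0_integralZl_EFin mu mD I0 mI' (c0 n i)) integral_indic//; last exact: mcell.
  rewrite EFinM; apply: lee_wpmul2l; first by rewrite lee_fin.
  apply: (@le_trans _ _ (mu (cell n i))).
    apply: le_measure; rewrite ?inE//; last exact: mcell.
    by apply: measurableI; [exact: mcell|exact: mD].
  rewrite lebesgue_itv /= lte_fin; case: ifPn => _; last first.
    by rewrite lee_fin divr_ge0// subr_ge0 ltW.
  by rewrite -EFinB gridS.
Qed.

Lemma integral_itv_ge (x y q : R) (u : R -> \bar R) : x <= y ->
    measurable_fun (`[x, y[ : set T) u -> (forall t, (0 <= u t)%E) ->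
    (forall t, x <= t < y -> (q%:E <= u t)%E) ->
  ((q * (y - x))%:E <= \int[mu]_(t in `[x, y[) u t)%E.
Proof.
move=> xy mf u0 qu.
have mI : lebesgue_measurable `[x, y[ by exact: lebesgue_measurable_itv.
have [q0|q0] := leP q 0.
  apply: (@le_trans _ _ 0%E); last exact: integral_ge0.
  by rewrite lee_fin mulr_le0_ge0// subr_ge0.
have -> : (q * (y - x))%:E = (\int[mu]_(t in `[x, y[) (cst q%:E) t)%E.
  rewrite (integral_cst mu mI) EFinM; congr (_ * _)%E.
  apply/esym; rewrite [LHS]lebesgue_itv /= lte_fin.
  by case: ltgtP xy => // -> _; rewrite subrr.
apply: ge0_le_integral; [exact: mI| |exact: measurable_cst|exact: mf|].
- by move=> t _; rewrite lee_fin ltW.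
- by move=> t; rewrite /= in_itv /= => /qu.
Qed.

End uniform_partitions.

(** * Riemann sums bounded by Lebesgue integrals *)

Section henstock_kurzweil_sums.
Context {R : realType}.
Local Notation mu := (@completed_lebesgue_measure R).
Local Notation T := (@lebesgue_type R).
Implicit Types (g h u delta : R -> R) (s : seq R) (c : nat -> R).

Lemma fine_tag_in a b delta s c : fine_tagged_partition a b delta s c ->
  forall i, (i < size s)%N -> a <= c i <= b.
Proof.
move=> [abs dc] i si; have [/andP[ci1 ci2] _ _] := dc i si.
apply/andP; split.
  by apply: le_trans ci1; apply: itv_partition_nth_ge (abs); rewrite ltnS ltnW.
apply: le_trans ci2 _.
by rewrite -[leLHS]/(nth b (a :: s) i.+1); exact: itv_partition_nth_le (abs).
Qed.

Lemma fine_tagged_partition_le a b delta delta' s c :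
  (forall t, a <= t <= b -> delta t <= delta' t) ->
  fine_tagged_partition a b delta s c -> fine_tagged_partition a b delta' s c.
Proof.
move=> dd' dsc; have cin := fine_tag_in dsc; case: dsc => abs dc; split => // i si.
by have [h1 h2 h3] := dc i si; have := dd' _ (cin i si); split => //; lra.
Qed.

Lemma fine_tagged_partition_cons x x' b t delta s c : x < x' -> x <= t <= x' ->
    t - delta t < x -> x' < t + delta t ->
    fine_tagged_partition x' b delta s c ->
  fine_tagged_partition x b delta (x' :: s) (fun i => if i is i'.+1 then c i' else t).
Proof.
move=> xx' xtx' tx tx' [[ps ls] dc]; split; first by split => //=; rewrite xx'.
by move=> [_|i si] /=; [split|exact: dc].
Qed.

Lemma riemann_sum_cons x x' b t g s c :
  riemann_sum x b g (x' :: s) (fun i => if i is i'.+1 then c i' else t) =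
  g t * (x' - x) + riemann_sum x' b g s c.
Proof. by rewrite /riemann_sum big_ord_recl. Qed.

(** Serves both for integrals over half-open cells and for lengths of cells. *)
Lemma partition_superadditive (K : R -> R -> \bar R) a b s : itv_partition a b s ->
    (forall x, K x x = 0)%E ->
    (forall x y z, a <= x -> x <= y -> y <= z -> z <= b -> (K x y + K y z <= K x z)%E) ->
  (\sum_(i < size s) K (nth b (a :: s) i) (nth b s i) <= K a b)%E.
Proof.
elim: s a => [a /itv_partition_nil <- K0 _|x s IH a abs K0 KD]; first by rewrite big_ord0 K0.
have xb := itv_partition_le (itv_partition_cons abs).
have ax : a <= x by case: abs => /= /andP[/ltW].
rewrite big_ord_recl /=; apply: le_trans (KD a x b (lexx _) ax xb (lexx _)).
apply: leeD2l; apply: IH => //; first exact: itv_partition_cons abs.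
by move=> u v w xu; apply: KD; exact: le_trans xu.
Qed.

(** A lower semicontinuous majorant [g] of [hat] exceeds [u t - e'] on a neighbourhood of each [t].
    With this gauge, a term of a Riemann sum is at most the integral of [g] over its cell plus [e']
    times the length. Since [hat] may be infinite, [u] may be arbitrary on a null set. *)
Lemma ge0_gauge a b u (hat : R -> \bar R) (W e : R) : a <= b ->
    measurable_fun (`[a, b] : set T) hat -> (forall t, a <= t <= b -> (0 <= hat t)%E) ->
    (forall t, a <= t <= b -> ((u t)%:E <= hat t)%E) ->
    (\int[mu]_(t in `[a, b]) hat t <= W%:E)%E -> 0 < e ->
  exists delta, (forall t, 0 < delta t) /\
    forall s c, fine_tagged_partition a b delta s c -> riemann_sum a b u s c <= W + e.
Proof.
move=> ab mhat hat0 uhat iW e0.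
have mD : lebesgue_measurable `[a, b] by exact: lebesgue_measurable_itv.
have inD t : `[a, b]%classic t -> a <= t <= b by rewrite /= in_itv.
have e20 : 0 < e / 2 by rewrite divr_gt0.
have Dfin : (mu `[a, b] < +oo)%E.
  by rewrite lebesgue_itv /=; case: ifP => _; rewrite ?ltry// -EFinB ltry.
have [g [lg g0 hg ig]] := lsc_majorant mD Dfin mhat (fun t Dt => hat0 t (inD t Dt)) e20.
have mg (D : set R) : measurable_fun (D : set T) g.
  by apply: borel_lebesgue_fun; exact: lower_semicontinuous_measurable.
(* Half of [e] is spent on the majorant and at most [e' * (b - a) <= e / 2] on the gauge; the [+ 1]
   covers [a = b]. *)
pose e' := e / (2 * (b - a + 1)).
have ba1 : 0 < 2 * (b - a + 1) by lra.
have e'0 : 0 < e' by rewrite divr_gt0.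
have e'E : e' * (b - a) <= e / 2.
  by rewrite /e' mulrAC ler_pdivrMr//; nra.
have /choice[delta dP] : forall t : R, exists d : R, 0 < d /\
    (a <= t <= b -> forall y, t - d < y < t + d -> ((u t - e')%:E < g y)%E).
  move=> t; have [tab|tab] := pselect (a <= t <= b); last by exists 1.
  have : ((u t - e')%:E < g t)%E.
    apply: lt_le_trans (hg t _); last by rewrite /= in_itv.
    by apply: lt_le_trans (uhat t tab); rewrite lte_fin; lra.
  move=> /lg[V /nbhs_ballP[d /= d0 dV] Vg]; exists d; split => // _ y ty.
  by apply/Vg/dV; rewrite -ball_normE /= ltr_norml; lra.
exists delta; split=> [t|s c dsc]; first by case: (dP t).
have [abs dc] := dsc.
pose K x y := (\int[mu]_(t in `[x, y[) g t)%E.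
have mI x y : lebesgue_measurable `[x, y[ by exact: lebesgue_measurable_itv.
have K0 x : (K x x = 0)%E by rewrite /K set_itvco0// integral_set0.
have KD x y z : a <= x -> x <= y -> y <= z -> z <= b -> (K x y + K y z <= K x z)%E.
  move=> _ xy yz _.
  have dj : [disjoint `[x, y[%classic & `[y, z[%classic].
    apply/eqP; rewrite -subset0 => t [/=]; rewrite !in_itv /= => /andP[_ ty] /andP[yt _].
    by have := lt_le_trans ty yt; rewrite ltxx.
  rewrite /K (_ : `[x, z[%classic = `[x, y[%classic `|` `[y, z[%classic).
    by rewrite (ge0_integral_setU mu (mI _ x y) (mI _ y z) (mg _) (fun t _ => g0 t) dj).
  by rewrite -itv_bndbnd_setU// bnd_simp.
have term (i : 'I_(size s)) :
    (((u (c i) - e') * (nth b s i - nth b (a :: s) i))%:E <= K (nth b (a :: s) i) (nth b s i))%E.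
  have := dc i (ltn_ord i); set x := nth b (a :: s) i; set y := nth b s i => -[xcy cx cy].
  have cab := fine_tag_in dsc (ltn_ord i).
  have xy : x <= y by lra.
  apply: (integral_itv_ge xy (mg _) g0).
  move=> t /andP[xt ty]; apply/ltW.
  have [_] := dP (c i); apply => //.
  by clear -cx cy xt ty; lra.
have Kab : (K a b <= (W + e / 2)%:E)%E.
  rewrite EFinD; apply: (@le_trans _ _ (\int[mu]_(t in `[a, b]) g t)%E); last first.
    by apply: le_trans ig _; exact: leeD2r.
  apply: (ge0_subset_integral mu (mI _ a b) mD (mg _) (fun t _ => g0 t)).
  by move=> t /=; rewrite !in_itv /= => /andP[-> /ltW ->].
have := le_trans (le_trans (lee_sum _ (fun i _ => term i)) (partition_superadditive abs K0 KD)) Kab.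
have len : \sum_(i < size s) (nth b s i - nth b (a :: s) i) <= b - a.
  rewrite -lee_fin -sumEFin.
  apply: (@partition_superadditive (fun x y => (y - x)%:E)) => // [x|x y z *].
    by rewrite subrr.
  by rewrite -EFinD lee_fin; lra.
rewrite sumEFin lee_fin.
under eq_bigr do rewrite mulrBl; rewrite sumrB -mulr_sumr.
rewrite /riemann_sum; nra.
Qed.

End henstock_kurzweil_sums.

(** * Dominated Henstock-Kurzweil integrals *)

Section henstock_kurzweil_dominated.
Context {R : realType}.
Local Notation mu := (@completed_lebesgue_measure R).
Local Notation T := (@lebesgue_type R).
Implicit Types (g h u delta : R -> R) (s : seq R) (c : nat -> R).

Definition fine_sum delta g (a b r : R) : Prop :=
  exists s c, fine_tagged_partition a b delta s c /\ riemann_sum a b g s c = r.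

Lemma fine_sum_nil delta g b : fine_sum delta g b b 0.
Proof. by exists [::], (fun=> b); split => //; rewrite /riemann_sum big_ord0. Qed.

Lemma fine_sum_cons delta g x x' b t r : x < x' -> x <= t <= x' ->
    t - delta t < x -> x' < t + delta t -> fine_sum delta g x' b r ->
  fine_sum delta g x b (g t * (x' - x) + r).
Proof.
move=> xx' xtx' tx tx' [s [c [dsc <-]]].
exists (x' :: s), (fun i => if i is i'.+1 then c i' else t); split.
  exact: fine_tagged_partition_cons.
by rewrite riemann_sum_cons.
Qed.

(** Cousin's lemma, run leftwards from [b]: the infimum of the reachable left ends is reachable and
    cannot exceed [a]. As [g] is nonnegative, added cells do not decrease the sum. *)
Lemma fine_sum_extend delta g a b r : (forall t, 0 < delta t) ->
    (forall t, a <= t <= b -> 0 <= g t) -> a <= b ->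
    forall z, b <= z -> fine_sum delta g b z r ->
  exists2 r', r <= r' & fine_sum delta g a z r'.
Proof.
move=> d0 g0 ab z bz br.
pose A := [set y | a <= y <= b /\ exists2 r', r <= r' & fine_sum delta g y z r'].
have Ab : A b by split; [rewrite ab lexx|exists r].
have hA : has_inf A.
  by split; [exists b|exists a => y [/andP[]]].
have am : a <= inf A by apply: lb_le_inf; [exact: hA.1|move=> y [/andP[]]].
have mb : inf A <= b by apply: ge_inf; [exact: hA.2|].
have mA y : A y -> inf A <= y by move=> Ay; apply: ge_inf => //; exact: hA.2.
set m := inf A in am mb mA.
(* A reachable [y] within [delta m] of [m] is joined to [m] by one cell with tag [m]. *)
have Am : A m.
  have [y [/andP[ay yb] [r' rr' yr']] ym] := inf_adherent (d0 m) hA.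
  have my : m <= y by apply: mA; split; [rewrite ay|exists r'].
  have [<-|ny] := eqVneq y m; first by split; [rewrite ay|exists r'].
  have my' : m < y by rewrite lt_neqAle eq_sym ny.
  split; first by rewrite am.
  exists (g m * (y - m) + r').
    have : 0 <= g m by apply: g0; rewrite am.
    by move=> gm0; rewrite ler_wpDl// mulr_ge0// subr_ge0.
  apply: fine_sum_cons => //; first by rewrite lexx.
  by rewrite ltrBlDr ltrDl.
have [_ [r' rr' mr']] := Am.
have [ma|ma] := leP m a.
  by exists r' => //; have <- : m = a by apply/eqP; rewrite eq_le ma am.
(* One more cell tagged by [m] itself would reach below the infimum. *)
pose x := Num.max a (m - delta m / 2).
have dm2 : 0 < delta m / 2 by rewrite divr_gt0.
have xm : x < m by rewrite /x gt_max ma /= ltrBlDr ltrDl.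
have ax : a <= x by rewrite /x le_max lexx.
suff /mA : A x by rewrite leNgt xm.
split; first by rewrite ax (le_trans (ltW xm)).
exists (g m * (m - x) + r').
  have : 0 <= g m by apply: g0; rewrite am.
  by move=> gm0; rewrite ler_wpDl// mulr_ge0// subr_ge0 ltW.
apply: fine_sum_cons => //; first by rewrite lexx (ltW xm).
  by rewrite /x lt_max; apply/orP; right; have := d0 m; lra.
by rewrite ltrDl.
Qed.

(* On the set where the gauge exceeds the mesh, the supremum of g over a cell of
   the uniform partition is almost attained at the tag of a fine partition. *)
Lemma ge0_sums_majorized delta g a b W : a < b -> (forall t, 0 < delta t) ->
    (forall t, a <= t <= b -> 0 <= g t) ->
    (forall r, fine_sum delta g a b r -> r <= W) ->
  majorized `[a, b] g W.
Proof.
move=> ab d0 g0 gW; have ab' := ltW ab.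
pose d (n : nat) := (b - a) / n.+1%:R.
have d_0 n : 0 < d n by rewrite divr_gt0// subr_gt0.
(* At such a point the gauge exceeds the mesh, so [t] is an admissible tag for its whole cell. *)
pose E n i t := grid a b n i <= t < grid a b n i.+1 /\ d n < delta t.
have Eab n i t : (i < n.+1)%N -> E n i t -> a <= t <= b.
  move=> ni [/andP[it ti] _]; have /andP[h1 _] := grid_in ab' (ltnW ni).
  have /andP[_ h2] := grid_in ab' ni; apply/andP; split; first exact: le_trans it.
  exact: le_trans (ltW ti) h2.
have Econs n i t r : (i < n.+1)%N -> E n i t -> fine_sum delta g (grid a b n i.+1) b r ->
    fine_sum delta g (grid a b n i) b (g t * d n + r).
  move=> ni [/andP[it ti] dt]; have := gridS a b n i; rewrite -/(d n) => dE.
  rewrite -dE; have := d_0 n => dn0.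
  by apply: fine_sum_cons; [lra|rewrite it ltW|lra|lra].
have ext n i r : (i <= n.+1)%N -> fine_sum delta g (grid a b n i) b r ->
    exists2 r', r <= r' & fine_sum delta g a b r'.
  move=> ni; have /andP[ai ib] := grid_in ab' ni.
  apply: fine_sum_extend => // t /andP[at_ ti]; apply: g0.
  by rewrite at_ (le_trans ti).
have ext1 n i : (i < n.+1)%N -> forall r, fine_sum delta g (grid a b n i.+1) b r ->
    exists2 r', r <= r' & fine_sum delta g (grid a b n i) b r'.
  move=> ni r; have /andP[ai ib] := grid_in ab' (ltnW ni).
  have /andP[ai' ib'] := grid_in ab' ni.
  apply: fine_sum_extend => // [t /andP[at_ ti]|]; last exact: grid_mono.
  by apply: g0; rewrite (le_trans ai at_) (le_trans ti).
(* The cell tagged by [t], completed on both sides by [fine_sum_extend], contributes [g t * d n] to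
   a sum bounded by [W]. *)
have Ebound n i t : (i < n.+1)%N -> E n i t -> g t <= W / d n.
  move=> ni Et; rewrite ler_pdivlMr//.
  have /andP[ai' ib'] := grid_in ab' ni.
  have [||r r0 Hr] := @fine_sum_extend delta g (grid a b n i.+1) b 0 d0 _ ib' b (lexx b).
  - by move=> u /andP[h1 h2]; apply: g0; rewrite (le_trans ai' h1).
  - exact: fine_sum_nil.
  have [r' rr' ar'] := ext n i _ (ltnW ni) (Econs _ _ _ _ ni Et Hr).
  by have := gW _ ar'; lra.
(* The near-supremum is a value at an admissible tag; a cell without admissible tags gets the value
   0. *)
have tag n i : exists c : R, 0 <= c /\ ((i < n.+1)%N ->
    (forall t, E n i t -> g t <= c + n.+1%:R^-1) /\
    (c = 0 \/ exists2 t, E n i t & c = g t)).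
  have [ni|ni] := boolP (i < n.+1)%N; last by exists 0.
  have [[t0 Et0]|NE] := pselect (exists t, E n i t); last first.
    exists 0; split => // _; split; last by left.
    by move=> t Et; exfalso; apply: NE; exists t.
  have hs : has_sup [set g t | t in E n i].
    split; first by exists (g t0), t0.
    by exists (W / d n) => _ [t Et <-]; exact: Ebound Et.
  have n0 : (0 : R) < n.+1%:R^-1 by rewrite invr_gt0.
  have [_ [t Et <-] gt] := sup_adherent n0 hs.
  exists (g t); split; first by apply: g0; exact: Eab Et.
  move=> _; split; last by right; exists t.
  move=> t' Et'; have : g t' <= sup [set g t | t in E n i].
    by apply: ub_le_sup; [exact: hs.2|exists t'].
  by move=> /le_trans; apply; rewrite -lerBlDr ltW.
have /choice[c cP] : forall ni : nat * nat, exists c : R, 0 <= c /\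
    ((ni.2 < ni.1.+1)%N ->
    (forall t, E ni.1 ni.2 t -> g t <= c + ni.1.+1%:R^-1) /\
    (c = 0 \/ exists2 t, E ni.1 ni.2 t & c = g t)).
  by move=> [n i]; exact: tag.
apply: (@step_majorized _ a b W (fun n i => c (n, i))) => //.
- by move=> n i; case: (cP (n, i)).
- move=> n; rewrite -/(d n).
  (* The partition is assembled from the right end: a cell with a chosen tag is used whole, any
     other one is filled by [fine_sum_extend]. *)
  have part k : (k <= n.+1)%N -> exists2 r,
      \sum_(n.+1 - k <= i < n.+1) c (n, i) * d n <= r &
      fine_sum delta g (grid a b n (n.+1 - k)) b r.
    elim: k => [_|k IH kn].
      by exists 0; rewrite subn0 ?big_geq// grid_last; exact: fine_sum_nil.
    have [r rk Hr] := IH (ltnW kn).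
    have ni : (n.+1 - k.+1 < n.+1)%N by rewrite ltn_subrL.
    have iE : (n.+1 - k)%N = (n.+1 - k.+1).+1 by rewrite -subSn// subSS.
    rewrite big_ltn//; rewrite iE in rk Hr.
    have [c0 /(_ ni)[_ [->|[t Et ->]]]] := cP (n, (n.+1 - k.+1)%N).
      have [r' rr' Hr'] := ext1 n _ ni _ Hr.
      by exists r' => //; rewrite mul0r add0r; exact: le_trans rr'.
    exists (g t * d n + r); first by rewrite lerD2l.
    exact: Econs.
  have [r rs Hr] := part n.+1 (leqnn _).
  rewrite subnn grid0 in rs Hr.
  by rewrite -(big_mkord xpredT (fun i => c (n, i) * d n)); exact: le_trans (gW _ Hr).
- apply: (@aeW _ T R mu) => t /andP[at_ tb] e e0.
  (* From [N1] on the mesh is below [delta t], so [t] is admissible; from [N2] on the loss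
     [1 / n.+1] is below [e]. *)
  have [N1 hN1] := grid_mesh a b (d0 t).
  have [N2 hN2] := grid_mesh 0 1 e0.
  exists (maxn N1 N2) => n i; rewrite geq_max => /andP[n1 n2] ni ti.
  have [_ /(_ ni)[+ _]] := cP (n, i) => /(_ t) H.
  apply: le_trans (H _) _; first by split => //; exact: hN1.
  by rewrite lerD2l; have := hN2 n n2; rewrite subr0 div1r => /ltW.
Qed.

Lemma riemann_sum_le a b delta s c g h : fine_tagged_partition a b delta s c ->
  (forall t, a <= t <= b -> g t <= h t) -> riemann_sum a b g s c <= riemann_sum a b h s c.
Proof.
move=> dsc gh; apply: ler_sum => i _; apply: ler_wpM2r.
  have [_ /(_ i (ltn_ord i))[/andP[h1 h2] _ _]] := dsc.
  by rewrite subr_ge0 (le_trans h1).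
by apply: gh; exact: fine_tag_in dsc _ (ltn_ord i).
Qed.

Lemma riemann_sumD a b s c g h :
  riemann_sum a b (fun t => g t + h t) s c = riemann_sum a b g s c + riemann_sum a b h s c.
Proof. by rewrite /riemann_sum -big_split; apply: eq_bigr => i _; rewrite mulrDl. Qed.

Let eq_lee (x y : \bar R) : x = y -> (x <= y)%E.
Proof. by move=> ->. Qed.

(** The representatives [g1'] and [g2'] are uncontrolled on a null set [Z], so [gg] and [hh] are set
    to 0 there and the discrepancy [wz] lives on [Z]. A gauge makes its Riemann sums small; then
    sums of [gg] are close to [v1 + v2] and those of [hh] are at most [w + e], which gives both
    majorants for the squeeze. *)
Lemma HK_dominated a b (g1 g2 g h : R -> \bar R) v1 v2 : a < b ->
    HK_integral a b g1 v1 -> HK_integral a b g2 v2 ->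
    mu.-integrable `[a, b] h ->
    {ae mu, forall t : R, a <= t <= b -> (g1 t + g2 t = g t)%E} ->
    {ae mu, forall t : R, a <= t <= b -> (0 <= g t <= h t)%E} ->
  measurable_fun (`[a, b] : set T) g /\ (\int[mu]_(t in `[a, b]) g t = (v1 + v2)%:E)%E.
Proof.
move=> ab [g1' [E1 HK1]] [g2' [E2 HK2]] inth gsum gh.
have mD : lebesgue_measurable `[a, b] by exact: lebesgue_measurable_itv.
have inD t : `[a, b]%classic t -> a <= t <= b by rewrite /= in_itv.
have Din t : a <= t <= b -> `[a, b]%classic t by rewrite /= in_itv.
have mh := measurable_int mu inth.
have E34 := aeS2 (fun t => @conj _ _) gsum gh.
have E345 := aeS2 (fun t => @conj _ _) E34 (integrable_ae mD inth).
have : {ae mu, forall t : R, a <= t <= b ->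
    (g t = (g1' t + g2' t)%:E)%E /\ ((0 <= g t <= h t)%E /\ h t \is a fin_num)}.
  apply: (aeS3 _ E1 E2 E345) => t e1 e2 [[e3 e4] e5] tab; split.
    by rewrite -e3// e1// e2.
  by split; [exact: e4|apply: e5; exact: Din].
move=> [Z [mZ Z0 PZ]].
have offZ t : a <= t <= b -> ~ Z t ->
    (g t = (g1' t + g2' t)%:E)%E /\ ((0 <= g t <= h t)%E /\ h t \is a fin_num).
  by move=> tab nZ; apply: contrapT => nP; apply/nZ/PZ => /= /(_ tab).
pose gg t := if t \in Z then 0 else g1' t + g2' t.
pose hh t := if t \in Z then 0 else fine (h t).
have gghh t : a <= t <= b -> 0 <= gg t <= hh t.
  rewrite /gg /hh => tab; case: (boolP (t \in Z)); first by rewrite lexx.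
  rewrite notin_setE => nZ; have [-> [gt ht]] := offZ t tab nZ.
  by rewrite -!lee_fin fineK.
have aeZ : {ae mu, forall t, t \notin Z}.
  by exists Z; split => // t /= /negP; rewrite negbK inE.
have ghE : {ae mu, forall t, `[a, b]%classic t -> (gg t)%:E = g t}.
  apply: (aeS _ aeZ) => t tZ Dt; have nZ : ~ Z t by rewrite -notin_setE.
  by have [-> _] := offZ t (inD t Dt) nZ; rewrite /gg (negbTE tZ).
have hhE : {ae mu, forall t, `[a, b]%classic t -> h t = (hh t)%:E}.
  apply: (aeS _ aeZ) => t tZ Dt; have nZ : ~ Z t by rewrite -notin_setE.
  by have [_ [_ hf]] := offZ t (inD t Dt) nZ; rewrite /hh (negbTE tZ) fineK.
have cmp := @completed_lebesgue_measure_is_complete R.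
have mhh : measurable_fun (`[a, b] : set T) (EFin \o hh).
  exact: (ae_measurable_fun cmp hhE mh).
pose w := fine (\int[mu]_(t in `[a, b]) h t)%E.
have wE : (\int[mu]_(t in `[a, b]) (hh t)%:E = w%:E)%E.
  rewrite /w fineK; last exact: (integrable_fin_num mD inth).
  apply: ae_eq_integral; [exact: mD|exact: mhh|exact: mh|].
  by apply: (aeS _ hhE) => t H Dt; rewrite H.
(* Infinite on the null set and 0 elsewhere: a majorant of the absolute value of [wz] with integral
   0. *)
pose hat t : \bar R := if t \in Z then +oo%E else 0%E.
have hatE : {ae mu, forall t, `[a, b]%classic t -> cst 0%E t = hat t}.
  by apply: (aeS _ aeZ) => t tZ _; rewrite /hat (negbTE tZ).
have mhat : measurable_fun (`[a, b] : set T) hat.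
  by apply: (ae_measurable_fun cmp hatE); exact: measurable_cst.
have ihat : (\int[mu]_(t in `[a, b]) hat t <= 0%:E)%E.
  apply: eq_lee; transitivity (\int[mu]_(t in `[a, b]) (cst 0%E t))%E; last exact: integral0.
  apply: ae_eq_integral; [exact: mD|exact: mhat|exact: measurable_cst|].
  by apply: (aeS _ hatE) => t H Dt; rewrite -H.
have hat0 t : a <= t <= b -> (0 <= hat t)%E by rewrite /hat; case: ifP.
pose wz t := g1' t + g2' t - gg t.
have wzhat t : a <= t <= b -> (`|wz t|%:E <= hat t)%E.
  by rewrite /wz /hat /gg; case: ifP => _ _; rewrite ?leey// subrr normr0.
have ggE t : gg t = g1' t + g2' t - wz t by rewrite /wz opprB addrC subrK.
have gauge e : 0 < e -> exists delta, (forall t, 0 < delta t) /\ forall s c,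
    fine_tagged_partition a b delta s c ->
    [/\ riemann_sum a b hh s c <= w + e, riemann_sum a b gg s c <= v1 + v2 + 3 * e &
        v1 + v2 - 3 * e <= riemann_sum a b gg s c].
  move=> e0.
  have [d1 [d1p d1P]] := HK1 e e0; have [d2 [d2p d2P]] := HK2 e e0.
  have hh0 t : a <= t <= b -> (0 <= (hh t)%:E)%E.
    by move=> /gghh/andP[x y]; rewrite lee_fin (le_trans x).
  have [d3 [d3p d3P]] := ge0_gauge (ltW ab) mhh hh0 (fun t _ => lexx _) (eq_lee wE) e0.
  have [d4 [d4p d4P]] := ge0_gauge (ltW ab) mhat hat0 wzhat ihat e0.
  (* Outside of [[a, b]] the given gauges need not be positive, hence the default 1. *)
  pose d t := if a <= t <= b then Num.min (Num.min (d1 t) (d2 t)) (Num.min (d3 t) (d4 t)) else 1.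
  exists d; split.
    move=> t; rewrite /d; case: ifP => // tab.
    by rewrite !lt_min d1p// d2p// d3p d4p.
  move=> s c dsc.
  have sub d' : (forall t, a <= t <= b -> d t <= d' t) -> fine_tagged_partition a b d' s c.
    by move=> dd'; exact: fine_tagged_partition_le dd' dsc.
  have f1 : fine_tagged_partition a b d1 s c.
    by apply: sub => t tab; rewrite /d tab !ge_min lexx.
  have f2 : fine_tagged_partition a b d2 s c.
    by apply: sub => t tab; rewrite /d tab !ge_min lexx orbT.
  have f3 : fine_tagged_partition a b d3 s c.
    by apply: sub => t tab; rewrite /d tab !ge_min lexx !orbT.
  have f4 : fine_tagged_partition a b d4 s c.
    by apply: sub => t tab; rewrite /d tab !ge_min lexx !orbT.
  have H1 := d1P s c f1; have H2 := d2P s c f2; have H3 := d3P s c f3.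
  have H4 := d4P s c f4.
  have sumE : riemann_sum a b g1' s c + riemann_sum a b g2' s c =
      riemann_sum a b gg s c + riemann_sum a b wz s c.
    rewrite -!riemann_sumD; congr (riemann_sum a b _ s c).
    by apply/funext => t; rewrite ggE subrK.
  have W1 : riemann_sum a b wz s c <= riemann_sum a b (fun t => `|wz t|) s c.
    by apply: (riemann_sum_le dsc) => t _; exact: ler_norm.
  have W2 : 0 <= riemann_sum a b wz s c + riemann_sum a b (fun t => `|wz t|) s c.
    rewrite -riemann_sumD.
    have -> : 0 = riemann_sum a b (fun=> 0) s c.
      by rewrite /riemann_sum big1// => i _; rewrite mul0r.
    apply: (riemann_sum_le dsc) => t _.
    by have := ler_norm (- wz t); rewrite normrN lerNl -subr_ge0 opprK addrC.
  move: H1 H2; rewrite !ltr_norml => /andP[H1 H1'] /andP[H2 H2'].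
  by clear -H1 H1' H2 H2' H3 H4 sumE W1 W2; split; lra.
have hh0 t : `[a, b]%classic t -> 0 <= hh t.
  by move=> /inD/gghh/andP[x y]; exact: le_trans y.
have [||mgg igg] := @squeeze_integral R `[a, b] gg hh (v1 + v2) w mD mhh hh0 (eq_lee (esym wE)).
- apply: majorized_inf => // e e0.
  have e3 : 0 < e / 3 by rewrite divr_gt0.
  have [delta [d0 dP]] := gauge _ e3.
  apply: (ge0_sums_majorized ab d0) => [t /gghh/andP[]//|r [s [c [dsc <-]]]].
  by have [_ H _] := dP s c dsc; clear -H; lra.
- apply: majorized_inf => // e e0.
  (* With [e' = e / 4], sums of [hh - gg] are at most [w + e' - (v1 + v2 - 3 * e') = w - (v1 + v2) +
     e]. *)
  have e4 : 0 < e / 4 by rewrite divr_gt0.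
  have [delta [d0 dP]] := gauge _ e4.
  apply: (ge0_sums_majorized ab d0) => [t /gghh/andP[_]|r [s [c [dsc <-]]]].
    by rewrite subr_ge0.
  have [H1 _ H2] := dP s c dsc.
  have : riemann_sum a b hh s c =
      riemann_sum a b (fun t => hh t - gg t) s c + riemann_sum a b gg s c.
    rewrite -riemann_sumD; congr (riemann_sum a b _ s c).
    by apply/funext => t; rewrite subrK.
  by clear -H1 H2; lra.
have mg : measurable_fun (`[a, b] : set T) g by exact: (ae_measurable_fun cmp ghE).
split => //; rewrite -igg; apply: ae_eq_integral; [exact: mD|exact: mg|exact: mgg|].
by apply: (aeS _ ghE) => t H Dt; rewrite H.
Qed.

End henstock_kurzweil_dominated.

(** * Absolute continuity on sets and images of null sets *)

Section absolute_continuity.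
Context {R : realType}.
Local Notation mu := (@completed_lebesgue_measure R).
Local Notation T := (@lebesgue_type R).
Local Notation out := ((@wlength R idfun)^*)%mu.
Implicit Types (E Z D : set R) (F : R -> R).

Lemma absolutely_continuous_onP E F : absolutely_continuous_on E F ->
  forall e : R, 0 < e -> exists2 d : R, 0 < d &
    forall (n : nat) (a b : 'I_n -> R), (forall i, a i <= b i) ->
      (forall i, a i < b i -> E (a i) /\ E (b i)) ->
      (forall i j, i != j -> a i < b i -> a j < b j -> b i <= a j \/ b j <= a i) ->
      \sum_(i < n) (b i - a i) < d -> \sum_(i < n) `|F (b i) - F (a i)| < e.
Proof.
move=> acE e e0; have [d d0 dP] := acE e e0; exists d => // n a b ab Eab dis sd.
pose P := [pred i | a i < b i].
have out_P (f : R -> R -> R) : (forall x, f x x = 0) ->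
    \sum_(i < n) f (a i) (b i) = \sum_(i < #|P|) f (a (enum_val i)) (b (enum_val i)).
  move=> f0; rewrite -(big_enum_val (A := P) (fun i => f (a i) (b i))) [RHS]big_mkcond.
  apply: eq_bigr => i _; rewrite inE; case: ifPn => // /negP nab.
  suff -> : a i = b i by [].
  by apply/eqP; rewrite eq_le ab /= leNgt; apply/negP.
have Pi (i : 'I_#|P|) : a (enum_val i) < b (enum_val i) by have := enum_valP i.
rewrite (out_P (fun x y => `|F y - F x|)) => [|x]; last by rewrite subrr normr0.
apply: dP => [i|i j ij|].
- by have [] := Eab _ (Pi i); split.
- apply: dis; rewrite ?Pi//; apply: contra_neq ij; exact: enum_val_inj.
- by rewrite -(out_P (fun x y => y - x))// => x; rewrite subrr.
Qed.

Lemma absolutely_continuous_onS E E' F : E' `<=` E ->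
  absolutely_continuous_on E F -> absolutely_continuous_on E' F.
Proof.
move=> sub acE e e0; have [d d0 dP] := acE e e0; exists d => // n a b Eab.
by apply: dP => i; have [/sub ? /sub ? ?] := Eab i.
Qed.

Lemma absolutely_continuous_onD E F G : absolutely_continuous_on E F ->
  absolutely_continuous_on E G -> absolutely_continuous_on E (fun t => F t + G t).
Proof.
move=> acF acG e e0; have e20 : 0 < e / 2 by rewrite divr_gt0.
have [d1 d10 d1P] := acF _ e20; have [d2 d20 d2P] := acG _ e20.
exists (Num.min d1 d2); first by rewrite lt_min d10.
move=> n a b Eab dis; rewrite lt_min => /andP[s1 s2].
have := d1P n a b Eab dis s1; have := d2P n a b Eab dis s2 => h1 h2.
have h : \sum_(i < n) `|F (b i) + G (b i) - (F (a i) + G (a i))| <=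
    \sum_(i < n) `|F (b i) - F (a i)| + \sum_(i < n) `|G (b i) - G (a i)|.
  rewrite -big_split /=; apply: ler_sum => i _.
  by rewrite opprD addrACA; exact: ler_normD.
by lra.
Qed.

Lemma absolutely_continuous_onZ E F (k : R) : absolutely_continuous_on E F ->
  absolutely_continuous_on E (fun t => k * F t).
Proof.
move=> acF e e0; have k0 : 0 < `|k| + 1 by rewrite ltr_pwDr.
have ek0 : 0 < e / (`|k| + 1) by rewrite divr_gt0.
have [d d0 dP] := acF _ ek0; exists d => // n a b Eab dis sd.
have := dP n a b Eab dis sd; rewrite ltr_pdivlMr// => h.
apply: le_lt_trans h; rewrite mulr_suml; apply: ler_sum => i _.
by rewrite -mulrBr normrM mulrC ler_wpM2l// lerDl.
Qed.

Lemma absolutely_continuous_on_id E : absolutely_continuous_on E id.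
Proof.
move=> e e0; exists e => // n a b Eab _; apply: le_lt_trans.
by apply: ler_sum => i _; have [_ _ ab] := Eab i; rewrite ger0_norm// subr_ge0 ltW.
Qed.

(* Half of the oscillation of F on a bounded piece is attained by a pair; the
   pieces are the traces of the components of a small open neighbourhood. *)
Lemma absolutely_continuous_on_null E F Z : absolutely_continuous_on E F -> Z `<=` E ->
  (out Z = 0)%E -> (out (F @` Z) = 0)%E.
Proof.
move=> acE ZE Z0; apply/eqP; rewrite eq_le outer_measure_ge0 andbT.
apply/lee_addgt0Pr => e e0; rewrite add0e.
(* Each piece of the image will be covered by an interval of length 4 times the increment of [F]
   over a pair. *)
have e40 : 0 < e / 4 by rewrite divr_gt0.
have [d d0 dP] := absolutely_continuous_onP acE e40.
have d20 : 0 < d / 2 by rewrite divr_gt0.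
have [U [oU ZU muU]] := outer_measure_open_le Z d20.
have {}muU : (mu U < d%:E)%E.
  by apply: le_lt_trans muU _; rewrite Z0 add0e lte_fin ltr_pdivrMr// ltr_pMr// ltr1n.
pose I := open_disjoint_itv oU.
have mI k : lebesgue_measurable (I k) by apply/lebesgue_measurable_open/open_disjoint_itv_open.
have sI : (\sum_(k <oo) mu (I k) < d%:E)%E.
  rewrite -(@measure_semi_bigcup _ R T mu I)//.
  - by rewrite /I -open_disjoint_itv_bigcup.
  - exact: open_disjoint_itv_trivIset.
  - by rewrite /I -open_disjoint_itv_bigcup; exact: lebesgue_measurable_open.
have lenI k x y : x <= y -> I k x -> I k y -> ((y - x)%:E <= mu (I k))%E.
  move=> xy Ix Iy; apply: (@le_trans _ _ (mu `[x, y])).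
    rewrite lebesgue_itv /= lte_fin -EFinB; case: ifPn => //.
    by rewrite -leNgt => yx; rewrite lee_fin subr_le0.
  apply: le_outer_measure => t /=; rewrite in_itv /= => xty.
  exact: (open_disjoint_itv_is_interval Ix Iy).
have muId k : (mu (I k) < d%:E)%E.
  apply: le_lt_trans sI.
  have := @nneseries_lim_ge R (fun k => mu (I k)) xpredT 0 k.+1 (fun _ _ _ => measure_ge0 mu _).
  apply: le_trans; rewrite big_nat_recr//= leeDr//.
  by apply: sume_ge0 => i _; exact: measure_ge0.
(* A piece that is empty, or on which [F] is constant, gets a trivial pair. *)
have pairs k : exists p : R * R, [/\ p.1 <= p.2,
    p.1 < p.2 -> (Z `&` I k) p.1 /\ (Z `&` I k) p.2 &
    forall z, (Z `&` I k) z -> `|F z - F p.1| <= 2 * `|F p.2 - F p.1|].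
  have [[z0 [Zz0 Iz0]]|S0] := pselect (exists z, (Z `&` I k) z); last first.
    by exists (0, 0); split => //= [|z Sz]; [rewrite ltxx|exfalso; apply: S0; exists z].
  have bnd x y : (Z `&` I k) x -> (Z `&` I k) y -> x <= y -> `|F y - F x| < e / 4.
    move=> [Zx Ix] [Zy Iy] xy.
    have := dP 1%N (fun=> x) (fun=> y); rewrite !big_ord1; apply => //.
    - by move=> _ _; split; exact: ZE.
    - by move=> i j; rewrite !ord1.
    - by rewrite -lte_fin; apply: le_lt_trans (muId k); exact: lenI.
  have bnd' x y : (Z `&` I k) x -> (Z `&` I k) y -> `|F y - F x| < e / 4.
    move=> Sx Sy; have [xy|yx] := leP x y; first exact: bnd.
    by rewrite distrC; apply: bnd => //; exact: ltW.
  pose B := [set `|F p.2 - F p.1| | p in (Z `&` I k) `*` (Z `&` I k)].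
  have hB : has_sup B.
    split; first by exists `|F z0 - F z0|, (z0, z0).
    by exists (e / 4) => _ [[x y] [/= Sx Sy] <-]; apply: ltW; exact: bnd'.
  have leB x y : (Z `&` I k) x -> (Z `&` I k) y -> `|F y - F x| <= sup B.
    by move=> Sx Sy; apply: ub_le_sup; [exact: hB.2|exists (x, y)].
  have [s0|s0] := leP (sup B) 0.
    exists (z0, z0); split => //= z Sz; rewrite subrr normr0 mulr0.
    by apply: le_trans s0; exact: leB.
  have s20 : 0 < sup B / 2 by rewrite divr_gt0.
  have [_ [[x y] [/= Sx Sy] <-] xys] := sup_adherent s20 hB.
  have [xy|yx] := leP x y.
    exists (x, y); split => //= z Sz; have := leB x z Sx Sz; lra.
  exists (y, x); split => //= [|z Sz]; first exact: ltW.
  have := leB y z Sy Sz; rewrite (distrC (F x)); lra.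
have /choice[p pP] := pairs.
have cover : F @` Z `<=` \bigcup_k
    `[F (p k).1 - 2 * `|F (p k).2 - F (p k).1|, F (p k).1 + 2 * `|F (p k).2 - F (p k).1|]%classic.
  move=> _ [z Zz <-]; have := ZU z Zz; rewrite (open_disjoint_itv_bigcup oU) => -[k _ Ik].
  exists k => //=; have [_ _ /(_ z (conj Zz Ik))] := pP k.
  by rewrite in_itv /= ler_distl.
apply: le_trans (le_outer_measure out _ _ cover) _.
apply: le_trans (outer_measure_sigma_subadditive out _) _.
apply: lime_le; first by apply: is_cvg_nneseries => k _ _; exact: outer_measure_ge0.
apply: nearW => n.
apply: (@le_trans _ _ (\sum_(0 <= k < n) (4 * `|F (p k).2 - F (p k).1|)%:E)%E).
  apply: lee_sum => k _; rewrite [leLHS]lebesgue_itv /= lte_fin.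
  have := normr_ge0 (F (p k).2 - F (p k).1) => N0.
  by case: ifPn => _; [rewrite -EFinB lee_fin; lra|rewrite lee_fin; lra].
rewrite sumEFin lee_fin -mulr_sumr mulrC -ler_pdivlMr// big_mkord; apply: ltW.
apply: (dP n (fun k : 'I_n => (p k).1) (fun k : 'I_n => (p k).2)).
- by move=> k; case: (pP k).
- by move=> k; case: (pP k) => _ + _ => /[apply] -[[Z1 _] [Z2 _]]; split; exact: ZE.
- move=> i j ij pi pj.
  have [_ /(_ pi)[[_ Ii1] [_ Ii2]] _] := pP i; have [_ /(_ pj)[[_ Ij1] [_ Ij2]] _] := pP j.
  have disj x : I i x -> I j x -> False.
    move=> Iix Ijx; move/eqP: ij; apply; apply: ord_inj.
    exact: (@open_disjoint_itv_trivIset _ _ oU i j Logic.I Logic.I (ex_intro _ x (conj Iix Ijx))).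
  apply: contrapT => /not_orP[/negP]; rewrite -ltNge => ji /negP; rewrite -ltNge => ij'.
  have [h|h] := leP (p i).1 (p j).1.
    apply: (disj (p j).1) => //; apply: (open_disjoint_itv_is_interval Ii1 Ii2).
    by rewrite h ltW.
  apply: (disj (p i).1) => //; apply: (open_disjoint_itv_is_interval Ij1 Ij2).
  by rewrite ltW//= ltW.
- rewrite -lte_fin -sumEFin; apply: le_lt_trans sI.
  have := @nneseries_lim_ge R (fun k => mu (I k)) xpredT 0 n (fun _ _ _ => measure_ge0 mu _).
  apply: le_trans; rewrite big_mkord; apply: lee_sum => k _.
  have [p12 pS _] := pP k; have [p12'|p12'] := eqVneq (p k).1 (p k).2.
    by rewrite p12' subrr; exact: measure_ge0.
  have [|[_ I1] [_ I2]] := pS _; first by rewrite lt_neqAle p12'.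
  exact: lenI.
Qed.

End absolute_continuity.

(** * Monotonicity from one-sided difference quotients *)

Section monotonicity.
Context {R : realType}.
Local Notation mu := (@completed_lebesgue_measure R).
Local Notation T := (@lebesgue_type R).
Local Notation out := ((@wlength R idfun)^*)%mu.
Implicit Types (E Z D : set R) (F g : R -> R).

(** The ACG property without continuity, and with a cover in place of an exact decomposition, so
    that it passes to subsets of [D]. *)
Definition generalized_AC D F : Prop := exists E : nat -> set R,
  D `<=` \bigcup_n E n /\ forall n, absolutely_continuous_on (E n) F.

Lemma generalized_ACZ D F (k : R) : generalized_AC D F ->
  generalized_AC D (fun t => k * F t).
Proof.
move=> [E [DE acE]]; exists E; split => // n; exact: absolutely_continuous_onZ.
Qed.

Lemma generalized_ACD D F G : generalized_AC D F -> generalized_AC D G ->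
  generalized_AC D (fun t => F t + G t).
Proof.
move=> [E [DE acE]] [E' [DE' acE']].
(* The common refinement is indexed by codes of pairs of indices; numbers coding no pair get the
   empty set. *)
exists (fun k => if unpickle k is Some nm then E nm.1 `&` E' nm.2 else set0); split.
  move=> t Dt; have [n _ En] := DE t Dt; have [m _ Em] := DE' t Dt.
  by exists (pickle (n, m)) => //; rewrite pickleK.
move=> k; case: unpickle => [[n m]|].
  by apply: absolutely_continuous_onD; [exact: absolutely_continuous_onS (acE n)|
    exact: absolutely_continuous_onS (acE' m)].
by apply: absolutely_continuous_onD; [exact: absolutely_continuous_onS (acE 0)|
  exact: absolutely_continuous_onS (acE' 0)].
Qed.

Lemma AC_generalized_AC D F : absolutely_continuous_on D F -> generalized_AC D F.
Proof. by move=> acD; exists (fun=> D); split => // t Dt; exists 0%N. Qed.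

(** Lusin's condition (N), by countable subadditivity over the pieces. *)
Lemma generalized_AC_null D F Z : generalized_AC D F -> (out Z = 0)%E ->
  (out (F @` (Z `&` D)) = 0)%E.
Proof.
move=> [E [DE acE]] Z0; apply/eqP; rewrite eq_le outer_measure_ge0 andbT.
have cover : F @` (Z `&` D) `<=` \bigcup_n (F @` (Z `&` E n)).
  move=> _ [t [Zt Dt] <-]; have [n _ En] := DE t Dt.
  by exists n => //; exists t.
apply: le_trans (le_outer_measure out _ _ cover) _.
apply: le_trans (outer_measure_sigma_subadditive out _) _.
rewrite eseries0// => n _ _; apply: (absolutely_continuous_on_null (acE n)) => [t []//|].
apply/eqP; rewrite eq_le outer_measure_ge0 andbT -Z0.
by apply: le_outer_measure; exact: subIsetl.
Qed.

Lemma negligible_out Z : mu.-negligible Z -> (out Z = 0)%E.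
Proof.
move=> [N [mN N0 ZN]]; apply/eqP; rewrite eq_le outer_measure_ge0 andbT.
by rewrite -[leRHS]N0; exact: le_outer_measure.
Qed.

Definition continuous_between (a b : R) F : Prop :=
  forall t, a <= t <= b -> forall e : R, 0 < e -> exists2 d : R, 0 < d &
    forall u, a <= u <= b -> `|u - t| < d -> `|F u - F t| < e.

Lemma continuous_betweenD a b F G : continuous_between a b F ->
  continuous_between a b G -> continuous_between a b (fun t => F t + G t).
Proof.
move=> cF cG t tab e e0; have e20 : 0 < e / 2 by rewrite divr_gt0.
have [d1 d10 d1P] := cF t tab _ e20; have [d2 d20 d2P] := cG t tab _ e20.
exists (Num.min d1 d2); first by rewrite lt_min d10.
move=> u uab; rewrite lt_min => /andP[/(d1P u uab) h1 /(d2P u uab) h2].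
rewrite opprD addrACA; apply: le_lt_trans (ler_normD _ _) _.
by clear -h1 h2; lra.
Qed.

Lemma continuous_betweenN a b F : continuous_between a b F ->
  continuous_between a b (fun t => -1 * F t).
Proof.
move=> cF t tab e e0; have [d d0 dP] := cF t tab e e0; exists d => // u uab ut.
by rewrite !mulN1r -opprD normrN; exact: dP.
Qed.

Lemma within_continuous_between a b a' b' F : a <= a' -> b' <= b ->
  {within `[a, b], continuous F} -> continuous_between a' b' F.
Proof.
move=> aa' bb' /subspace_continuousP cF t /andP[at' tb'] e e0.
have Dt : `[a, b]%classic t.
  by rewrite /= in_itv /= (le_trans aa' at') (le_trans tb' bb').
have /cvgrPdist_lt/(_ e e0) := cF t Dt.
rewrite near_withinE => /nbhs_ballP[d /= d0 dP]; exists d => // u /andP[au ub] ut.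
rewrite distrC; apply: dP; first by rewrite -ball_normE /= distrC.
by rewrite /= in_itv /= (le_trans aa' au) (le_trans ub bb').
Qed.

(* Some value strictly between F x + e x and F y + e y is not taken on the
   exceptional null set; at the last point where it is taken, F + e id increases. *)
Lemma nondecreasing_of_lower_derivative a b F : continuous_between a b F ->
    generalized_AC `[a, b] F ->
    {ae mu, forall t, a <= t <= b -> t < b -> forall e d : R, 0 < e -> 0 < d ->
      exists2 u, t < u < t + d & - e * (u - t) <= F u - F t} ->
  forall x y, a <= x -> x <= y -> y <= b -> F x <= F y.
Proof.
move=> cF acF aeF x y ax xy yb; rewrite leNgt; apply/negP => Fyx.
have {xy} xy : x < y.
  by rewrite lt_neqAle xy andbT; apply: contraTneq Fyx => ->; rewrite ltxx.
(* This slope gives back half of the drop of [F], so that [H y < H x] still holds. *)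
pose e := (F x - F y) / (2 * (y - x)).
have yx0 : 0 < 2 * (y - x) by rewrite mulr_gt0// subr_gt0.
have e0 : 0 < e by rewrite divr_gt0// subr_gt0.
have eE : e * (y - x) = (F x - F y) / 2.
  by rewrite /e invfM mulrA mulfVK// gt_eqF// subr_gt0.
pose H t := F t + e * t.
have acH : generalized_AC `[a, b] H.
  apply: generalized_ACD => //; apply: AC_generalized_AC.
  exact/absolutely_continuous_onZ/absolutely_continuous_on_id.
have cH : continuous_between a b H.
  apply: continuous_betweenD => // t tab r r0; exists (r / e); first by rewrite divr_gt0.
  move=> u _ ut; rewrite -mulrBr normrM (gtr0_norm e0) mulrC.
  by rewrite -ltr_pdivlMr.
have Hyx : H y < H x by rewrite /H; have := eE; rewrite mulrBr; lra.
case: aeF => Z [mZ Z0 PZ].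
have outZ : (out Z = 0)%E by apply: negligible_out; exists Z; split.
have [v /andP[yv vx] nv] : exists2 v, H y < v < H x & ~ (H @` (Z `&` `[a, b])) v.
  apply: contrapT => /forall2NP h.
  have sub : `]H y, H x[%classic `<=` H @` (Z `&` `[a, b]).
    move=> v /=; rewrite in_itv /= => vyx; have [//|nn] := h v.
    by apply: contrapT.
  have : (out `]H y, H x[%classic <= 0)%E.
    by rewrite -(generalized_AC_null acH outZ); exact: le_outer_measure.
  rewrite [leLHS]lebesgue_itv /= lte_fin Hyx -EFinB lee_fin.
  by clear -Hyx; lra.
pose A := [set t | x <= t <= y /\ v <= H t].
have Ax : A x by split; [rewrite lexx ltW|exact: ltW].
have hA : has_sup A by split; [exists x|exists y => t [/andP[]]].
pose c := sup A.
have Ac t : A t -> t <= c by move=> At; apply: ub_le_sup => //; exact: hA.2.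
have xc : x <= c by exact: Ac.
have cy : c <= y by apply: ge_sup; [exists x|move=> t [/andP[]]].
have cab : a <= c <= b by rewrite (le_trans ax xc) (le_trans cy yb).
have vc : v <= H c.
  rewrite leNgt; apply/negP => Hc.
  have Hc0 : 0 < v - H c by rewrite subr_gt0.
  have [d d0 dP] := cH c cab _ Hc0.
  have [t [xty vt] ct] := sup_adherent d0 hA; rewrite -/c in ct.
  have tc := Ac t (conj xty vt).
  have : `|H t - H c| < v - H c.
    apply: dP; first by clear -xty ax yb; lra.
    by rewrite ler0_norm; clear -tc ct; lra.
  by rewrite ltr_norml => /andP[_]; clear -vt; lra.
have {cy} cy : c < y.
  rewrite lt_neqAle cy andbT; apply: contraTneq vc => ->; by rewrite -ltNge.
have HcE : H c = v.
  apply/eqP; rewrite eq_le vc andbT leNgt; apply/negP => vHc.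
  have Hc0 : 0 < H c - v by rewrite subr_gt0.
  have [d d0 dP] := cH c cab _ Hc0.
  pose t := Num.min y (c + d / 2).
  have ct : c < t by rewrite /t lt_min cy; clear -d0; lra.
  have ty : t <= y by rewrite /t ge_min lexx.
  have td : t <= c + d / 2 by rewrite /t ge_min lexx orbT.
  have : `|H t - H c| < H c - v.
    apply: dP; first by clear -ct ty xc ax yb; lra.
    by rewrite ger0_norm; clear -ct td d0; lra.
  rewrite ltr_norml => /andP[h _].
  have : A t by split; [clear -ct ty xc; lra|clear -h; lra].
  by move=> /Ac; clear -ct; lra.
have nZc : ~ Z c.
  by move=> Zc; apply: nv; exists c => //; split => //=; rewrite in_itv.
have : a <= c <= b -> c < b -> forall e d : R, 0 < e -> 0 < d ->
      exists2 u, c < u < c + d & - e * (u - c) <= F u - F c.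
  by apply: contrapT => h; apply/nZc/PZ.
have cb : c < b by exact: lt_le_trans yb.
have e20 : 0 < e / 2 by rewrite divr_gt0.
have cy0 : 0 < y - c by rewrite subr_gt0.
move=> /(_ cab cb _ _ e20 cy0)[u /andP[cu uy] Fu].
(* From [c] to [u], [F] loses at most [e / 2] per unit of length while the linear term gains [e], so
   [H u] is still at least [v]. *)
have : A u.
  split; first by clear -cu uy xc; lra.
  by rewrite -HcE /H; clear -Fu cu e0; nra.
by move=> /Ac; clear -cu; lra.
Qed.

End monotonicity.

(** * Density points and approximate derivatives *)

Section approximate_derivatives.
Context {R : realType}.
Local Notation mu := (@completed_lebesgue_measure R).
Local Notation T := (@lebesgue_type R).
Implicit Types (E : set R) (F H Q : R -> R).

(** The measures of the two traces add up to those of their union, at most [2 * h], and of their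
    intersection, which misses []p, q[]. *)
Lemma inclusion_exclusion_le E1 E2 (t p q h : R) :
    lebesgue_measurable E1 -> lebesgue_measurable E2 ->
    t - h <= p -> p < q -> q <= t + h ->
    (forall u, p < u < q -> E1 u -> E2 u -> False) ->
  (mu (E1 `&` `[(t - h)%R, (t + h)%R]) + mu (E2 `&` `[(t - h)%R, (t + h)%R]) <= (4 * h - (q - p))%:E)%E.
Proof.
move=> mE1 mE2 tp pq qt dis.
have mJ : lebesgue_measurable `[t - h, t + h] by exact: lebesgue_measurable_itv.
set A := (X in (mu X + _)%E); set B := (X in (_ + mu X)%E).
have mA : lebesgue_measurable A by exact: measurableI.
have mB : lebesgue_measurable B by exact: measurableI.
have mBA : lebesgue_measurable (B `\` A) by exact: measurableD.
have BE : (mu B = mu (B `\` A) + mu (B `&` A))%E by exact: (measureDI mu mB mA).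
have AB : (mu A + mu (B `\` A) = mu (A `|` (B `\` A)))%E.
  rewrite [RHS](measureU mu mA mBA)//.
  by rewrite -subset0 => x [Ax [_]]; exact.
rewrite BE addeA AB.
have h1 : (mu (A `|` (B `\` A)) <= (2 * h)%:E)%E.
  apply: (@le_trans _ _ (mu `[(t - h)%R, (t + h)%R])).
    by apply: le_outer_measure => x [[]|[[]]].
  rewrite [leLHS]lebesgue_itv /= lte_fin ifT; last by clear -tp pq qt; lra.
  by rewrite -EFinB lee_fin; lra.
have h2 : (mu (B `&` A) <= (p - (t - h))%:E + (t + h - q)%:E)%E.
  apply: (@le_trans _ _ (mu (`[(t - h)%R, p] `|` `[q, (t + h)%R]))).
    apply: le_outer_measure => x [[E2x Jx] [E1x _]] /=.
    move: Jx; rewrite /= !in_itv /= => /andP[x1 x2].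
    have [xp|px] := leP x p; first by left; rewrite x1.
    have [qx|xq] := leP q x; first by right.
    by exfalso; apply: (dis x) => //; rewrite px.
  apply: le_trans (measureU2 mu _ _) _; [exact: lebesgue_measurable_itv|exact: lebesgue_measurable_itv|].
  apply: leeD; rewrite [leLHS]lebesgue_itv /= lte_fin; case: ifPn => _;
    by rewrite -?EFinB lee_fin; clear -tp pq qt; lra.
apply: le_trans (leeD h1 h2) _; rewrite -!EFinD lee_fin.
by clear; lra.
Qed.

Lemma density_bound E (t k : R) : density_point E t -> 0 < k ->
  exists2 r : R, 0 < r & forall h : R, 0 < h < r ->
    ((2 * h * (1 - k))%:E < mu (E `&` `[(t - h)%R, (t + h)%R]))%E.
Proof.
move=> dE k0; have /cvgrPdist_lt/(_ k k0) := dE.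
rewrite near_withinE => /nbhs_ballP[r /= r0 rP]; exists r => // h /andP[h0 hr].
have := rP h; rewrite -ball_normE /= sub0r normrN gtr0_norm// => /(_ hr h0).
have h20 : 0 < 2 * h by rewrite mulr_gt0.
have mfin : mu (E `&` `[(t - h)%R, (t + h)%R]) \is a fin_num.
  rewrite ge0_fin_numE ?outer_measure_ge0//.
  apply: (@le_lt_trans _ _ (mu `[(t - h)%R, (t + h)%R])).
    by apply: le_outer_measure; exact: subIsetr.
  by rewrite lebesgue_itv /=; case: ifP => _; rewrite ?ltry// -EFinB ltry.
rewrite ltr_norml => /andP[_]; rewrite ltrBlDr -ltrBlDl ltr_pdivlMr// => H.
by rewrite -(fineK mfin) lte_fin mulrC.
Qed.

Lemma density_common E1 E2 t : lebesgue_measurable E1 -> lebesgue_measurable E2 ->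
    density_point E1 t -> density_point E2 t -> forall k : R, 0 < k ->
  exists2 r : R, 0 < r & forall x, 0 < x < r ->
    (exists2 u, t + x < u < t + (1 + k) * x & E1 u /\ E2 u) /\
    (exists2 u, t - (1 + k) * x < u < t - x & E1 u /\ E2 u).
Proof.
(* With [h = (1 + k) * x], the two traces have total measure above [4 * h * (1 - j)]; [j] is chosen
   so that [4 * h * j = k * x], the length of either gap in which a common point is sought. *)
move=> mE1 mE2 d1 d2 k k0; pose j := k / (4 * (1 + k)).
have k10 : 0 < 1 + k by rewrite addr_gt0.
have j0 : 0 < j by rewrite divr_gt0// mulr_gt0.
have jE : 4 * (1 + k) * j = k by rewrite /j mulrC divfK// gt_eqF// mulr_gt0.
have [r1 r10 r1P] := density_bound d1 j0; have [r2 r20 r2P] := density_bound d2 j0.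
exists (Num.min r1 r2 / (1 + k)); first by rewrite divr_gt0// lt_min r10.
move=> x /andP[x0]; rewrite ltr_pdivlMr// lt_min => /andP[xr1 xr2].
pose h := (1 + k) * x; have h0 : 0 < h by rewrite mulr_gt0.
have hr1 : 0 < h < r1 by rewrite h0 /h mulrC.
have hr2 : 0 < h < r2 by rewrite h0 /h mulrC.
have xh : x < h by rewrite /h ltr_pMl// ltrDl.
have key p q : t - h <= p -> p < q -> q <= t + h -> q - p = k * x ->
    exists2 u, p < u < q & E1 u /\ E2 u.
  move=> tp pq qt qpE; apply: contrapT => /forall2NP no.
  have := @inclusion_exclusion_le E1 E2 t p q h mE1 mE2 tp pq qt.
  have nodis u : p < u < q -> E1 u -> E2 u -> False.
    by move=> puq u1 u2; have [|] := no u; [exact|apply].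
  move=> /(_ nodis); rewrite leNgt => /negP; apply.
  apply: le_lt_trans (lteD (r1P h hr1) (r2P h hr2)); rewrite -EFinD lee_fin qpE.
  have -> : k * x = 4 * h * j by rewrite -[in LHS]jE /h; ring.
  by clear; lra.
split.
  have [||||u uP Eu] := key (t + x) (t + h); last by exists u.
  - by clear -x0 h0; lra.
  - by clear -xh; lra.
  - by [].
  - by rewrite /h; ring.
have [||||u uP Eu] := key (t - h) (t - x); last by exists u.
- by [].
- by clear -xh; lra.
- by clear -x0 h0; lra.
- by rewrite /h; ring.
Qed.

(** In place of a density set: at every small scale and on either side, within a factor [1 + k] of
    any prescribed distance, there is a point with a good difference quotient. *)
Definition lower_approximate_derivative Q (t q : R) : Prop :=
  forall k : R, 0 < k -> exists2 r : R, 0 < r & forall x, 0 < x < r ->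
    (exists2 u, t + x < u < t + (1 + k) * x & (q - k) * (u - t) <= Q u - Q t) /\
    (exists2 u, t - (1 + k) * x < u < t - x & (q - k) * (t - u) <= Q t - Q u).

Definition lower_derivative H (t q : R) : Prop :=
  forall k : R, 0 < k -> exists2 r : R, 0 < r & forall u, `|u - t| < r ->
    (t < u -> (q - k) * (u - t) <= H u - H t) /\
    (u < t -> (q - k) * (t - u) <= H t - H u).

Lemma approximate_derivative_near F t l (k : R) : approximate_derivative01 F t l -> 0 < k ->
  exists E, [/\ lebesgue_measurable E, density_point E t & exists2 r : R, 0 < r &
    forall u, E u -> u != t -> `|u - t| < r -> `|F u - F t - l * (u - t)| <= k * `|u - t|].
Proof.
move=> [E [mE _ dE cE]] k0; exists E; split => //.
have /cvgrPdist_lt/(_ k k0) := cE.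
rewrite !near_withinE => /nbhs_ballP[r /= r0 rP]; exists r => // u Eu ut utr.
have := rP u; rewrite -ball_normE /= distrC => /(_ utr ut Eu).
have ut0 : u - t != 0 by rewrite subr_eq0.
move=> /ltW; rewrite -(ler_pM2r (_ : 0 < `|u - t|)) ?normr_gt0// -normrM.
by rewrite mulrBl divfK// distrC.
Qed.

(** Used with [s = 1] and [H = 0] for a sum of primitives, and with [s = -1] for an indefinite
    integral minus this sum. The density sets of [F1] and [F2] meet at every small scale by
    [density_common]. *)
Lemma lower_approximate_derivativeD F1 F2 t l1 l2 :
    approximate_derivative01 F1 t l1 -> approximate_derivative01 F2 t l2 ->
  forall (s : R) H q, lower_derivative H t q ->
  lower_approximate_derivative (fun u => H u + s * (F1 u + F2 u)) t (q + s * (l1 + l2)).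
Proof.
move=> D1 D2 s H q Hq k k0; have s0 : 0 < `|s| + 1 by rewrite ltr_pwDr.
(* After multiplication by [s], the errors of [F1] and [F2] are at most [k / 3] each; the third
   [k / 3] is for [H]. *)
pose k' := k / (3 * (`|s| + 1)).
have k'0 : 0 < k' by rewrite divr_gt0// mulr_gt0.
have k'E : k' * (`|s| + 1) = k / 3 by rewrite /k' invfM mulrA mulfVK// gt_eqF.
have k30 : 0 < k / 3 by rewrite divr_gt0.
have [E1 [m1 d1 [r1 r10 r1P]]] := approximate_derivative_near D1 k'0.
have [E2 [m2 d2 [r2 r20 r2P]]] := approximate_derivative_near D2 k'0.
have [r3 r30 r3P] := density_common m1 m2 d1 d2 k0.
have [r4 r40 r4P] := Hq _ k30.
pose m := Num.min (Num.min r1 r2) r4.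
have m0 : 0 < m by rewrite !lt_min r10 r20.
have k10 : 0 < 1 + k by rewrite addr_gt0.
exists (Num.min r3 (m / (1 + k))); first by rewrite lt_min r30 divr_gt0.
have est u : E1 u -> E2 u -> u != t -> `|u - t| < m ->
    `|s * (F1 u + F2 u) - s * (F1 t + F2 t) - s * (l1 + l2) * (u - t)| <= 2 * (k / 3) * `|u - t|.
  move=> u1 u2 ut; rewrite !lt_min => /andP[/andP[h1 h2] _].
  have e1 := r1P u u1 ut h1; have e2 := r2P u u2 ut h2.
  rewrite (_ : _ - _ - _ = s * ((F1 u - F1 t - l1 * (u - t)) + (F2 u - F2 t - l2 * (u - t)))); last by ring.
  rewrite normrM; apply: (@le_trans _ _ (`|s| * (2 * k' * `|u - t|))).
    apply: ler_wpM2l => //; apply: le_trans (ler_normD _ _) _.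
    by clear -e1 e2; lra.
  have : 0 <= k' * `|u - t| by rewrite mulr_ge0// ltW.
  by rewrite -k'E; clear; lra.
move=> x /andP[x0]; rewrite lt_min ltr_pdivlMr// => /andP[xr3 xm].
have xr : 0 < x < r3 by rewrite x0.
have [[u /andP[xu ux] [u1 u2]] [v /andP[xv vx] [v1 v2]]] := r3P x xr.
split.
  exists u; first by rewrite xu.
  have tu : t < u by clear -xu x0; lra.
  have um : `|u - t| < m by rewrite gtr0_norm ?subr_gt0//; clear -ux xm; lra.
  have ut : u != t by rewrite gt_eqF.
  have utE : `|u - t| = u - t by rewrite gtr0_norm ?subr_gt0.
  have := est u u1 u2 ut um; rewrite utE ler_norml => /andP[h1 _].
  have um4 : `|u - t| < r4 by move: um; rewrite !lt_min => /andP[].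
  have [/(_ tu) h2 _] := r4P u um4.
  by clear -h1 h2; lra.
exists v; first by rewrite xv.
have vt : v < t by clear -vx x0; lra.
have vm : `|v - t| < m by rewrite ltr0_norm ?subr_lt0//; clear -xv xm; lra.
have vt' : v != t by rewrite lt_eqF.
have vtE : `|v - t| = t - v by rewrite ltr0_norm ?subr_lt0// opprB.
have := est v v1 v2 vt' vm; rewrite vtE ler_norml => /andP[_ h1].
have vm4 : `|v - t| < r4 by move: vm; rewrite !lt_min => /andP[].
have [_ /(_ vt) h2] := r4P v vm4.
by clear -h1 h2; lra.
Qed.

End approximate_derivatives.

(** * Upper integrals from lower approximate derivatives *)

Section denjoy_khintchine_dominated.
Context {R : realType}.
Local Notation mu := (@completed_lebesgue_measure R).
Local Notation T := (@lebesgue_type R).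
Implicit Types (F H Q : R -> R).

(** The step functions take the slopes of the nondecreasing [Q] as values, so their integrals
    telescope to [Q b - Q a]. For almost every [t], points near both ends of its cell have good
    difference quotients, and monotonicity carries these to the ends. *)
Lemma lower_approximate_majorized (a b : R) Q (g : R -> R) : a < b ->
    continuous_between a b Q -> generalized_AC `[a, b] Q ->
    {ae mu, forall t, a <= t <= b -> 0 <= g t /\ lower_approximate_derivative Q t (g t)} ->
  majorized `[a, b] g (Q b - Q a).
Proof.
move=> ab cQ acQ aeQ; have ab' := ltW ab.
have ndQ : forall x y, a <= x -> x <= y -> y <= b -> Q x <= Q y.
  apply: nondecreasing_of_lower_derivative => //.
  apply: (aeS _ aeQ) => t H tab tb e d e0 d0; have [g0 Qt] := H tab.
  have [r r0 rP] := Qt e e0.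
  have e10 : 0 < 1 + e by rewrite addr_gt0.
  pose x := Num.min r (d / (1 + e)) / 2.
  have m0 : 0 < Num.min r (d / (1 + e)) by rewrite lt_min r0 divr_gt0.
  have x0 : 0 < x by rewrite divr_gt0.
  have : x < Num.min r (d / (1 + e)) by rewrite /x ltr_pdivrMr// ltr_pMr// ltr1n.
  rewrite lt_min ltr_pdivlMr// => /andP[xr xd].
  have [|[u /andP[tu ut] Qu] _] := rP x; first by rewrite x0.
  exists u; first by apply/andP; split; clear -tu ut x0 xd; lra.
  by apply: le_trans Qu; clear -g0 tu x0; nra.
pose d (n : nat) := (b - a) / n.+1%:R.
have d_0 n : 0 < d n by rewrite divr_gt0// subr_gt0.
pose c n i := if (i < n.+1)%N then (Q (grid a b n i.+1) - Q (grid a b n i)) / d n else 0.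
apply: (@step_majorized _ a b _ c) => //.
- move=> n i; rewrite /c; case: ifPn => // ni.
  apply: divr_ge0; last exact: ltW.
  have /andP[ai _] := grid_in ab' (ltnW ni); have /andP[_ bi] := grid_in ab' ni.
  by rewrite subr_ge0; apply: ndQ => //; exact: grid_mono.
- move=> n; rewrite -/(d n).
  rewrite (eq_bigr (fun i : 'I_n.+1 => Q (grid a b n i.+1) - Q (grid a b n i))); last first.
    by move=> i _; rewrite /c ltn_ord divfK// gt_eqF.
  rewrite -(big_mkord xpredT (fun i => Q (grid a b n i.+1) - Q (grid a b n i))).
  by rewrite telescope_sumr// grid0 grid_last.
- apply: (aeS _ aeQ) => t H /andP[at_ tb] e e0.
  have [g0 Qt] := H (introT andP (conj at_ (ltW tb))).
  have g10 : 0 < 1 + g t by rewrite ltr_pwDl.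
  (* Reaching only the fraction [1 / (1 + k)] of a distance is affordable:
     [(g t - k) / (1 + k) >= g t - e] if [g t > k], and otherwise [g t - e <= 0]. *)
  pose k := e / (1 + g t); have k0 : 0 < k by rewrite divr_gt0.
  have kE : k * (1 + g t) = e by rewrite /k divfK// gt_eqF.
  have k10 : 0 < 1 + k by rewrite addr_gt0.
  have [r r0 rP] := Qt k k0; have [N NP] := grid_mesh a b r0.
  exists N => n i Nn ni /andP[it ti]; have dr := NP n Nn; rewrite -/(d n) in dr.
  have /andP[ai ib] := grid_in ab' (ltnW ni); have /andP[ai' ib'] := grid_in ab' ni.
  have dE := gridS a b n i; rewrite -/(d n) in dE.
  set p := grid a b n i in it ai ib dE *; set q := grid a b n i.+1 in ti ai' ib' dE *.
  have slope z w D : 0 <= z -> z / (1 + k) <= w -> (g t - k) * w <= D -> 0 <= D ->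
      (g t - e) * z <= D.
    move=> z0 zw Dw D0; have [gk|gk] := leP (g t) k.
      have : k <= e by rewrite -kE ler_pMr// lerDl.
      by clear -gk z0 D0; nra.
    apply: le_trans Dw; apply: (@le_trans _ _ ((g t - k) * (z / (1 + k)))); last first.
      by rewrite ler_pM2l// subr_gt0.
    rewrite mulrA ler_pdivlMr// mulrAC ler_wpM2r//.
    by clear -kE k0 e0; nra.
  have right : (g t - e) * (q - t) <= Q q - Q t.
    have x0 : 0 < (q - t) / (1 + k) by rewrite divr_gt0// subr_gt0.
    have [|[u /andP[tu ut] Qu] _] := rP ((q - t) / (1 + k)).
      by rewrite x0 ltr_pdivrMr//; clear -dE it ti dr k0 r0; nra.
    rewrite mulrC divfK ?gt_eqF// in ut.
    have uq : u <= q by clear -ut; lra.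
    apply: (slope (q - t) (u - t)).
    - by rewrite subr_ge0 ltW.
    - by clear -tu; lra.
    - by apply: le_trans Qu _; rewrite lerB// ndQ//; clear -tu at_ x0; lra.
    - by rewrite subr_ge0 ndQ// ltW.
  have left : (g t - e) * (t - p) <= Q t - Q p.
    have [->|tp] := eqVneq t p; first by rewrite !subrr mulr0.
    have pt : p < t by rewrite lt_neqAle eq_sym tp.
    have x0 : 0 < (t - p) / (1 + k) by rewrite divr_gt0// subr_gt0.
    have [|_ [u /andP[tu ut] Qu]] := rP ((t - p) / (1 + k)).
      by rewrite x0 ltr_pdivrMr//; clear -dE it ti dr k0 r0; nra.
    rewrite mulrC divfK ?gt_eqF// in tu.
    have pu : p <= u by clear -tu; lra.
    apply: (slope (t - p) (t - u)).
    - by rewrite subr_ge0 ltW.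
    - by clear -ut; lra.
    - by apply: le_trans Qu _; rewrite lerB// ndQ//; clear -ut tb x0; lra.
    - by rewrite subr_ge0 ndQ// ltW.
  rewrite /c ni -/p -/q -lerBlDr ler_pdivlMr// -dE.
  by clear -left right; lra.
Qed.

End denjoy_khintchine_dominated.

(** * Indefinite integrals of lower semicontinuous functions *)

Section absolute_continuity_integral.
Context {R : realType}.
Local Notation mu := (@completed_lebesgue_measure R).
Local Notation T := (@lebesgue_type R).

Lemma ge0_integral_small (D : set R) (h : R -> \bar R) : lebesgue_measurable D ->
    measurable_fun (D : set T) h -> (forall t, D t -> (0 <= h t)%E) ->
    (\int[mu]_(t in D) h t < +oo)%E ->
  forall e : R, 0 < e -> exists2 d : R, 0 < d & forall A, lebesgue_measurable A ->
    A `<=` D -> (mu A < d%:E)%E -> (\int[mu]_(t in A) h t < e%:E)%E.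
Proof.
move=> mD mh h0 ih.
pose f := fun t => fine ((h \_ D) t).
have hD0 t : (0 <= (h \_ D) t)%E by rewrite patchE; case: ifP => // /set_mem/h0.
have intD : mu.-integrable D h.
  apply/integrableP; split => //.
  by under eq_integral => t /set_mem Dt do rewrite gee0_abs ?h0//.
have ihD : mu.-integrable setT (h \_ D) by apply/(integrable_mkcond _ mD).
have mhD := measurable_int mu ihD.
have mf : measurable_fun (setT : set T) f.
  by apply: measurableT_comp mhD; exact: fine_measurable.
have intf : mu.-integrable setT (EFin \o f).
  apply: (le_integrable _ _ _ ihD); [exact: measurableT|exact/measurable_EFinP|].
  move=> t _; rewrite /f /= [leRHS]gee0_abs//.
  by case: (_ t) (hD0 t) => [r||]//= r0; rewrite ?normr0 ?leey// lee_fin ger0_norm.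
have fh : {ae mu, forall t, D t -> h t = (f t)%:E}.
  apply: (aeS _ (integrable_ae mD intD)) => t ht Dt.
  by rewrite /f patchE mem_set// fineK// ht.
move=> e e0; have [d [d0 dP]] := integral_normr_continuous intf e0.
exists d => // A mA AD muA.
have E : (\int[mu]_(t in A) `|f t|%:E = \int[mu]_(t in A) h t)%E.
  apply: ae_eq_integral; [exact: mA| |exact: measurable_funS mh|].
    apply/measurable_EFinP; apply: measurableT_comp; first exact: normr_measurable.
    exact: measurable_funTS.
  apply: (aeS _ fh) => t ft At; have := h0 t (AD t At); rewrite ft; last exact: AD.
  by rewrite lee_fin => f0; rewrite ger0_norm.
have fin : (\int[mu]_(t in A) h t)%E \is a fin_num.
  rewrite ge0_fin_numE; last by apply: integral_ge0 => t At; exact/h0/AD.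
  by apply: le_lt_trans ih; exact: (ge0_subset_integral mu mA mD mh h0 AD).
by rewrite -(fineK fin) lte_fin -E; exact: dP.
Qed.

End absolute_continuity_integral.

Section indefinite_integral.
Context {R : realType}.
Local Notation mu := (@completed_lebesgue_measure R).
Local Notation T := (@lebesgue_type R).
Context (a b : R) (hl : R -> \bar R).
Hypotheses (lsc : lower_semicontinuous hl) (hl0 : forall t, (0 <= hl t)%E)
  (ihl : (\int[mu]_(t in `[a, b]) hl t < +oo)%E).

Let mI (x y : R) : lebesgue_measurable `[x, y[.
Proof. exact: lebesgue_measurable_itv. Qed.

Let mD : lebesgue_measurable `[a, b].
Proof. exact: lebesgue_measurable_itv. Qed.

Let mhl (D : set R) : measurable_fun (D : set T) hl.
Proof. by apply: borel_lebesgue_fun; exact: lower_semicontinuous_measurable. Qed.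

Definition indefinite (t : R) : R := fine (\int[mu]_(u in `[a, t[) hl u)%E.
Local Notation H := indefinite.

Let sub_itv (x y : R) : a <= x -> y <= b -> `[x, y[%classic `<=` `[a, b]%classic.
Proof.
move=> ax yb t /=; rewrite !in_itv /= => /andP[xt ty].
by rewrite (le_trans ax xt) (le_trans (ltW ty) yb).
Qed.

Let fin_itv (x y : R) : a <= x -> y <= b -> (\int[mu]_(u in `[x, y[) hl u)%E \is a fin_num.
Proof.
move=> ax yb; rewrite ge0_fin_numE; last exact: integral_ge0.
apply: le_lt_trans ihl.
apply: (ge0_subset_integral mu (mI x y) mD (@mhl _) (fun t _ => hl0 t)).
exact: sub_itv.
Qed.

Lemma indefiniteB x y : a <= x -> x <= y -> y <= b ->
  (\int[mu]_(u in `[x, y[) hl u = (H y - H x)%:E)%E.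
Proof.
move=> ax xy yb.
have dj : [disjoint `[a, x[%classic & `[x, y[%classic].
  apply/eqP; rewrite -subset0 => t [/=]; rewrite !in_itv /= => /andP[_ tx] /andP[xt _].
  by have := lt_le_trans tx xt; rewrite ltxx.
have E : (\int[mu]_(u in `[a, y[) hl u =
    \int[mu]_(u in `[a, x[) hl u + \int[mu]_(u in `[x, y[) hl u)%E.
  rewrite -(ge0_integral_setU mu (mI a x) (mI x y) (@mhl _) (fun t _ => hl0 t) dj).
  by rewrite -itv_bndbnd_setU// bnd_simp.
have fx := fin_itv (lexx a) (le_trans xy yb); have fxy := fin_itv ax yb.
by rewrite /H E fineD// addrC addKr fineK.
Qed.

Lemma indefinite_ge x y q : a <= x -> x <= y -> y <= b ->
  (forall t, x <= t < y -> (q%:E <= hl t)%E) -> q * (y - x) <= H y - H x.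
Proof.
move=> ax xy yb qh; rewrite -lee_fin -indefiniteB//.
exact: (integral_itv_ge xy (@mhl _) hl0).
Qed.

(** Lower semicontinuity keeps [hl] above [q - k] near [t], which bounds the increments on both
    sides; no exceptional null set arises. *)
Lemma indefinite_lower_derivative t q : a < t < b -> (q%:E <= hl t)%E ->
  lower_derivative H t q.
Proof.
move=> /andP[at_ tb] qh k k0.
have : ((q - k)%:E < hl t)%E by apply: lt_le_trans qh; rewrite lte_fin ltrBlDr ltrDl.
move=> /lsc[V /nbhs_ballP[r /= r0 rV] Vh].
exists (Num.min r (Num.min (t - a) (b - t))); first by rewrite !lt_min r0 !subr_gt0 at_.
move=> u; rewrite !lt_min => /andP[ur /andP[uta ubt]].
have near_t v : `|v - t| <= `|u - t| -> ((q - k)%:E <= hl v)%E.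
  move=> vu; apply/ltW/Vh/rV; rewrite -ball_normE /= distrC.
  exact: le_lt_trans ur.
split=> [tu|ut].
  apply: indefinite_ge; [exact: ltW|exact: ltW| |].
    by move: ubt; rewrite gtr0_norm ?subr_gt0// ltrD2r => /ltW.
  move=> v /andP[tv vu]; apply: near_t.
  by rewrite !ger0_norm ?subr_ge0// ?lerD2r// ltW.
apply: indefinite_ge; [|exact: ltW|exact: ltW|].
  by move: uta; rewrite ltr0_norm ?subr_lt0// opprB ltrD2l ltrN2 => /ltW.
move=> v /andP[uv vt]; apply: near_t.
rewrite ltr0_norm ?subr_lt0// ltr0_norm ?subr_lt0// lerN2 lerD2r//.
Qed.

Lemma indefinite_absolutely_continuous : absolutely_continuous_on `[a, b] H.
Proof.
move=> e e0.
have [d d0 dP] := ge0_integral_small mD (@mhl _) (fun t _ => hl0 t) ihl e0.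
exists d => // n x y xyE dis sd.
have xin i : a <= x i by have [] := xyE i; rewrite /= !in_itv => /andP[].
have yin i : y i <= b by have [_] := xyE i; rewrite /= !in_itv => /andP[].
have xy i : x i < y i by have [] := xyE i.
pose I (i : 'I_n) : set R := `[x i, y i[%classic.
have tI : trivIset [set` index_enum 'I_n] I.
  move=> i j _ _ [t []]; rewrite /I /= !in_itv /= => /andP[it ti] /andP[jt tj].
  apply/eqP/negPn/negP => ij; have [h|h] := dis i j ij.
    by have := lt_le_trans ti (le_trans h jt); rewrite ltxx.
  by have := lt_le_trans tj (le_trans h it); rewrite ltxx.
pose A : set R := \big[setU/set0]_(i <- index_enum 'I_n) I i.
have mA : lebesgue_measurable A by apply: (@bigsetU_measurable _ T) => i _; exact: mI.
have AD : A `<=` `[a, b].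
  by rewrite /A -bigcup_seq => t [i _]; apply: sub_itv.
have mI' i : lebesgue_measurable (I i) by exact: mI.
have muA : (mu A < d%:E)%E.
  rewrite -[mu A]mul1e -(integral_cst mu mA).
  rewrite (ge0_integral_bigsetU mu mI' (index_enum_uniq _) tI)//.
  apply: le_lt_trans (_ : ((\sum_(i < n) (y i - x i))%:E < _)%E); last by rewrite lte_fin.
  rewrite -sumEFin; apply: lee_sum => i _.
  rewrite integral_cst ?mul1e//; last exact: mI.
  by rewrite [leLHS]lebesgue_itv /= lte_fin xy -EFinB.
rewrite -lte_fin; apply: le_lt_trans (dP A mA AD muA).
rewrite (ge0_integral_bigsetU mu mI' (index_enum_uniq _) tI)//.
rewrite -sumEFin; apply: lee_sum => i _.
have xyi := ltW (xy i); have xa := xin i; have yb := yin i.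
rewrite (indefiniteB xa xyi yb) ger0_norm// -(mul0r (y i - x i)).
by apply: indefinite_ge.
Qed.

End indefinite_integral.

(** * Dominated Denjoy-Khintchine integrals *)

Section denjoy_khintchine_integral.
Context {R : realType}.
Local Notation mu := (@completed_lebesgue_measure R).
Local Notation T := (@lebesgue_type R).
Implicit Types (F : R -> R).

Lemma AC_continuous_between (a b : R) F :
  absolutely_continuous_on `[a, b] F -> continuous_between a b F.
Proof.
move=> acF t tab e e0; have [d d0 dP] := absolutely_continuous_onP acF e0.
exists d => // u uab ut.
wlog tu : t u tab uab ut / t <= u.
  move=> W; have [|/ltW ut'] := leP t u; first exact: W.
  by rewrite distrC; apply: W => //; rewrite distrC.
have := dP 1%N (fun=> t) (fun=> u); rewrite !big_ord1; apply => //.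
- by move=> i j; rewrite !ord1.
- by rewrite -[u - t]ger0_norm// subr_ge0.
Qed.

Lemma ACG01_generalized (a b : R) F : 0 <= a -> b <= 1 -> ACG01 F ->
  continuous_between a b F /\ generalized_AC `[a, b] F.
Proof.
move=> a0 b1 [cF [E [UE acE]]]; split; first exact: within_continuous_between cF.
exists E; split => // t /=; rewrite in_itv /= => /andP[at_ tb].
rewrite -UE /unit_interval /= in_itv /=.
by rewrite (le_trans a0 at_) (le_trans tb b1).
Qed.

(* With a lower semicontinuous majorant hl of h, both F = F1 + F2 and the
   indefinite integral of hl minus F have a nonnegative lower approximate
   derivative, hence are nondecreasing, and the integrals of g and hl - g are
   squeezed between their increments. *)
Lemma DK_dominated (a b : R) (g1 g2 g h : R -> \bar R) v1 v2 : 0 <= a -> a < b -> b <= 1 ->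
    DK_integral a b g1 v1 -> DK_integral a b g2 v2 ->
    mu.-integrable `[a, b] h ->
    {ae mu, forall t : R, a <= t <= b -> (g1 t + g2 t = g t)%E} ->
    {ae mu, forall t : R, a <= t <= b -> (0 <= g t <= h t)%E} ->
  measurable_fun (`[a, b] : set T) g /\ (\int[mu]_(t in `[a, b]) g t = (v1 + v2)%:E)%E.
Proof.
move=> a0 ab b1 [F1 [acF1 D1] ->] [F2 [acF2 D2] ->] inth gsum gh.
have mD : lebesgue_measurable `[a, b] by exact: lebesgue_measurable_itv.
have mI : lebesgue_measurable `[a, b[ by exact: lebesgue_measurable_itv.
have inD t : `[a, b]%classic t -> a <= t <= b by rewrite /= in_itv.
have Din t : a <= t <= b -> `[a, b]%classic t by rewrite /= in_itv.
have D01 t : a <= t <= b -> unit_interval t.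
  move=> /andP[at_ tb]; rewrite /unit_interval /= in_itv /=.
  by rewrite (le_trans a0 at_) (le_trans tb b1).
have Dfin : (mu `[a, b] < +oo)%E.
  by rewrite lebesgue_itv /=; case: ifP => _; rewrite ?ltry// -EFinB ltry.
(* [h] is nonnegative only almost everywhere, while [lsc_majorant] asks for it at every point, hence
   the absolute value. *)
have intah := integrable_abse inth.
have iah := integrable_lty mD intah.
have ah0 t : `[a, b]%classic t -> (0 <= (abse \o h) t)%E by move=> _; exact: abse_ge0.
have [hl [lsc hl0 hhl ihl]] := lsc_majorant mD Dfin (measurable_int mu intah) ah0 ltr01.
have {}ihl : (\int[mu]_(t in `[a, b]) hl t < +oo)%E.
  by apply: le_lt_trans ihl _; rewrite lte_add_pinfty// ltry.
have mhl (D : set R) : measurable_fun (D : set T) hl.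
  by apply: borel_lebesgue_fun; exact: lower_semicontinuous_measurable.
have inthl : mu.-integrable `[a, b] hl.
  apply/integrableP; split; first exact: mhl.
  by under eq_integral do rewrite gee0_abs//.
pose H := indefinite a hl.
have acH := indefinite_absolutely_continuous lsc hl0 ihl.
have [cF1 gF1] := ACG01_generalized a0 b1 acF1.
have [cF2 gF2] := ACG01_generalized a0 b1 acF2.
have cF := continuous_betweenD cF1 cF2; have gF := generalized_ACD gF1 gF2.
(* Both are written in the shape [H u + s * (F1 u + F2 u)] of [lower_approximate_derivativeD]. *)
pose Q1 t := 0 + 1 * (F1 t + F2 t); pose Q2 t := H t + -1 * (F1 t + F2 t).
have ac0 : absolutely_continuous_on `[a, b] (fun=> 0).
  by move=> e e0; exists 1 => // n x y _ _ _; rewrite big1// => i _; rewrite subrr normr0.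
have cQ1 : continuous_between a b Q1.
  rewrite (_ : Q1 = fun t => F1 t + F2 t)//.
  by apply/funext => t; rewrite /Q1 add0r mul1r.
have cQ2 : continuous_between a b Q2.
  by apply: continuous_betweenD; [exact: AC_continuous_between|exact: continuous_betweenN].
have gQ1 : generalized_AC `[a, b] Q1.
  by apply: generalized_ACD; [exact: AC_generalized_AC|exact: generalized_ACZ].
have gQ2 : generalized_AC `[a, b] Q2.
  by apply: generalized_ACD; [exact: AC_generalized_AC|exact: generalized_ACZ].
pose gg t := fine (g t); pose hr t := fine (hl t).
have DE := aeS2 (fun t => @conj _ _) D1 D2.
have GE := aeS2 (fun t => @conj _ _) gsum gh.
(* The end points are removed because the lower derivative of [H] is known only at interior
   points. *)
have HE := aeS3 (fun t x y z => conj x (conj y z)) (integrable_ae mD inthl) (ae_neq a) (ae_neq b).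
have main : {ae mu, forall t, a <= t <= b -> [/\ g t = (gg t)%:E, hl t = (hr t)%:E,
    0 <= gg t <= hr t, lower_approximate_derivative Q1 t (gg t) &
    lower_approximate_derivative Q2 t (hr t - gg t)]}.
  apply: (aeS3 _ DE GE HE) => t [d1 d2] [gs ghe] [hf [ta tb]] tab.
  have [l1 l1E A1] := d1 (D01 t tab); have [l2 l2E A2] := d2 (D01 t tab).
  have gE : g t = (l1 + l2)%:E by rewrite -gs// l1E l2E.
  have ggE : gg t = l1 + l2 by rewrite /gg gE.
  have hlE : hl t = (hr t)%:E by rewrite /hr fineK// hf//; exact: Din.
  have /andP[g0 gh'] := ghe tab.
  have ghr : 0 <= gg t <= hr t.
    rewrite ggE -!lee_fin -gE -hlE g0 /= (le_trans gh')//.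
    by apply: le_trans (hhl t (Din t tab)); exact: lee_abs.
  have tin : a < t < b.
    by move: tab; rewrite !le_eqVlt eq_sym (negbTE ta) (negbTE tb).
  split => //; first by rewrite gE ggE.
    rewrite ggE -[l1 + l2]mul1r -[1 * _]add0r.
    apply: lower_approximate_derivativeD => // k k0; exists 1 => // u _.
    by rewrite subrr add0r; split=> ?; rewrite mulNr oppr_le0 mulr_ge0 ?subr_ge0 ?ltW.
  rewrite ggE -mulN1r; apply: lower_approximate_derivativeD => //.
  by apply: (indefinite_lower_derivative lsc hl0 ihl tin); rewrite hlE.
have M1 : majorized `[a, b] gg (Q1 b - Q1 a).
  apply: lower_approximate_majorized => //; apply: (aeS _ main) => t M tab.
  by have [_ _ /andP[? _] ? _] := M tab.
have M2 : majorized `[a, b] (fun t => hr t - gg t) (Q2 b - Q2 a).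
  apply: lower_approximate_majorized => //; apply: (aeS _ main) => t M tab.
  by have [_ _ /andP[_ ?] _ ?] := M tab; rewrite subr_ge0.
have cmp := @completed_lebesgue_measure_is_complete R.
have hrE : {ae mu, forall t, `[a, b]%classic t -> hl t = (hr t)%:E}.
  by apply: (aeS _ main) => t M Dt; have [] := M (inD t Dt).
have ggE : {ae mu, forall t, `[a, b]%classic t -> (gg t)%:E = g t}.
  by apply: (aeS _ main) => t M Dt; have [] := M (inD t Dt).
have mhr : measurable_fun (`[a, b] : set T) (EFin \o hr).
  by apply: (ae_measurable_fun cmp hrE); exact: mhl.
have hr0 t : `[a, b]%classic t -> 0 <= hr t by move=> _; exact: fine_ge0.
have Hw : ((H b - H a)%:E <= \int[mu]_(t in `[a, b]) (hr t)%:E)%E.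
  have -> : (\int[mu]_(t in `[a, b]) (hr t)%:E = \int[mu]_(t in `[a, b]) hl t)%E.
    apply: ae_eq_integral; [exact: mD|exact: mhr|exact: mhl|].
    by apply: (aeS _ hrE) => t E Dt; rewrite E.
  rewrite -(indefiniteB lsc hl0 ihl (lexx a) (ltW ab) (lexx b)).
  apply: (ge0_subset_integral mu mI mD (mhl _) (fun t _ => hl0 t)).
  by move=> t /=; rewrite !in_itv /= => /andP[-> /ltW ->].
have vE : Q1 b - Q1 a = F1 b - F1 a + (F2 b - F2 a) by rewrite /Q1; ring.
have wE : Q2 b - Q2 a = (H b - H a) - (F1 b - F1 a + (F2 b - F2 a)) by rewrite /Q2; ring.
rewrite vE in M1; rewrite wE in M2.
have [mgg igg] := squeeze_integral mD mhr hr0 Hw M1 M2.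
have mg : measurable_fun (`[a, b] : set T) g by exact: (ae_measurable_fun cmp ggE).
split => //; rewrite -igg; apply: ae_eq_integral; [exact: mD|exact: mg|exact: mgg|].
by apply: (aeS _ ggE) => t E Dt; rewrite E.
Qed.

End denjoy_khintchine_integral.

(** * From integrals over intervals to integrals over measurable sets *)

Section measurable_sets_from_intervals.
Context {R : realType} {X : completeNormedModType R}.
Local Notation mu := (@completed_lebesgue_measure R).
Local Notation T := (@lebesgue_type R).
Local Notation U01 := (@unit_interval R).
Context (k : subfamily) (G : R -> set X) (h : R -> \bar R).
Local Notation s phi t := (support_fun phi (G t)).
Hypotheses (mh : measurable_fun (U01 : set T) h) (h0 : forall t, U01 t -> (0 <= h t)%E)
  (ih : (\int[mu]_(t in U01) h t < +oo)%E)
  (ms : forall phi : dual X, measurable_fun (U01 : set T) (fun t => s phi t))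
  (s0 : forall (phi : dual X) t, U01 t -> (0 <= s phi t)%E)
  (sh : forall (phi : dual X) (M : R), 0 <= M -> (forall z, `|phi z| <= M * `|z|) ->
    forall t, U01 t -> (s phi t <= M%:E * h t)%E)
  (interval_integral : forall a b : R, 0 <= a -> a <= b -> b <= 1 ->
    exists2 N : set X, in_subfamily k N & forall phi : dual X,
      support_fun phi N = (\int[mu]_(t in `[a, b]) s phi t)%E).

Let mU : lebesgue_measurable U01.
Proof. exact: lebesgue_measurable_itv. Qed.

Let p (A : set R) (phi : dual X) : R := fine (\int[mu]_(t in A) s phi t)%E.

Let small (A : set R) (e : R) : Prop := (\int[mu]_(t in A) h t < e%:E)%E.

Let int_le (A : set R) (phi : dual X) (M : R) : lebesgue_measurable A -> A `<=` U01 ->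
  0 <= M -> (forall z, `|phi z| <= M * `|z|) ->
  (\int[mu]_(t in A) s phi t <= M%:E * \int[mu]_(t in A) h t)%E.
Proof.
move=> mA AU M0 phiM.
have hA t : A t -> (0 <= h t)%E by move=> /AU/h0.
have mhA : measurable_fun (A : set T) h by exact: measurable_funS mh.
rewrite -(ge0_integralZl_EFin mu mA hA mhA M0); apply: ge0_le_integral.
- exact: mA.
- by move=> t /AU; exact: s0.
- exact: measurable_funS (ms phi).
- exact: measurable_funeM.
- by move=> t /AU; exact: sh.
Qed.

Let int_h_fin (A : set R) : lebesgue_measurable A -> A `<=` U01 ->
  (\int[mu]_(t in A) h t)%E \is a fin_num.
Proof.
move=> mA AU; rewrite ge0_fin_numE; last by apply: integral_ge0 => t /AU/h0.
by apply: le_lt_trans ih; exact: (ge0_subset_integral mu mA mU mh h0 AU).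
Qed.

Let int_fin (A : set R) (phi : dual X) : lebesgue_measurable A -> A `<=` U01 ->
  (\int[mu]_(t in A) s phi t)%E \is a fin_num.
Proof.
move=> mA AU; rewrite ge0_fin_numE; last by apply: integral_ge0 => t /AU; exact: s0.
have [M M0 phiM] := dual_bounded phi.
apply: le_lt_trans (int_le mA AU (ltW M0) phiM) _.
by rewrite -(fineK (int_h_fin mA AU)) -EFinM ltry.
Qed.

Let pE (A : set R) (phi : dual X) : lebesgue_measurable A -> A `<=` U01 ->
  (\int[mu]_(t in A) s phi t = (p A phi)%:E)%E.
Proof. by move=> mA AU; rewrite /p fineK// int_fin. Qed.

Let p_ge0 (A : set R) (phi : dual X) : A `<=` U01 -> 0 <= p A phi.
Proof. by move=> AU; apply/fine_ge0/integral_ge0 => t /AU; exact: s0. Qed.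

Let pU (A B : set R) (phi : dual X) : lebesgue_measurable A -> lebesgue_measurable B ->
  A `<=` U01 -> B `<=` U01 -> [disjoint A & B] -> p (A `|` B) phi = p A phi + p B phi.
Proof.
move=> mA mB AU BU AB.
have ABU : A `|` B `<=` U01 by move=> t [/AU|/BU].
have mAB : lebesgue_measurable (A `|` B) by exact: measurableU.
apply: EFin_inj; rewrite EFinD -!pE//.
apply: (ge0_integral_setU mu mA mB _ _ AB).
  exact: measurable_funS (ms phi).
by move=> t /ABU; exact: s0.
Qed.

Let good (A : set R) : Prop := exists C, supports C (p A).

Let goodU (A B : set R) : lebesgue_measurable A -> lebesgue_measurable B ->
  A `<=` U01 -> B `<=` U01 -> [disjoint A & B] -> good A -> good B -> good (A `|` B).
Proof.
move=> mA mB AU BU AB [C CA] [D DB].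
exists [set x1 + x2 | x1 in C & x2 in D].
have -> : p (A `|` B) = (fun phi => p A phi + p B phi).
  by apply/funext => phi; exact: pU.
exact: supportsD.
Qed.

(** [p A - p D] is the difference of the values on the two set differences, each between 0 and
    [e * M], so [support_limit] applies. *)
Let good_limit (A : set R) : lebesgue_measurable A -> A `<=` U01 ->
  (forall e : R, 0 < e -> exists D, [/\ lebesgue_measurable D, D `<=` U01, good D,
     small (D `\` A) e & small (A `\` D) e]) -> supports (polar (p A)) (p A).
Proof.
move=> mA AU appr; apply: support_limit => e e0.
have [D [mD DU [C CD] sDA sAD]] := appr e e0.
exists C, (p D); split => // phi M M0 phiM.
have split2 (B1 B2 : set R) : lebesgue_measurable B1 -> lebesgue_measurable B2 ->
    B1 `<=` U01 -> p B1 phi = p (B1 `&` B2) phi + p (B1 `\` B2) phi.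
  move=> m1 m2 B1U; rewrite -pU; [by rewrite setUIDK|exact: measurableI|exact: measurableD| | |].
  - by move=> t [/B1U].
  - by move=> t [/B1U].
  - by apply/eqP; rewrite -subset0 => t [[_ B2t] [_]]; exact.
have bound (B : set R) : lebesgue_measurable B -> B `<=` U01 -> small B e -> p B phi <= e * M.
  move=> mB BU sB; rewrite -lee_fin -pE//; apply: le_trans (int_le mB BU M0 phiM) _.
  by rewrite mulrC EFinM; apply: lee_wpmul2l; [rewrite lee_fin|exact: ltW].
rewrite (split2 A D)// (split2 D A)// setIC.
have mDA : lebesgue_measurable (D `\` A) by exact: measurableD.
have mAD : lebesgue_measurable (A `\` D) by exact: measurableD.
have DAU : D `\` A `<=` U01 by move=> t [/DU].
have ADU : A `\` D `<=` U01 by move=> t [/AU].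
have := bound _ mDA DAU sDA; have := bound _ mAD ADU sAD.
have := p_ge0 phi DAU; have := p_ge0 phi ADU.
rewrite ler_norml; move: (p _ _) (p _ _) (p _ _) (e * M) => w x y z h1 h2 h3 h4.
by apply/andP; split; lra.
Qed.

Let p_null (A : set R) (phi : dual X) : lebesgue_measurable A -> A `<=` U01 ->
  mu A = 0%E -> p A phi = 0.
Proof.
move=> mA AU A0; apply: EFin_inj; rewrite -pE//.
by apply: null_set_integral; [exact: mA|exact: measurable_funS (ms phi)|exact: A0].
Qed.

Let good_null (A : set R) : lebesgue_measurable A -> A `<=` U01 -> mu A = 0%E -> good A.
Proof.
move=> mA AU A0; exists [set 0]; split; first by exists 0.
  by move=> x y t -> -> _ _; rewrite /= !scaler0 addr0.
move=> phi; rewrite p_null//; apply/eqP; rewrite eq_le; apply/andP; split.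
  by apply: support_fun_le => x ->; rewrite linear0.
by have := @support_fun_ge _ _ phi [set 0] 0 erefl; rewrite linear0.
Qed.

Let good_itv (x y : R) : 0 <= x -> x <= y -> y <= 1 -> good `[x, y[.
Proof.
move=> x0 xy y1; have [N [[N0 cN vN] _] Ns] := interval_integral x0 xy y1.
exists N; split => //; first exact/convex_setP.
move=> phi; rewrite Ns.
have mxy : lebesgue_measurable `[x, y] by exact: lebesgue_measurable_itv.
have mxyo : lebesgue_measurable `[x, y[ by exact: lebesgue_measurable_itv.
have myy : lebesgue_measurable `[y, y] by exact: lebesgue_measurable_itv.
have xyU : `[x, y]%classic `<=` U01.
  move=> t; rewrite /unit_interval /= !in_itv /= => /andP[xt ty].
  by rewrite (le_trans x0 xt) (le_trans ty y1).
have xyE : `[x, y]%classic = `[x, y[%classic `|` `[y, y]%classic.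
  by rewrite -itv_bndbnd_setU// bnd_simp.
have s1 : `[x, y[%classic `<=` U01 by move=> t ?; apply: xyU; rewrite xyE; left.
have s2 : `[y, y]%classic `<=` U01 by move=> t ?; apply: xyU; rewrite xyE; right.
rewrite pE// xyE pU//.
  rewrite (p_null phi myy s2) ?addr0//.
  by rewrite lebesgue_itv /= ltxx.
apply/eqP; rewrite -subset0 => t [/=]; rewrite !in_itv /= => /andP[_ ty] /andP[yt _].
by have := lt_le_trans ty yt; rewrite ltxx.
Qed.

Let cell n i : set R := `[grid 0 1 n i, grid 0 1 n i.+1[%classic.

Let cells (U : set R) n j : set R :=
  [set t | exists2 i, (i < j)%N & cell n i t /\ cell n i `<=` U].

Let cellsS U n j :
  cells U n j.+1 = cells U n j `|` (if `[< cell n j `<=` U >] then cell n j else set0).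
Proof.
apply/seteqP; split => t.
  move=> [i]; rewrite ltnS leq_eqVlt => /orP[/eqP ->|ij] [ci cU].
    by right; rewrite asboolT.
  by left; exists i.
move=> [[i ij ci]|]; first by exists i => //; exact: ltnW.
by case: asboolP => // cU cj; exists j.
Qed.

Let cells_good U n j : (j <= n.+1)%N ->
  [/\ lebesgue_measurable (cells U n j), cells U n j `<=` U01 & good (cells U n j)].
Proof.
have l01 : (0 : R) <= 1 by [].
elim: j => [_|j IH jn].
  have -> : cells U n 0 = set0 by rewrite -subset0 => t [].
  split => //; first exact: measurable0.
  by apply: good_null; [exact: measurable0|exact: sub0set|exact: measure0].
have [mc cU gc] := IH (ltnW jn); rewrite cellsS.
have mcell : lebesgue_measurable (cell n j) by exact: lebesgue_measurable_itv.
have /andP[j0 _] := grid_in l01 (ltnW jn); have /andP[_ j1] := grid_in l01 jn.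
have cellU : cell n j `<=` U01.
  move=> t; rewrite /cell /unit_interval /= !in_itv /= => /andP[jt tj].
  by rewrite (le_trans j0 jt) (le_trans (ltW tj) j1).
case: asboolP => _; last by rewrite setU0.
split; [exact: measurableU|by move=> t [/cU|/cellU]|].
apply: goodU => //; last by apply: good_itv => //; exact: grid_mono.
apply/eqP; rewrite -subset0 => t [[i ij [ci _]]].
move: ci; rewrite /cell /= !in_itv /= => /andP[_ ti] /andP[jt _].
have := lt_le_trans ti (le_trans (grid_mono n l01 ij) jt).
by rewrite ltxx.
Qed.

(** The cells inside [U] exhaust its trace up to the point 1, which no half-open cell contains. *)
Let good_open U : open U -> good (U `&` U01).
Proof.
move=> oU; have mO := lebesgue_measurable_open oU.
pose A := U `&` U01.
have mA : lebesgue_measurable A by exact: measurableI.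
have AU : A `<=` U01 by exact: subIsetr.
exists (polar (p A)); apply: good_limit => // e e0.
have [d d0 dP] := ge0_integral_small mU mh h0 ih e0.
pose D n := cells U n n.+1.
have DP n := @cells_good U n n.+1 (leqnn _).
have mD n : lebesgue_measurable (D n) by case: (DP n).
have DU n : D n `<=` U01 by case: (DP n).
have DA n : D n `<=` A.
  by move=> t Dt; split; [case: Dt => i _ [ci cU]; exact: cU|exact: DU Dt].
(* Successive uniform partitions do not refine each other, so the sets [D n] need not increase; tail
   unions of the remainders do decrease. *)
pose E n := \bigcup_(m in [set m | (n <= m)%N]) (A `\` D m).
have mE n : lebesgue_measurable (E n).
  by apply: (@bigcup_measurable _ T) => m _; apply: measurableD; [exact: mA|exact: mD].
have EA n : E n `<=` A by move=> t [m _ []].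
have mE' : lebesgue_measurable (\bigcap_n E n) by apply: (@bigcapT_measurable _ T).
have E1 : \bigcap_n E n `<=` [set 1].
  move=> t Et; have [Ut Ut1] := EA 0%N t (Et 0%N Logic.I).
  move: Ut1; rewrite /unit_interval /= in_itv /= => /andP[t0 t1].
  have [->//|tn1] := eqVneq t 1.
  have t01 : 0 <= t < 1 by rewrite t0 lt_neqAle tn1.
  exfalso; have /nbhs_ballP[r /= r0 rU] : nbhs t U by exact: open_nbhs_nbhs.
  have [N NP] := grid_mesh 0 1 r0.
  have [m /= Nm [_]] := Et N Logic.I; apply.
  have l01 : (0 : R) < 1 by [].
  have [i im /andP[it ti]] := grid_cell m l01 t01.
  exists i => //; split; first by rewrite /cell /= in_itv /= it.
  move=> u; rewrite /cell /= in_itv /= => /andP[iu ui]; apply: rU.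
  rewrite -ball_normE /= ltr_norml.
  have := NP m Nm; rewrite -(gridS 0 1 m i); move: it ti iu ui.
  move: (grid 0 1 m i) (grid 0 1 m i.+1) => x y tx yt ux yu yx.
  by apply/andP; split; lra.
have [n nd] : exists n, (mu (E n) < d%:E)%E.
  apply: contrapT => /forallNP no.
  have Efin : (mu (E 0%N) < +oo)%E.
    apply: (@le_lt_trans _ _ (mu U01)).
      by apply: le_outer_measure => t /EA/AU.
    by rewrite /unit_interval lebesgue_itv /= lte_fin ltr01 -EFinB ltry.
  have niE : nonincreasing_seq E.
    move=> m n mn; apply/subsetPset => t [j /= nj Aj].
    by exists j => //=; exact: leq_trans nj.
  have E0 : mu (\bigcap_n E n) = 0%E.
    apply/eqP; rewrite eq_le measure_ge0 andbT.
    apply: (@le_trans _ _ (mu `[1, 1])).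
      by apply: le_outer_measure => t /E1 ->; rewrite /= in_itv /= lexx.
    by rewrite lebesgue_itv /= ltxx.
  have cE : (mu \o E) n @[n --> \oo] --> 0%E.
    by rewrite -E0; exact: (nonincreasing_cvg_mu Efin mE mE' niE).
  have : (d%:E <= limn (mu \o E))%E.
    apply: lime_ge; first by apply/cvg_ex; exists 0%E.
    by apply: nearW => n; rewrite leNgt; apply/negP; exact: no.
  by rewrite (cvg_lim _ cE)// leNgt lte_fin d0.
exists (D n); split => //; first by case: (DP n).
  rewrite /small (_ : D n `\` A = set0) ?integral_set0//.
  by rewrite -subset0 => t [/DA].
apply: dP; [by apply: measurableD; [exact: mA|exact: mD]|by move=> t [/AU]|].
apply: le_lt_trans nd; apply: le_outer_measure => t [At nDt].
by exists n => //=.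
Qed.

Lemma pettis_integrable_of_intervals : pettis_integrable k G.
Proof.
split=> [phi|A mA AU].
  apply/integrableP; split; first exact: ms.
  under eq_integral => t /set_mem Ut do rewrite gee0_abs ?s0//.
  by rewrite pE// ltry.
have supA : supports (polar (p A)) (p A).
  apply: good_limit => // e e0.
  have [d d0 dP] := ge0_integral_small mU mh h0 ih e0.
  have d20 : 0 < d / 2 by rewrite divr_gt0.
  have [U [oU AO muU]] := lebesgue_open_cover A d20.
  have mO := lebesgue_measurable_open oU.
  exists (U `&` U01); split.
  - exact: measurableI.
  - exact: subIsetr.
  - exact: good_open.
  - apply: dP; [by apply: measurableD => //; exact: measurableI|by move=> t [[]]|].
    have Afin : mu A \is a fin_num.
      rewrite ge0_fin_numE ?measure_ge0//; apply: (@le_lt_trans _ _ (mu U01)).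
        exact: le_outer_measure.
      by rewrite /unit_interval lebesgue_itv /= lte_fin ltr01 -EFinB ltry.
    have UE : (mu U = mu (U `\` A) + mu A)%E.
      by rewrite {2}(_ : A = U `&` A); [exact: (measureDI mu mO mA)|rewrite setIidr].
    apply: (@le_lt_trans _ _ (mu (U `\` A))).
      by apply: le_outer_measure => t [[]].
    apply: (@le_lt_trans _ _ (d / 2)%:E); last by rewrite lte_fin ltr_pdivrMr// ltr_pMr// ltr1n.
    by move: muU; rewrite UE addeC leeD2lE.
  - rewrite /small (_ : A `\` (U `&` U01) = set0) ?integral_set0//.
    by rewrite -subset0 => t [At]; apply; split; [exact: AO|exact: AU].
exists (polar (p A)); last by move=> phi; have [_ _ ->] := supA; rewrite pE.
have l01 : (0 : R) <= 1 by [].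
have [N Nk Ns] := interval_integral (lexx 0) l01 (lexx 1).
(* Nonnegative support functions give [p A <= p U01], so the polar lies inside the integral over the
   unit interval. *)
apply: (@in_subfamily_polar _ _ k N (p A) (p U01)) => //.
  by move=> phi; rewrite Ns pE.
move=> phi; rewrite -lee_fin -!pE//.
by apply: (ge0_subset_integral mu mA mU (ms phi) _ AU) => t; exact: s0.
Qed.

End measurable_sets_from_intervals.

(** * Translates, diameters and upper integrals *)

Section translates.
Context {R : realType} {X : completeNormedModType R}.
Local Notation mu := (@completed_lebesgue_measure R).
Local Notation T := (@lebesgue_type R).
Local Notation U01 := (@unit_interval R).
Implicit Types (phi : dual X) (C : set X) (y : X).

Lemma support_fun_translate phi C y :
  support_fun phi [set x - y | x in C] = (support_fun phi C - (phi y : R)%:E)%E.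
Proof.
apply/eqP; rewrite eq_le; apply/andP; split.
  apply: support_fun_le => _ [x Cx <-]; rewrite linearB EFinB.
  by apply: leeB => //; exact: support_fun_ge.
rewrite leeBlDr//; apply: support_fun_le => x Cx.
have -> : (phi x : R)%:E = ((phi (x - y) : R)%:E + (phi y : R)%:E)%E.
  by rewrite -EFinD linearB /= subrK.
by apply: leeD2r; apply: support_fun_ge; exists x.
Qed.

Lemma support_fun1 phi y : support_fun phi [set y] = (phi y : R)%:E.
Proof. by rewrite /support_fun image_set1 ereal_sup1. Qed.

Lemma diam_ge C x y : C x -> C y -> (`|x - y|%:E <= diam C)%E.
Proof. by move=> Cx Cy; apply: ereal_sup_ubound; exists (x, y). Qed.

Lemma diam_le C (c : \bar R) : (forall x y, C x -> C y -> (`|x - y|%:E <= c)%E) ->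
  (diam C <= c)%E.
Proof. by move=> h; apply: ge_ereal_sup => _ [[x y] [/= Cx Cy] <-]; exact: h. Qed.

Lemma hnorm_le C (c : \bar R) : (forall x, C x -> (`|x|%:E <= c)%E) -> (hnorm C <= c)%E.
Proof. by move=> h; apply: ge_ereal_sup => _ [x Cx <-]; exact: h. Qed.

Lemma diam_translate C y : (diam [set (x + y)%R | x in C] <= diam C)%E.
Proof.
apply: diam_le => _ _ [x Cx <-] [x' Cx' <-].
by rewrite opprD addrACA subrr addr0; exact: diam_ge.
Qed.

Lemma in_subfamily0 k : in_subfamily k [set (0 : X)].
Proof.
split; last by case: k; [apply: compact_bounded; exact: compact_set1|
  exact: (@compact_set1 (weak_topology X))|exact: compact_set1].
split; first by exists 0.
  by apply: accessible_closed_set1; apply: hausdorff_accessible; exact: norm_hausdorff.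
by apply/convex_setP => x y t -> -> _ _; rewrite /= !scaler0 addr0.
Qed.

Lemma upper_integral01_ltyP (g : R -> \bar R) : (upper_integral01 g < +oo)%E <->
  exists h : R -> \bar R, [/\ measurable_fun (U01 : set T) h,
    forall t, U01 t -> (g t <= h t)%E & (\int[mu]_(t in U01) h t < +oo)%E].
Proof.
split=> [/ereal_inf_lt[_ [h [mh gh] <-] ih]|[h [mh gh ih]]]; first by exists h.
by apply: le_lt_trans ih; apply: ereal_inf_lbound; exists h.
Qed.

Lemma upper_integral01_le_lty (g1 g2 : R -> \bar R) :
  (forall t, U01 t -> (g1 t <= g2 t)%E) ->
  (upper_integral01 g2 < +oo)%E -> (upper_integral01 g1 < +oo)%E.
Proof.
move=> g12 /upper_integral01_ltyP[h [mh gh ih]]; apply/upper_integral01_ltyP.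
by exists h; split => // t Ut; exact: le_trans (g12 t Ut) (gh t Ut).
Qed.

Lemma upper_integral01_ae_bounded (g : R -> \bar R) (c : R) :
  {ae mu, forall t : R, U01 t -> (g t <= c%:E)%E} -> (upper_integral01 g < +oo)%E.
Proof.
move=> [Z [mZ Z0 PZ]]; apply/upper_integral01_ltyP.
have mU : lebesgue_measurable U01 by exact: lebesgue_measurable_itv.
(* [upper_integral01] asks for majorants at every point of the interval, so the exceptional null set
   gets the value [+oo]. *)
pose h t : \bar R := if t \in Z then +oo%E else c%:E.
have hE : {ae mu, forall t, U01 t -> cst c%:E t = h t}.
  exists Z; split => // t /= /not_implyP[_]; apply: contra_notP => nZ.
  by rewrite /h memNset.
have mh : measurable_fun (U01 : set T) h.
  apply: (ae_measurable_fun (@completed_lebesgue_measure_is_complete R) hE).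
  exact: measurable_cst.
exists h; split => // [t Ut|].
  rewrite /h; case: (boolP (t \in Z)) => [_|]; first exact: leey.
  rewrite notin_setE => nZ; apply: contrapT => ngc; apply/nZ/PZ => /=.
  by move=> /(_ Ut).
have -> : (\int[mu]_(t in U01) h t = \int[mu]_(t in U01) (cst c%:E) t)%E.
  apply: ae_eq_integral; [exact: mU|exact: mh|exact: measurable_cst|].
  by apply: (aeS _ hE) => t E Ut; rewrite E.
have U1 : mu U01 = 1%:E.
  by rewrite /unit_interval lebesgue_itv /= lte_fin ltr01 -EFinB subr0.
by rewrite (integral_cst mu mU) [X in (_ * X)%E]U1 mule1 ltry.
Qed.

End translates.

(** * Uniform treatment of the scalar integrals *)

Section scalar_senses.
Context {R : realType} {X : completeNormedModType R}.
Local Notation mu := (@completed_lebesgue_measure R).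
Local Notation T := (@lebesgue_type R).
Local Notation U01 := (@unit_interval R).

(** The weakly McShane sense is handled through its Henstock-Kurzweil integrals. In the Pettis sense
    integrability is recorded as well, because additivity of the integral relies on it. *)
Definition scalar_integral (sense : scalar_sense) (a b : R) (g : R -> \bar R) (v : R) : Prop :=
  match sense with
  | Pettis => mu.-integrable `[a, b] g /\ (\int[mu]_(t in `[a, b]) g t = v%:E)%E
  | DenjoyKhintchinePettis => DK_integral a b g v
  | _ => HK_integral a b g v
  end.

Let sub01 (a b : R) : 0 <= a -> b <= 1 -> `[a, b]%classic `<=` U01.
Proof.
move=> a0 b1 t; rewrite /unit_interval /= !in_itv /= => /andP[at_ tb].
by rewrite (le_trans a0 at_) (le_trans tb b1).
Qed.

Lemma integrable_in_itv sense k (Gamma : R -> set X) (a b : R) :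
    integrable_in sense k Gamma -> 0 <= a -> a <= b -> b <= 1 ->
  exists2 N : set X, in_subfamily k N & forall phi : dual X, exists2 v : R,
    scalar_integral sense a b (fun t => support_fun phi (Gamma t)) v & support_fun phi N = v%:E.
Proof.
have mD : lebesgue_measurable `[a, b] by exact: lebesgue_measurable_itv.
have mU : lebesgue_measurable U01 by exact: lebesgue_measurable_itv.
case: sense => /= [[int P]|[[_ P] _]|[_ P]|[_ P]] a0 ab b1; last 3 first.
- exact: P.
- exact: P.
- exact: P.
have [N Nk NP] := P _ mD (sub01 a0 b1); exists N => // phi.
have intD : mu.-integrable `[a, b] (fun t => support_fun phi (Gamma t)).
  exact: (integrableS mU mD (sub01 a0 b1) (int phi)).
have fin := integrable_fin_num mD intD.
exists (fine (\int[mu]_(t in `[a, b]) support_fun phi (Gamma t))%E).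
  by split => //; rewrite fineK.
by rewrite NP fineK.
Qed.

Lemma scalar_integral_dominated sense (a b : R) (g1 g2 g h : R -> \bar R) v1 v2 :
    0 <= a -> a < b -> b <= 1 ->
    scalar_integral sense a b g1 v1 -> scalar_integral sense a b g2 v2 ->
    mu.-integrable `[a, b] h ->
    {ae mu, forall t : R, a <= t <= b -> (g1 t + g2 t = g t)%E} ->
    {ae mu, forall t : R, a <= t <= b -> (0 <= g t <= h t)%E} ->
  measurable_fun (`[a, b] : set T) g /\ (\int[mu]_(t in `[a, b]) g t = (v1 + v2)%:E)%E.
Proof.
case: sense => a0 ab b1; [|exact: HK_dominated|exact: HK_dominated|exact: DK_dominated].
move=> [int1 E1] [int2 E2] _ gE _.
have mD : lebesgue_measurable `[a, b] by exact: lebesgue_measurable_itv.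
have m12 := emeasurable_funD (measurable_int mu int1) (measurable_int mu int2).
have gE' : {ae mu, forall t, `[a, b]%classic t -> (g1 t + g2 t = g t)%E}.
  by apply: (aeS _ gE) => t H Dt; apply: H; move: Dt; rewrite /= in_itv.
have mg := ae_measurable_fun (@completed_lebesgue_measure_is_complete R) gE' m12.
split => //; rewrite EFinD -E1 -E2 -(integralD mD int1 int2).
apply: ae_eq_integral; [exact: mD|exact: mg|exact: m12|].
by apply: (aeS _ gE') => t E Dt; rewrite E.
Qed.

(* Domination applied to phi f + (- phi) f = 0 makes the support function of the
   integral of f odd, so that the integral is a single point. *)
Lemma integrable_in_point sense k (f : R -> X) (a b : R) :
    integrable_in sense k (fun t => [set f t]) -> 0 <= a -> a < b -> b <= 1 ->
  exists y : X, forall phi : dual X,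
    scalar_integral sense a b (fun t => (phi (f t) : R)%:E) (phi y).
Proof.
move=> intf a0 ab b1.
have [N [[[y Ny] _ _] _] NP] := integrable_in_itv intf a0 (ltW ab) b1.
exists y => phi; have [psi psiE] := dualN phi.
have mD : lebesgue_measurable `[a, b] by exact: lebesgue_measurable_itv.
have [v1 V1 N1] := NP phi; have [v2 V2 N2] := NP psi.
have int0 : mu.-integrable `[a, b] (cst 0%E) by exact: integrable0.
have sumE : {ae mu, forall t : R, a <= t <= b ->
    (support_fun phi [set f t] + support_fun psi [set f t] = cst 0 t)%E}.
  by apply: (@aeW _ T R mu) => t _; rewrite !support_fun1 psiE -EFinD subrr.
have dom0 : {ae mu, forall t : R, a <= t <= b -> (0 <= (cst 0 t : \bar R) <= cst 0 t)%E}.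
  by apply: (@aeW _ T R mu) => t _; rewrite lexx.
have [_] := scalar_integral_dominated a0 ab b1 V1 V2 int0 sumE dom0.
rewrite integral0 => -[v0].
(* As [v1 + v2 = 0], the inequalities [phi y <= v1] and [- phi y <= v2] are equalities. *)
have y1 : phi y <= v1 by rewrite -lee_fin -N1; exact: support_fun_ge.
have y2 : - phi y <= v2 by rewrite -psiE -lee_fin -N2; exact: support_fun_ge.
have -> : phi y = v1 :> R by apply/eqP; rewrite eq_le y1; lra.
rewrite (_ : (fun t => _) = (fun t => support_fun phi [set f t]))//.
by apply/funext => t; rewrite support_fun1.
Qed.

End scalar_senses.

(** * Decomposition and finite variation *)

Section main_results.
Context {R : realType} {X : completeNormedModType R}.
Local Notation mu := (@completed_lebesgue_measure R).
Local Notation T := (@lebesgue_type R).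
Local Notation U01 := (@unit_interval R).
Implicit Types (Gamma G : R -> set X) (f : R -> X) (phi : dual X).

Let mU : lebesgue_measurable U01.
Proof. exact: lebesgue_measurable_itv. Qed.

Lemma support_fun_bounds C phi (M : R) : C (0 : X) -> 0 <= M ->
    (forall z, `|phi z| <= M * `|z|) ->
  (0 <= support_fun phi C)%E /\ (support_fun phi C <= M%:E * diam C)%E.
Proof.
move=> C0 M0 phiM; split; first by have := support_fun_ge phi C0; rewrite linear0.
apply: support_fun_le => x Cx; apply: (@le_trans _ _ (M%:E * `|x|%:E)%E).
  by rewrite -EFinM lee_fin; apply: le_trans (phiM x); exact: ler_norm.
by apply: lee_wpmul2l; [rewrite lee_fin|rewrite -[x]subr0; exact: diam_ge].
Qed.

Lemma pettis_integrable_translate sense k Gamma f (h : R -> \bar R) :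
    is_multifunction01 Gamma -> integrable_in sense k Gamma ->
    integrable_selection sense k Gamma f ->
    measurable_fun (U01 : set T) h -> (forall t, U01 t -> (diam (Gamma t) <= h t)%E) ->
    (\int[mu]_(t in U01) h t < +oo)%E ->
  pettis_integrable k (fun t => [set x - f t | x in Gamma t]).
Proof.
move=> cG intG [self intf] mh Dh ih; set G := fun t => _.
have G0 t : U01 t -> G t 0 by move=> Ut; exists (f t); [exact: self|rewrite subrr].
have DG t : U01 t -> (diam (G t) <= h t)%E.
  move=> Ut; apply: le_trans (Dh t Ut); exact: (diam_translate _ (- f t)).
have h0 t : U01 t -> (0 <= h t)%E.
  move=> Ut; apply: le_trans (DG t Ut).
  by have := diam_ge (G0 t Ut) (G0 t Ut); rewrite subrr normr0.
have s0 phi t : U01 t -> (0 <= support_fun phi (G t))%E.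
  move=> Ut; have [M M0 phiM] := dual_bounded phi.
  by have [] := support_fun_bounds (G0 t Ut) (ltW M0) phiM.
have sh phi (M : R) : 0 <= M -> (forall z, `|phi z| <= M * `|z|) ->
    forall t, U01 t -> (support_fun phi (G t) <= M%:E * h t)%E.
  move=> M0 phiM t Ut; have [_ H] := support_fun_bounds (G0 t Ut) M0 phiM.
  by apply: le_trans H _; apply: lee_wpmul2l; [rewrite lee_fin|exact: DG].
have inth : mu.-integrable U01 h.
  apply/integrableP; split => //.
  by under eq_integral => t /set_mem Ut do rewrite gee0_abs ?h0//.
have sub01 (a b : R) : 0 <= a -> b <= 1 -> `[a, b]%classic `<=` U01.
  move=> a0 b1 t; rewrite /unit_interval /= !in_itv /= => /andP[at_ tb].
  by rewrite (le_trans a0 at_) (le_trans tb b1).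
have in01 (a b t : R) : 0 <= a -> b <= 1 -> a <= t <= b -> U01 t.
  by move=> a0 b1 tab; apply: (sub01 a b) => //=; rewrite in_itv.
(* The support function of [G t] at [phi] is that of [Gamma t] plus that of [[set f t]] at the
   opposite functional [psi], and [M%:E * h t] dominates this sum. *)
have value (a b : R) : 0 <= a -> a < b -> b <= 1 -> exists2 N : set X, in_subfamily k N &
    forall phi, measurable_fun (`[a, b] : set T) (fun t => support_fun phi (G t)) /\
    support_fun phi N = (\int[mu]_(t in `[a, b]) support_fun phi (G t))%E.
  move=> a0 ab b1.
  have mD : lebesgue_measurable `[a, b] by exact: lebesgue_measurable_itv.
  have [N Nk NP] := integrable_in_itv intG a0 (ltW ab) b1.
  have [y yP] := integrable_in_point intf a0 ab b1.
  exists [set x - y | x in N]; first exact: in_subfamily_translate.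
  move=> phi; have [psi psiE] := dualN phi; have [M M0 phiM] := dual_bounded phi.
  have [v V Nv] := NP phi.
  have inthD : mu.-integrable `[a, b] (fun t => M%:E * h t)%E.
    apply: integrableZl; first exact: mD.
    exact: (integrableS mU mD (sub01 a b a0 b1) inth).
  have [||ms E] := scalar_integral_dominated a0 ab b1 V (yP psi) inthD
      (g := fun t => support_fun phi (G t)).
  - by apply: (@aeW _ T R mu) => t _; rewrite support_fun_translate psiE EFinN.
  - apply: (@aeW _ T R mu) => t tab; have Ut := in01 a b t a0 b1 tab.
    by rewrite s0//= sh// ltW.
  by split => //; rewrite E support_fun_translate Nv psiE.
have ms phi : measurable_fun (U01 : set T) (fun t => support_fun phi (G t)).
  by have [N _ /(_ phi)[]] := value 0 1 (lexx 0) ltr01 (lexx 1).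
apply: (@pettis_integrable_of_intervals _ _ k G h) => // a b a0 ab b1.
(* Domination asks for [a < b]; over a degenerate interval the integral is [[set 0]]. *)
have [<-|ab'] := eqVneq a b; last first.
  have [|N Nk NP] := value a b a0 _ b1; first by rewrite lt_neqAle ab'.
  by exists N => // phi; have [] := NP phi.
exists [set 0]; first exact: in_subfamily0.
move=> phi; rewrite support_fun1 linear0.
have a1 : a <= 1 by exact: le_trans ab b1.
have ma : lebesgue_measurable `[a, a] by exact: lebesgue_measurable_itv.
apply/esym/null_set_integral; first exact: ma.
  exact: measurable_funS mU (sub01 a a a0 a1) (ms phi).
by apply: etrans (lebesgue_itv _) _; rewrite /= ltxx.
Qed.

Lemma DL_decomposition_zero sense k Gamma G f : DL_decomposition sense k Gamma G f ->
  forall t, U01 t -> G t 0.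
Proof.
move=> [_ tr [self _] _ _] t Ut; have := self t Ut; rewrite tr// => -[x Gx].
by rewrite -[RHS]add0r => /addIr <-.
Qed.

Lemma DL_decomposition_diam sense k Gamma G f : DL_decomposition sense k Gamma G f ->
  forall t, U01 t -> (diam (Gamma t) <= diam (G t))%E.
Proof. by move=> [_ tr _ _ _] t Ut; rewrite tr//; exact: diam_translate. Qed.

Lemma DL_decomposition_exists sense k Gamma f : is_multifunction01 Gamma ->
    integrable_in sense k Gamma -> integrable_selection sense k Gamma f ->
    DL_condition Gamma ->
  DL_decomposition sense k Gamma (fun t => [set x - f t | x in Gamma t]) f.
Proof.
move=> cG intG self DL; have /upper_integral01_ltyP[h [mh Dh ih]] := DL; split => //.
- by move=> t Ut; exact/closed_convex_translate/cG.
- move=> t Ut; apply/seteqP; split => [x Gx|_ [_ [x Gx <-] <-]]; last by rewrite subrK.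
  by exists (x - f t); [exists x|rewrite subrK].
- exact: pettis_integrable_translate intG self mh Dh ih.
- apply: upper_integral01_le_lty DL => t Ut; exact: (diam_translate _ (- f t)).
Qed.

Lemma Db_condition_DL Gamma : Db_condition Gamma -> DL_condition Gamma.
Proof. by move=> [c]; exact: upper_integral01_ae_bounded. Qed.

Lemma norm_attaining_dual (x : X) : exists2 phi : dual X,
  (forall z, `|phi z| <= `|z|) & `|x| <= phi x.
Proof.
have [||_ ->|phi phi1 phix] := @separation _ _ [set 0] x `|x|.
- by exists 0.
- by move=> u v t -> -> _ _; rewrite /= !scaler0 addr0.
- by rewrite subr0.
by exists phi => //; have := phix 0 erefl; rewrite linear0 add0r.
Qed.

(** A functional of norm at most 1 that attains the norm of a point of [M A] bounds this norm by the
    integral of a support function over [A], hence by that of [h]; over a partition the latter add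
    up. *)
Lemma indefinite_pettis_finite_variation k G (M : set R -> set X) (h : R -> \bar R) :
    pettis_integrable k G -> indefinite_pettis_integral k G M ->
    (forall t, U01 t -> G t 0) -> measurable_fun (U01 : set T) h ->
    (forall t, U01 t -> (diam (G t) <= h t)%E) -> (\int[mu]_(t in U01) h t < +oo)%E ->
  finite_variation01 M.
Proof.
move=> [intG _] MP G0 mh Dh ih; apply: le_lt_trans ih.
have h0 t : U01 t -> (0 <= h t)%E.
  move=> Ut; apply: le_trans (Dh t Ut).
  by have := diam_ge (G0 t Ut) (G0 t Ut); rewrite subrr normr0.
have hM A : lebesgue_measurable A -> A `<=` U01 ->
    (hnorm (M A) <= \int[mu]_(t in A) h t)%E.
  move=> mA AU; apply: hnorm_le => x Mx.
  have [phi phi1 xphi] := norm_attaining_dual x.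
  have phi1' z : `|phi z| <= 1 * `|z| by rewrite mul1r.
  have le1 : (`|x|%:E <= support_fun phi (M A))%E.
    by apply: le_trans (support_fun_ge phi Mx); rewrite lee_fin.
  apply: le_trans le1 _.
  have [_ ->] := MP A mA AU.
  have bnd t : A t -> (0 <= support_fun phi (G t) <= h t)%E.
    move=> /AU Ut; have [s0 sD] := support_fun_bounds (G0 t Ut) ler01 phi1'.
    by rewrite s0 /= (le_trans sD)// mul1e Dh.
  apply: ge0_le_integral; first exact: mA.
  - by move=> t /bnd/andP[].
  - exact: measurable_funS mU AU (measurable_int mu (intG phi)).
  - exact: measurable_funS mU AU mh.
  - by move=> t /bnd/andP[].
apply: ge_ereal_sup => _ [n [A [[mA tA UA] ->]]].
have AU i : A i `<=` U01 by rewrite -UA => t At; exists i.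
apply: (@le_trans _ _ (\sum_(i < n) \int[mu]_(t in A i) h t)%E).
  by apply: lee_sum => i _; apply: hM.
have tI : trivIset [set` index_enum 'I_n] A by apply: sub_trivIset tA.
have UE : \big[setU/set0]_(i <- index_enum 'I_n) A i `<=` U01.
  by rewrite -bigcup_seq => t [i _]; apply: AU.
have mB : lebesgue_measurable (\big[setU/set0]_(i <- index_enum 'I_n) A i).
  by apply: (@bigsetU_measurable _ T) => i _; exact: mA.
rewrite -(ge0_integral_bigsetU mu mA (index_enum_uniq _) tI).
- exact: (ge0_subset_integral mu mB mU mh h0 UE).
- exact: measurable_funS mU UE mh.
- by move=> t /UE/h0.
Qed.

End main_results.

Theorem theorem4p1 (R : realType) (X : completeNormedModType R)
    (k : subfamily) (sense : scalar_sense) (Gamma : R -> set X)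
    (Gamma_closed_convex : is_multifunction01 Gamma)
    (Gamma_integrable : integrable_in sense k Gamma)
    (Gamma_selection : exists f : R -> X, integrable_selection sense k Gamma f) :
  [/\ DL_condition Gamma <->
        (exists (G : R -> set X) (f : R -> X), DL_decomposition sense k Gamma G f),
      Db_condition Gamma <->
        (exists (G : R -> set X) (f : R -> X), Db_decomposition sense k Gamma G f) &
      forall (G : R -> set X) (f : R -> X) (M : set R -> set X),
        DL_decomposition sense k Gamma G f -> indefinite_pettis_integral k G M ->
        finite_variation01 M].
Proof.
have [f self] := Gamma_selection; split.
- split=> [DL|[G [g dec]]].
    by exists (fun t => [set x - f t | x in Gamma t]), f; exact: DL_decomposition_exists.
  have [_ _ _ _ DG] := dec.
  exact: upper_integral01_le_lty (DL_decomposition_diam dec) DG.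
- split=> [Db|[G [g [dec [c Gc]]]]].
    exists (fun t => [set x - f t | x in Gamma t]), f; split.
      exact/DL_decomposition_exists/Db_condition_DL.
    have [c Dc] := Db; exists c; apply: (aeS _ Dc) => t D Ut.
    (* As [f t] lies in [Gamma t], norms of points of the translate are distances within
       [Gamma t]. *)
    apply: le_trans (D Ut); apply: hnorm_le => _ [x Gx <-].
    by apply: diam_ge => //; exact: self.1.
  exists (c + c); apply: (aeS _ Gc) => t N Ut.
  apply: le_trans (DL_decomposition_diam dec Ut) _; apply: diam_le => x y Gx Gy.
  have hc z : G t z -> `|z| <= c.
    move=> Gz; rewrite -lee_fin; apply: le_trans (N Ut).
    by apply: ereal_sup_ubound; exists z.
  by rewrite lee_fin (le_trans (ler_normB x y))// lerD ?hc.
- move=> G g M dec MP; have [_ _ _ intG DG] := dec.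
  have /upper_integral01_ltyP[h [mh Dh ih]] := DG.
  exact: indefinite_pettis_finite_variation intG MP (DL_decomposition_zero dec) mh Dh ih.
Qed.
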